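(* Let $p$ be as in the context, fix positive $a_l,a_r$ and consider the Riemann problem with data $\bar u_l,\bar u_r\in A_0$. Define $$l'=\inf\left\{\rho\in[\hat\varphi_l(\bar u_l),\check\varphi_l(\bar u_l)]\colon a_l\,L_1(\rho;\bar u_l)\le a_r\,L_2^-(\hat\varphi_r(\bar u_r);\bar u_r)\right\},$$ $$l''=\sup\left\{\rho\in[\hat\varphi_l(\bar u_l),\check\varphi_l(\bar u_l)]\colon a_l\,L_1(\rho;\bar u_l)\ge a_r\,L_2^-(\check\varphi_r(\bar u_r);\bar u_r)\right\}.$$ A necessary and sufficient condition for the existence and uniqueness of an (L)-solution to the Riemann problem, attaining values in $A_0$, is $$\left\{\begin{array}{rcl} a_l P\left(l',L_1(l';\bar u_l)\right)&\le& a_r P\left(g\left(\frac{a_l}{a_r}L_1(l';\bar u_l)\right),\frac{a_l}{a_r}L_1(l';\bar u_l)\right),\\[4pt] a_l P\left(l'',L_1(l'';\bar u_l)\right)&\ge& a_r P\left(g\left(\frac{a_l}{a_r}L_1(l'';\bar u_l)\right),\frac{a_l}{a_r}L_1(l'';\bar u_l)\right), \end{array}\right.$$ where $g$ is the inverse in $A_0$ of the map $\rho\mapsto L_2^-(\rho;\bar u_r)$.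
   Context: Pressure: $p\in C^2(\mathbb{R}^+;\mathbb{R}^+)$, $\mathbb{R}^+=[0,+\infty[$, with $p'(\rho)>0$ and $p''(\rho)\ge0$ for all $\rho>0$. Write $u=(\rho,q)$, $c(\rho)=\sqrt{p'(\rho)}$, $P(u)=\frac{q^2}{\rho}+p(\rho)$, $\lambda_1(u)=\frac q\rho-c(\rho)$, $\lambda_2(u)=\frac q\rho+c(\rho)$. Subsonic region: $A_0=\{u\in\,]0,+\infty[\times\mathbb{R}\colon\lambda_1(u)<0<\lambda_2(u)\}$. Lax curves, for $u_o=(\rho_o,q_o)$ with $\rho_o>0$: the forward 1-Lax curve is $L_1(\rho;u_o)=\frac{\rho}{\rho_o}q_o-\rho\int_{\rho_o}^\rho\frac{c(r)}r\,dr$ if $\rho\le\rho_o$, and $L_1(\rho;u_o)=\frac{\rho}{\rho_o}q_o-\sqrt{\frac\rho{\rho_o}(\rho-\rho_o)(p(\rho)-p(\rho_o))}$ if $\rho\ge\rho_o$. The reversed 2-Lax curve is $L_2^-(\rho;u_o)=\frac{\rho}{\rho_o}q_o+\rho\int_{\rho_o}^\rho\frac{c(r)}r\,dr$ if $\rho\le\rho_o$, and $L_2^-(\rho;u_o)=\frac{\rho}{\rho_o}q_o+\sqrt{\frac\rho{\rho_o}(\rho-\rho_o)(p(\rho)-p(\rho_o))}$ if $\rho\ge\rho_o$. For $\bar u\in A_0$, the densities $\check\varphi_l(\bar u),\hat\varphi_l(\bar u),\check\varphi_r(\bar u),\hat\varphi_r(\bar u)$ are the $\rho$-components of the intersections of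 the curves $\rho\mapsto(\rho,L_1(\rho;\bar u))$ (index $l$) and $\rho\mapsto(\rho,L_2^-(\rho;\bar u))$ (index $r$) with the boundary of $A_0$; they are uniquely determined by $$\lambda_2\left(\check\varphi_r,L_2^-(\check\varphi_r;\bar u)\right)=0,\quad\lambda_2\left(\check\varphi_l,L_1(\check\varphi_l;\bar u)\right)=0,\quad\lambda_1\left(\hat\varphi_r,L_2^-(\hat\varphi_r;\bar u)\right)=0,\quad\lambda_1\left(\hat\varphi_l,L_1(\hat\varphi_l;\bar u)\right)=0,$$ all evaluated at $\bar u$. Riemann problem: $\partial_t\rho+\partial_xq=0$, $\partial_tq+\partial_x(q^2/\rho+p(\rho))=0$, with $u(0,x)=\bar u_l$ for $x<0$ and $u(0,x)=\bar u_r$ for $x>0$. Given a junction function $\Phi$, a weak $\Phi$-solution is a map $u\in C^0(\mathbb{R}^+;L^1_{loc}(\mathbb{R};]0,+\infty[\times\mathbb{R}))$, with $u(t)$ of bounded variation for a.e. $t\in\mathbb{R}^+$, such that: (1) $\int_{\mathbb{R}^+}\int_{\mathbb{R}}\left((\rho,q)\,\partial_t\phi+(q,P(\rho,q))\,\partial_x\phi\right)dx\,dt=0$ for all $\phi\in C^1_c(]0,+\infty[\times\mathbb{R};\mathbb{R})$ whose support does not intersect $x=0$; (2) $u(0,x)$ coincides with the Riemann initial datum for a.e. $x\in\mathbb{R}$; (3) for a.e. $t\in\mathbb{R}^+$, $\Phi(a_l,u(t,0-);a_r,u(t,0+))=0$. Solutions to Riemann problems are understood to be made of standard Lax waves: on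 $x<0$, $u$ is a (possibly trivial) Lax wave of the first family joining $\bar u_l$ to the trace $u(t,0-)$, so $q(t,0-)=L_1(\rho(t,0-);\bar u_l)$; on $x>0$, $u$ is a (possibly trivial) Lax wave of the second family joining the trace $u(t,0+)$ to $\bar u_r$, so $q(t,0+)=L_2^-(\rho(t,0+);\bar u_r)$. An (L)-solution is a weak $\Phi$-solution for the junction condition $a_lq_l=a_rq_r$ and $a_lP(\rho_l,q_l)=a_rP(\rho_r,q_r)$ on the traces $(\rho_l,q_l)=u(t,0-)$, $(\rho_r,q_r)=u(t,0+)$.
   Formalization: ''Attaining values in A_0'' and the inverse g are taken in the closure λ1 ≤ 0 ≤ λ2, since with the open A_0 the claim fails at equality; that the four sonic densities are uniquely determined for all ū in A_0, which does not follow from the conditions on p, is an explicit hypothesis. *)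

(* Defs.v *)
From HB Require Import structures.
From mathcomp Require Import all_boot all_order all_algebra.
From mathcomp Require Import all_classical all_reals all_analysis.
Set Implicit Arguments.
Unset Strict Implicit.
Unset Printing Implicit Defensive.
Import Order.TTheory GRing.Theory Num.Theory.
Import numFieldNormedType.Exports.
Local Open Scope classical_set_scope.
Local Open Scope ring_scope.

Notation mu R := (@lebesgue_measure R).

Section PSystem.
Variable R : realType.
Implicit Types (p : R -> R) (u ul ur um : R * R) (rho x t al ar : R).

(* C^2 on the closed half-line [0, +oo[: p, p' and p'' are continuous on
   ]0, +oo[ and extend continuously to 0. Values of p at negative arguments
   are irrelevant. *)
Definition C2_halfline p : Prop :=
  [/\ forall rho, 0 < rho -> derivable p rho 1 /\ derivable (derive1 p) rho 1,
      forall rho, 0 < rho -> {for rho, continuous (derive1 (derive1 p))},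
      p rho @[rho --> 0^'+] --> p 0,
      cvg (derive1 p rho @[rho --> 0^'+]) &
      cvg (derive1 (derive1 p) rho @[rho --> 0^'+])].

Definition pressure p : Prop :=
  [/\ C2_halfline p,
      forall rho, 0 <= rho -> 0 <= p rho,
      forall rho, 0 < rho -> 0 < derive1 p rho &
      forall rho, 0 < rho -> 0 <= derive1 (derive1 p) rho].

Definition sound p rho : R := Num.sqrt (derive1 p rho).

Definition flowP p u : R := u.2 ^+ 2 / u.1 + p u.1.

Definition lambda1 p u : R := u.2 / u.1 - sound p u.1.
Definition lambda2 p u : R := u.2 / u.1 + sound p u.1.

Definition A0 p : set (R * R) :=
  [set u | 0 < u.1 /\ lambda1 p u < 0 < lambda2 p u].

(* Closure of A0 in ]0, +oo[ x R. The extremal subsonic states of the junction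
   problem (ends of the closed density intervals, and values of the inverse g
   there) are sonic, hence in this set but not in the open set A0. *)
Definition A0cl p : set (R * R) :=
  [set u | 0 < u.1 /\ lambda1 p u <= 0 <= lambda2 p u].

(* Oriented integral from a to b. *)
Definition oint (f : R -> R) (a b : R) : R :=
  if a <= b then (\int[mu R]_(x in `[a, b]) f x)%R
  else - (\int[mu R]_(x in `[b, a]) f x)%R.

Definition L1 p rho u : R :=
  if rho <= u.1 then
    rho / u.1 * u.2 - rho * oint (fun r => sound p r / r) u.1 rho
  else
    rho / u.1 * u.2 - Num.sqrt (rho / u.1 * (rho - u.1) * (p rho - p u.1)).

Definition L2m p rho u : R :=
  if rho <= u.1 then
    rho / u.1 * u.2 + rho * oint (fun r => sound p r / r) u.1 rho
  else
    rho / u.1 * u.2 + Num.sqrt (rho / u.1 * (rho - u.1) * (p rho - p u.1)).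

Definition sonic_check_l p u : set R :=
  [set rho | 0 < rho /\ lambda2 p (rho, L1 p rho u) = 0].
Definition sonic_hat_l p u : set R :=
  [set rho | 0 < rho /\ lambda1 p (rho, L1 p rho u) = 0].
Definition sonic_check_r p u : set R :=
  [set rho | 0 < rho /\ lambda2 p (rho, L2m p rho u) = 0].
Definition sonic_hat_r p u : set R :=
  [set rho | 0 < rho /\ lambda1 p (rho, L2m p rho u) = 0].

Definition phi_check_l p u : R := get (sonic_check_l p u).
Definition phi_hat_l p u : R := get (sonic_hat_l p u).
Definition phi_check_r p u : R := get (sonic_check_r p u).
Definition phi_hat_r p u : R := get (sonic_hat_r p u).

(* The four sonic densities are well defined: each defining equation has exactly
   one positive solution, for every subsonic state. This does not follow from
   [pressure p]: it holds for p rho = rho ^ gamma with 1 <= gamma <= 3, whereas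
   for gamma > 3 a 1-Lax curve may reach the vacuum before meeting
   lambda1 = 0. *)
Definition sonic_densities_determined p : Prop :=
  forall u, A0 p u ->
    [/\ exists! rho, sonic_check_l p u rho,
        exists! rho, sonic_hat_l p u rho,
        exists! rho, sonic_check_r p u rho &
        exists! rho, sonic_hat_r p u rho].

(* C^0([0, +oo[; L^1_loc(R)), for one component of the solution. *)
Definition C0_L1loc (f : R -> R -> R) : Prop :=
  (forall t, 0 <= t -> locally_integrable setT (f t)) /\
  (forall t (K : set R), 0 <= t -> compact K ->
     (\int[mu R]_(x in K) `|f s x - f t x|%:E)%E
       @[s --> within [set s | 0 <= s] (nbhs t)] --> 0%E).

(* Bounded variation on R of an a.e. equivalence class. *)
Definition BV_class (f : R -> R) : Prop :=
  exists2 g : R -> R, (\forall x \ae mu R, f x = g x) &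
    exists M : R, forall a b, a <= b -> (total_variation a b g <= M%:E)%E.

(* One-sided traces at x = 0 of an a.e. equivalence class. *)
Definition left_trace (f : R -> R * R) (l : R * R) : Prop :=
  exists2 g : R -> R * R, (\forall x \ae mu R, f x = g x) &
    g x @[x --> 0^'-] --> l.
Definition right_trace (f : R -> R * R) (l : R * R) : Prop :=
  exists2 g : R -> R * R, (\forall x \ae mu R, f x = g x) &
    g x @[x --> 0^'+] --> l.

Definition d_t (phi : R * R -> R) : R * R -> R := 'D_(1 : R, 0 : R) phi.
Definition d_x (phi : R * R -> R) : R * R -> R := 'D_(0 : R, 1 : R) phi.

(* C^1_c functions on ]0, +oo[ x R, extended by 0, whose support does not meet
   x = 0. *)
Definition test_function (phi : R * R -> R) : Prop :=
  let supp := closure [set z | phi z != 0] in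
  [/\ forall z, differentiable phi z,
      continuous (d_t phi) /\ continuous (d_x phi),
      compact supp &
      supp `<=` [set z | 0 < z.1 /\ z.2 != 0]].

Definition riemann_datum ul ur x : R * R := if x < 0 then ul else ur.

(* The iterated integrals are extended-real valued; being equal to 0 includes
   being finite. *)
Definition weak_Phi_solution p (Phi : R -> R * R -> R -> R * R -> R * R)
    al ar ul ur (u : R -> R -> R * R) : Prop :=
  [/\ [/\ C0_L1loc (fun t x => (u t x).1), C0_L1loc (fun t x => (u t x).2),
          forall t, 0 <= t -> \forall x \ae mu R, 0 < (u t x).1 &
          \forall t \ae mu R, 0 <= t ->
            BV_class (fun x => (u t x).1) /\ BV_class (fun x => (u t x).2)],
      forall phi, test_function phi ->
        (\int[mu R]_(t in `[0%R, +oo[) \int[mu R]_x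
           ((u t x).1 * d_t phi (t, x) + (u t x).2 * d_x phi (t, x))%:E
           = 0)%E /\
        (\int[mu R]_(t in `[0%R, +oo[) \int[mu R]_x
           ((u t x).2 * d_t phi (t, x) + flowP p (u t x) * d_x phi (t, x))%:E
           = 0)%E,
      \forall x \ae mu R, u 0 x = riemann_datum ul ur x &
      \forall t \ae mu R, 0 <= t ->
        exists um up, [/\ left_trace (u t) um, right_trace (u t) up &
                          Phi al um ar up = 0]].

Definition Phi_L p al um ar up : R * R :=
  (al * um.2 - ar * up.2, al * flowP p um - ar * flowP p up).

(* Centered waves, as functions w of xi = x / t, from the left state u to the
   right state v. *)
Definition shock_wave u v (w : R -> R * R) : Prop :=
  let sigma := (v.2 - u.2) / (v.1 - u.1) in
  forall xi, (xi < sigma -> w xi = u) /\ (sigma < xi -> w xi = v).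

(* Rarefaction for the characteristic speed lambda along the curve q = L rho. *)
Definition rarefaction_wave (lambda : R * R -> R) (L : R -> R) u v
    (w : R -> R * R) : Prop :=
  forall xi,
    [/\ xi <= lambda u -> w xi = u,
        lambda v <= xi -> w xi = v &
        lambda u < xi < lambda v ->
          [/\ Num.min u.1 v.1 <= (w xi).1 <= Num.max u.1 v.1,
              (w xi).2 = L (w xi).1 & lambda (w xi) = xi]].

(* First family: from ul (left) to um (right) along the forward curve of ul. *)
Definition lax_wave1 p ul um (w : R -> R * R) : Prop :=
  [/\ 0 < um.1, um.2 = L1 p um.1 ul &
      if um.1 <= ul.1
      then rarefaction_wave (lambda1 p) (fun rho => L1 p rho ul) ul um w
      else shock_wave ul um w].

(* Second family: from um (left) to ur (right) along the reversed curve of ur. *)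
Definition lax_wave2 p um ur (w : R -> R * R) : Prop :=
  [/\ 0 < um.1, um.2 = L2m p um.1 ur &
      if um.1 <= ur.1
      then rarefaction_wave (lambda2 p) (fun rho => L2m p rho ur) um ur w
      else shock_wave um ur w].

Definition made_of_lax_waves p ul ur (u : R -> R -> R * R) : Prop :=
  (exists um w, lax_wave1 p ul um w /\
     forall t, 0 < t ->
       (\forall x \ae mu R, x < 0 -> u t x = w (x / t)) /\
       left_trace (u t) um) /\
  (exists um w, lax_wave2 p um ur w /\
     forall t, 0 < t ->
       (\forall x \ae mu R, 0 < x -> u t x = w (x / t)) /\
       right_trace (u t) um).

Definition L_solution p al ar ul ur (u : R -> R -> R * R) : Prop :=
  weak_Phi_solution p (Phi_L p) al ar ul ur u /\ made_of_lax_waves p ul ur u.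

Definition subsonic_valued p (u : R -> R -> R * R) : Prop :=
  forall t, 0 <= t -> \forall x \ae mu R, A0cl p (u t x).

(* Equality in C^0([0, +oo[; L^1_loc(R)). *)
Definition same_solution (u v : R -> R -> R * R) : Prop :=
  forall t, 0 <= t -> \forall x \ae mu R, u t x = v t x.

Definition l_prime p al ar ul ur : R :=
  inf [set rho | phi_hat_l p ul <= rho <= phi_check_l p ul /\
                 al * L1 p rho ul <= ar * L2m p (phi_hat_r p ur) ur].

Definition l_second p al ar ul ur : R :=
  sup [set rho | phi_hat_l p ul <= rho <= phi_check_l p ul /\
                 al * L1 p rho ul >= ar * L2m p (phi_check_r p ur) ur].

Definition g_inv p ur : R -> R :=
  pinv [set rho | A0cl p (rho, L2m p rho ur)] (fun rho => L2m p rho ur).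

End PSystem.

(* Main.v *)
Require Import Defs.
From mathcomp Require Import all_boot all_order all_algebra.
From mathcomp Require Import all_classical all_reals all_analysis.
From mathcomp Require Import measurable_realfun metric_structure.
From mathcomp Require Import lebesgue_integral_under.
From mathcomp Require Import ring lra.
Import Order.TTheory GRing.Theory Num.Theory.
Import numFieldNormedType.Exports.
Local Open Scope classical_set_scope.
Local Open Scope ring_scope.

(* A subsonic solution is determined by the densities of its two traces at the
   junction, which lie on the forward 1-Lax curve of [ul] and on the reversed
   2-Lax curve of [ur]. On the subsonic part of the left curve the flow q is
   strictly decreasing and P strictly increasing in the density; on the right
   curve both are strictly increasing. Hence, along the left densities whose
   flow can be matched on the right, the jump of P through the junction is
   strictly increasing; it vanishes somewhere, and then only once, if and only
   if it is nonpositive at the smallest such density l' and nonnegative at the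
   largest one l''. A space reflection reduces the right curve to the left one.

   That a pair of traces yields a weak solution rests on one estimate. The
   increments of the state W(x/t) and flux G(x/t) of a centered wave are related
   by intermediate speeds, so K = G - xi W satisfies
   |K(y) - K(x) + W(x)(y - x)| <= |y - x| |W(y) - W(x)|; as W is monotone, it
   follows that K' = - W in the weak sense, for shocks and rarefactions alike. *)

(** * The pressure law *)

(** The two characteristic speeds behave differently along the 1-Lax curve. [lambda1] decreases,
    because the velocity decreases and the sound speed does not. In [lambda2] these two terms
    compete, and convexity of [p] does not settle its sign; so it is not clear a priori that the
    subsonic part of the curve is the whole interval between the two sonic densities. The gap is
    closed by applying [sonic_densities_determined] to all subsonic states of one density at once:
    changing the momentum shifts the velocity along the curve by a constant, so the hypothesis says
    that one fixed function takes each intermediate level exactly once.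

    At the sonic ends the velocity is plus or minus the sound speed, so on both curves the flow has
    opposite signs at the two ends. Hence the bounds l' and l'' are attained, the flow is positive
    at l' and negative at l'', and l' lies to the left of l''.

    Solutions are classes up to null sets. The closed region [A0cl] is what passes to traces, and
    since the traces of Lax waves do not depend on time, the junction condition at one good time
    fixes them. *)

Lemma MVT_closed {R : realType} (f df : R -> R) (a b : R) : a < b ->
    (forall x, a <= x <= b -> is_derive x (1 : R) f (df x)) ->
  exists2 c, a < c < b & f b - f a = df c * (b - a).
Proof.
move=> ab fdf.
have [||c cab ->] := @MVT R f df a b ab _ _.
- by move=> x; rewrite in_itv/= => /andP[ax xb]; apply: fdf; rewrite !ltW.
- apply: derivable_within_continuous => x; rewrite in_itv/= => xab.
  by have [] := fdf _ xab.
- by exists c => //; move: cab; rewrite in_itv.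
Qed.

Lemma derivable1_continuous {R : realType} (f : R -> R) (x : R) :
  derivable f x 1 -> {for x, continuous f}.
Proof. by move=> /derivable1_diffP/differentiable_continuous. Qed.

Lemma near_gt {R : realType} (x y : R) : y < x -> \forall z \near x, y < z.
Proof. by move=> yx; exact: (@cvgr_gt _ _ (nbhs x) _ id x _ y). Qed.

Lemma near_lt {R : realType} (x y : R) : x < y -> \forall z \near x, z < y.
Proof. by move=> yx; exact: (@cvgr_lt _ _ (nbhs x) _ id x _ y). Qed.

Section pressure_law.
Context {R : realType} (p : R -> R).
Hypothesis pP : pressure p.

Lemma pressure_is_derive (x : R) : 0 < x -> is_derive x (1 : R) p (derive1 p x).
Proof.
move=> x0; have [[/(_ _ x0)[dp _] _ _ _ _] _ _ _] := pP.
by rewrite derive1E; exact/derivableP.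
Qed.

Lemma pressure_continuous (x : R) : 0 < x -> {for x, continuous p}.
Proof.
by move=> x0; apply: derivable1_continuous; have [] := pressure_is_derive _ x0.
Qed.

Lemma dpressure_continuous (x : R) : 0 < x -> {for x, continuous (derive1 p)}.
Proof.
move=> x0; have [[/(_ _ x0)[_ dp] _ _ _ _] _ _ _] := pP.
exact: derivable1_continuous.
Qed.

Lemma dpressure_gt0 (x : R) : 0 < x -> 0 < derive1 p x.
Proof. by have [_ _ + _] := pP; exact. Qed.

Lemma dpressure_nd (x y : R) : 0 < x -> x <= y -> derive1 p x <= derive1 p y.
Proof.
move=> x0; rewrite le_eqVlt => /predU1P[-> //|xy].
have [[dp _ _ _ _] _ _ p2] := pP.
have [|c /andP[xc cy] pE] := @MVT_closed R (derive1 p) (derive1 (derive1 p)) x y xy _.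
  move=> z /andP[xz _]; have z0 : 0 < z by exact: lt_le_trans xz.
  by rewrite (derive1E (derive1 p)); apply/derivableP; have [] := dp _ z0.
rewrite -subr_ge0 pE mulr_ge0 ?subr_ge0 ?(ltW xy)//.
by apply: p2; exact: lt_trans xc.
Qed.

Lemma pressure_slope (x y : R) : 0 < x -> x < y ->
  derive1 p x * (y - x) <= p y - p x <= derive1 p y * (y - x).
Proof.
move=> x0 xy.
have [|c /andP[xc cy] ->] := @MVT_closed R p (derive1 p) x y xy _.
  by move=> z /andP[xz _]; apply: pressure_is_derive; exact: lt_le_trans xz.
have c0 := lt_trans x0 xc.
by rewrite !ler_pM2r ?subr_gt0// !dpressure_nd// ltW.
Qed.

Lemma pressure_lt (x y : R) : 0 < x -> x < y -> p x < p y.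
Proof.
move=> x0 xy; have /andP[+ _] := pressure_slope _ _ x0 xy.
rewrite -subr_gt0; apply: lt_le_trans.
by rewrite mulr_gt0 ?dpressure_gt0 ?subr_gt0.
Qed.

(** By convexity the derivative at the middle point [x] bounds the slope of the chord over [[z, x]]
    from above and that over [[x, y]] from below; the slope over [[z, y]] is a weighted mean of the
    two. *)
Lemma pressure_chord_nd (z x y : R) : 0 < z -> z < x -> x <= y ->
  (p x - p z) / (x - z) <= (p y - p z) / (y - z).
Proof.
move=> z0 zx; rewrite le_eqVlt => /predU1P[->//|xy].
have x0 := lt_trans z0 zx; have zy := lt_trans zx xy.
have /andP[h1 _] := pressure_slope _ _ x0 xy.
have /andP[_ h2] := pressure_slope _ _ z0 zx.
rewrite ler_pdivrMr ?subr_gt0// mulrAC ler_pdivlMr ?subr_gt0//.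
have := ler_wpM2r _ h2 => /(_ (y - x)); rewrite subr_ge0 ltW// => /(_ isT).
have := ler_wpM2r _ h1 => /(_ (x - z)); rewrite subr_ge0 ltW// => /(_ isT).
lra.
Qed.

Lemma sound_gt0 (x : R) : 0 < x -> 0 < sound p x.
Proof. by move=> x0; rewrite sqrtr_gt0 dpressure_gt0. Qed.

Lemma sound_sqr (x : R) : 0 < x -> sound p x ^+ 2 = derive1 p x.
Proof. by move=> x0; rewrite sqr_sqrtr// ltW// dpressure_gt0. Qed.

Lemma sound_nd (x y : R) : 0 < x -> x <= y -> sound p x <= sound p y.
Proof. by move=> x0 xy; rewrite ler_wsqrtr// dpressure_nd. Qed.

Lemma sound_continuous (x : R) : 0 < x -> {for x, continuous (sound p)}.
Proof.
move=> x0; apply: (continuous_comp (dpressure_continuous _ x0)).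
exact: sqrt_continuous.
Qed.

Let kappa (r : R) := sound p r / r.

Lemma kappa_continuous (x : R) : 0 < x -> {for x, continuous kappa}.
Proof.
move=> x0; apply: cvgM; first exact: sound_continuous.
by apply: cvgV; rewrite ?gt_eqF//; exact: cvg_id.
Qed.

Lemma kappa_integrable (x y : R) : 0 < x ->
  (@lebesgue_measure R).-integrable `[x, y] (EFin \o kappa).
Proof.
move=> x0; apply: continuous_compact_integrable; first exact: segment_compact.
apply: continuous_in_subspaceT => z; rewrite inE/= in_itv/= => /andP[xz _].
by apply: kappa_continuous; exact: lt_le_trans xz.
Qed.

Lemma kappa_int_is_derive (d x : R) : 0 < d -> d < x ->
  is_derive x (1 : R) (fun y => oint kappa d y) (kappa x).
Proof.
move=> d0 dx; have x0 := lt_trans d0 dx.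
(* Any point to the right of [x] would do in place of [x + 1]: it makes [x] interior to the segment
   of integration. *)
have := @continuous_FTC1_closed R kappa d x (x + 1).
rewrite ltrDl ltr01 => /(_ isT (kappa_integrable _ _ d0) dx).
move=> /(_ (kappa_continuous _ x0))[h1 h2].
have dF : is_derive x (1 : R)
    (fun y => \int[@lebesgue_measure R]_(t in `[d, y]) kappa t)%R (kappa x).
  by rewrite -h2 derive1E; exact/derivableP.
apply: near_eq_is_derive dF.
near=> y; rewrite /oint ifT//.
by apply/ltW; near: y; exact: near_gt.
Unshelve. all: by end_near. Qed.

Lemma ointxx (f : R -> R) (x : R) : oint f x x = 0.
Proof. by rewrite /oint lexx set_itv1 Rintegral_set1. Qed.

(** The Lax curve integrates backwards from [y]. Rebased at [d], the variable [x] becomes the upper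
    end of a forward integral, to which the fundamental theorem of calculus applies. *)
Lemma kappa_int_split (d x y : R) : 0 < d -> d <= x -> x <= y ->
  oint kappa y x = oint kappa d x - oint kappa d y.
Proof.
move=> d0 dx; rewrite le_eqVlt => /predU1P[->|xy]; first by rewrite ointxx subrr.
rewrite {1}/oint leNgt xy/= /oint dx (le_trans dx (ltW xy)).
rewrite -[in RHS]opprB; congr (- _).
have := @Rintegral_itvB R kappa (BLeft d) (BRight y) x.
rewrite kappa_integrable// => /(_ isT); rewrite !bnd_simp => /(_ dx (ltW xy)) ->.
rewrite Rintegral_itv_obnd_cbnd//.
apply: integrableS (kappa_integrable x y (lt_le_trans d0 dx)) => //.
by apply: subset_itvr; rewrite bnd_simp.
Qed.

End pressure_law.

Lemma continuous_within_itvcc {R : realType} (f : R -> R) (a b : R) :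
  (forall x, a <= x <= b -> {for x, continuous f}) ->
  {within `[a, b], continuous f}.
Proof.
move=> cf; apply: continuous_in_subspaceT => x.
by rewrite inE/= in_itv/=; exact: cf.
Qed.

Lemma IVT_incr {R : realType} (f : R -> R) (a b y : R) : a <= b ->
    (forall x, a <= x <= b -> {for x, continuous f}) ->
    f a < y < f b -> exists2 c, a < c < b & f c = y.
Proof.
move=> ab cf /andP[fay yfb].
have [|c + fcE] := @IVT R f a b y ab (continuous_within_itvcc _ _ _ cf).
  by rewrite ge_min le_max (ltW fay) (ltW yfb) orbT.
rewrite in_itv/= => /andP[ac cb]; exists c => //.
rewrite !lt_neqAle ac cb !andbT; apply/andP; split; apply/eqP => cE; move: fcE.
  by rewrite -cE => E; move: fay; rewrite E ltxx.
by rewrite cE => E; move: yfb; rewrite E ltxx.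
Qed.

Lemma IVT_decr {R : realType} (f : R -> R) (a b y : R) : a <= b ->
    (forall x, a <= x <= b -> {for x, continuous f}) ->
    f b < y < f a -> exists2 c, a < c < b & f c = y.
Proof.
move=> ab cf /andP[fay yfb].
have [||c cab /eqP] := @IVT_incr R (fun x => - f x) a b (- y) ab.
- by move=> x /cf cfx; exact: cvgN.
- by rewrite !ltrN2 fay yfb.
- by rewrite eqr_opp => /eqP; exists c.
Qed.

(* The pattern of the two characteristic speeds along a Lax curve: [H] is the
   larger one and [k] the smaller one, up to a constant. Since each level of
   [H] strictly between [-c] and [c] is taken only once, [H] has no valley and
   hence cannot go below [c] on the left of [r]. *)
Section unique_levels.
Context {R : realType} (H k : R -> R) (r c : R).
Hypothesis r_gt0 : 0 < r.
Hypothesis H_cont : forall x, 0 < x -> {for x, continuous H}.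
Hypothesis k_decr : forall x y, 0 < x -> x < y -> k y < k x.
Hypothesis kH : forall x, 0 < x -> k x < H x.
Hypothesis Hr : H r = c.
Hypothesis kr : k r = - c.
Hypothesis H_uniq : forall y, - c < y < c ->
  exists! x, 0 < x /\ H x = y.
Hypothesis k_ex : forall y, - c < y < c -> exists x, 0 < x /\ k x = y.

Let uniq_eq y x1 x2 : - c < y < c -> 0 < x1 -> 0 < x2 ->
  H x1 = y -> H x2 = y -> x1 = x2.
Proof.
move=> yc x10 x20 h1 h2; have [x [_ xE]] := H_uniq _ yc.
by rewrite -(xE x1)// -(xE x2).
Qed.

(** The level [y] would be taken twice, once on the way down and once on the way up. *)
Let no_valley y x1 x2 x3 : - c < y < c -> 0 < x1 -> x1 < x2 -> x2 < x3 ->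
  H x2 < y -> y < H x1 -> y < H x3 -> False.
Proof.
move=> yc x10 x12 x23 h2 h1 h3.
have x20 := lt_trans x10 x12.
have [||z1 /andP[xz1 zx1] e1] := @IVT_decr R H x1 x2 y (ltW x12).
- by move=> x /andP[xx _]; apply: H_cont; exact: lt_le_trans xx.
- by rewrite h2.
have [||z2 /andP[xz2 zx2] e2] := @IVT_incr R H x2 x3 y (ltW x23).
- by move=> x /andP[xx _]; apply: H_cont; exact: lt_le_trans xx.
- by rewrite h2.
have z1z2 : z1 = z2.
  by apply: (uniq_eq _ _ _ yc); [exact: lt_trans xz1|exact: lt_trans xz2|..].
by move: zx1; rewrite z1z2 => /(lt_trans xz2); rewrite ltxx.
Qed.

(** If [H x < c], then [H x] is also a level of [k], taken at some [z]. As [k < H] and [k]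
    decreases, [z < x], and [H z > k z = H x]. Since [H r = c] on the other side, [x] lies in a
    valley of [H], at a level halfway up to the lower of the two rims. *)
Lemma unique_levels_left x : 0 < x -> x <= r -> c <= H x.
Proof.
move=> x0; rewrite le_eqVlt => /predU1P[->|xr]; first by rewrite Hr.
rewrite leNgt; apply/negP => Hxc.
have Hxc' : - c < H x by rewrite (lt_trans _ (kH _ x0))// -kr k_decr.
have [|z [z0 kz]] := k_ex (H x); first by rewrite Hxc'.
have zx : z < x.
  rewrite ltNge; apply/negP; rewrite le_eqVlt => /predU1P[xz|xz].
    by have := kH _ z0; rewrite kz xz ltxx.
  by have := k_decr _ _ x0 xz; rewrite kz ltNge ltW// kH.
have Hz : H x < H z by rewrite -kz kH.
pose y := (H x + Num.min c (H z)) / 2.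
have m1 : H x < Num.min c (H z) by rewrite lt_min Hxc Hz.
have m2 : Num.min c (H z) <= c by rewrite ge_min lexx.
have m3 : Num.min c (H z) <= H z by rewrite ge_min lexx orbT.
have y1 : H x < y by rewrite /y; lra.
have y2 : y < Num.min c (H z) by rewrite /y; lra.
apply: (no_valley y z x r) => //.
- by apply/andP; split; [exact: lt_trans y1|exact: lt_le_trans m2].
- exact: lt_le_trans m3.
- by rewrite Hr; exact: lt_le_trans m2.
Qed.

Section root.
Variables (y b : R).
Hypothesis yc : - c < y < c.
Hypothesis b_gt0 : 0 < b.
Hypothesis Hb : H b = y.

Lemma unique_levels_root : r < b.
Proof.
rewrite ltNge; apply/negP => /(unique_levels_left _ b_gt0).
by rewrite Hb leNgt; case/andP: yc => _ ->.
Qed.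

Lemma unique_levels_before x : 0 < x -> x < b -> y < H x.
Proof.
move=> x0 xb; have [xr|rx] := leP x r.
  by rewrite (lt_le_trans _ (unique_levels_left _ x0 xr))//; case/andP: yc.
rewrite ltNge le_eqVlt; apply/negP => /predU1P[e|Hxy].
  by move: xb; rewrite (uniq_eq _ _ _ yc x0 b_gt0 e Hb) ltxx.
have [||z /andP[rz zx] e] := @IVT_decr R H r x y (ltW rx).
- by move=> z /andP[rz _]; apply: H_cont; exact: lt_le_trans rz.
- by rewrite Hxy Hr; case/andP: yc.
have z0 := lt_trans r_gt0 rz.
by move: (lt_trans zx xb); rewrite (uniq_eq _ _ _ yc z0 b_gt0 e Hb) ltxx.
Qed.

End root.

(** The root [b2] of a lower level serves as an anchor: it lies beyond [b], so if [H] exceeded [y]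
    somewhere after [b], it would cross [y] a second time between that point and [b2]. *)
Lemma unique_levels_after y b x : - c < y < c -> 0 < b -> H b = y ->
  b < x -> H x < y.
Proof.
move=> yc b0 Hb bx; have x0 := lt_trans b0 bx.
rewrite ltNge le_eqVlt; apply/negP => /predU1P[/esym e|Hxy].
  by move: bx; rewrite (uniq_eq _ _ _ yc x0 b0 e Hb) ltxx.
case/andP: (yc) => yc1 yc2.
(* The midpoint of [- c] and [y]: an admissible level strictly below [y]. *)
have y2c : - c < (y - c) / 2 < c by lra.
have [b2 [[b20 Hb2] _]] := H_uniq _ y2c.
have y2y : H b2 < y by rewrite Hb2; lra.
have bb2 : b < b2.
  rewrite ltNge le_eqVlt; apply/negP => /predU1P[e|b2b].
    by move: y2y; rewrite e Hb ltxx.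
  by move: y2y; rewrite ltNge ltW// (unique_levels_before _ _ yc b0 Hb).
have [xb2|b2x] := ltP x b2.
  have [||z /andP[rz zx] e] := @IVT_decr R H x b2 y (ltW xb2).
  - by move=> z /andP[rz _]; apply: H_cont; exact: lt_le_trans rz.
  - by rewrite y2y.
  have bz := lt_trans bx rz.
  by move: (bz); rewrite (uniq_eq _ _ _ yc (lt_trans b0 bz) b0 e Hb) ltxx.
have [||z /andP[rz zx] e] := @IVT_incr R H b2 x y b2x.
- by move=> z /andP[rz _]; apply: H_cont; exact: lt_le_trans rz.
- by rewrite y2y.
have bz := lt_trans bb2 rz.
by move: (bz); rewrite (uniq_eq _ _ _ yc (lt_trans b0 bz) b0 e Hb) ltxx.
Qed.

End unique_levels.

(** * The forward 1-Lax curve *)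

Section lax_curve.
Context {R : realType} (p : R -> R).
Hypothesis pP : pressure p.
Variable u : R * R.
Hypothesis u1_gt0 : 0 < u.1.

Let kappa (r : R) := sound p r / r.

(* Rarefaction part of the 1-Lax curve with the integral based at [d], so that
   it also makes sense on the right of [u.1]. *)
Definition rar_curve (d x : R) :=
  x * (u.2 / u.1 - (oint kappa d x - oint kappa d u.1)).

(** Both the derivative of [rar_curve] and, on the rarefaction part of the curve, the value of
    [lambda1]. *)
Definition rar_speed (d x : R) :=
  u.2 / u.1 - (oint kappa d x - oint kappa d u.1) - sound p x.

Definition shock_curve (x : R) :=
  x / u.1 * u.2 - Num.sqrt (x / u.1 * (x - u.1) * (p x - p u.1)).

(** The Rankine-Hugoniot speed of the shock from [u] to the state of density [x], that is, the slope
    of the chord of the curve between them ([shock_curveE], [flowP_shock]). *)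
Definition shock_speed (x : R) :=
  u.2 / u.1 - Num.sqrt (x / u.1 * ((p x - p u.1) / (x - u.1))).

Lemma L1_rar (d x : R) : 0 < d -> d <= x -> x <= u.1 -> L1 p x u = rar_curve d x.
Proof.
move=> d0 dx xu; rewrite /L1 xu /rar_curve (@kappa_int_split _ p pP d)//.
by rewrite [in RHS]mulrBr; congr (_ - _); rewrite mulrAC mulrA.
Qed.

Lemma L1_shock (x : R) : u.1 <= x -> L1 p x u = shock_curve x.
Proof.
rewrite le_eqVlt => /predU1P[<-|ux].
  by rewrite /L1 lexx /shock_curve ointxx subrr !(mulr0, mul0r) sqrtr0.
by rewrite /L1 leNgt ux.
Qed.

Lemma L1_self : L1 p u.1 u = u.2.
Proof. by rewrite /L1 lexx ointxx mulr0 subr0 divff ?mul1r// gt_eqF. Qed.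

(** With v the velocity along the curve and c the sound speed, v' = - c / x, so (x v)' = v - c. Thus
    the slope of the rarefaction curve is its own characteristic speed. *)
Lemma rar_curve_is_derive (d x : R) : 0 < d -> d < x ->
  is_derive x (1 : R) (rar_curve d) (rar_speed d x).
Proof.
move=> d0 dx; have x0 := lt_trans d0 dx.
have dk := kappa_int_is_derive p pP _ _ d0 dx.
pose G y : R := oint kappa d u.1 + u.2 / u.1 - oint kappa d y.
have dG : is_derive x (1 : R) G (0 - kappa x) by exact: is_deriveB.
have dM : is_derive x (1 : R) (id * G) (x *: (0 - kappa x) + G x *: 1).
  exact: is_deriveM.
have -> : rar_curve d = id * G.
  by apply/funext => y; rewrite /rar_curve /G /GRing.mul/=; congr (_ * _); ring.
apply: is_derive_eq.
rewrite /GRing.scale/= /rar_speed /G /kappa sub0r mulrN mulrCA divff ?gt_eqF//.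
by ring.
Qed.

Lemma kappa_int_lt (d x y : R) : 0 < d -> d < x -> x < y ->
  oint kappa d x < oint kappa d y.
Proof.
move=> d0 dx xy; have x0 := lt_trans d0 dx.
have [|c /andP[xc cy] kE] :=
    @MVT_closed R (fun y => oint kappa d y) kappa x y xy _.
  move=> z /andP[xz _]; apply: kappa_int_is_derive => //.
  exact: lt_le_trans xz.
rewrite -subr_gt0 kE mulr_gt0 ?subr_gt0// divr_gt0 ?(sound_gt0 p pP)//.
  exact: lt_trans xc.
exact: lt_trans xc.
Qed.

Lemma shock_curveE (x : R) : u.1 <= x ->
  shock_curve x = u.2 + shock_speed x * (x - u.1).
Proof.
move=> ux; rewrite /shock_speed /shock_curve.
have -> : Num.sqrt (x / u.1 * (x - u.1) * (p x - p u.1)) =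
    Num.sqrt (x / u.1 * ((p x - p u.1) / (x - u.1))) * (x - u.1).
  move: ux; rewrite le_eqVlt => /predU1P[<-|ux].
    by rewrite !subrr !(mulr0, mul0r) sqrtr0.
  have d0 : 0 < x - u.1 by rewrite subr_gt0.
  rewrite -[X in _ = _ * X]ger0_norm ?(ltW d0)// -sqrtr_sqr -sqrtrM.
    by congr Num.sqrt; field; rewrite !gt_eqF.
  rewrite mulr_ge0 ?divr_ge0 ?(ltW u1_gt0) ?(ltW d0)//.
    exact: ltW (lt_trans u1_gt0 ux).
  by rewrite subr_ge0 ltW// (pressure_lt p pP).
by field; rewrite gt_eqF.
Qed.

Lemma L1E (x : R) : u.1 <= x -> L1 p x u = u.2 + shock_speed x * (x - u.1).
Proof. by move=> ux; rewrite L1_shock// shock_curveE. Qed.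

(** The radicand is a product of [x / u.1], which increases strictly, and the slope of the chord of
    [p] from [u.1], which is nondecreasing by convexity. *)
Lemma shock_speed_decr (x y : R) : u.1 < x -> x < y -> shock_speed y < shock_speed x.
Proof.
move=> ux xy; rewrite /shock_speed ltrD2l ltrN2 ltr_sqrt; last first.
  rewrite mulr_gt0 ?divr_gt0 ?subr_gt0 ?pressure_lt//.
  - exact: lt_trans (lt_trans ux xy).
  - exact: lt_trans xy.
  - exact: lt_trans xy.
have ux0 := lt_trans u1_gt0 ux.
apply: (@lt_le_trans _ _ (y / u.1 * ((p x - p u.1) / (x - u.1)))).
  rewrite ltr_pM2r ?ltr_pM2r ?invr_gt0//.
  by rewrite divr_gt0 ?subr_gt0// (pressure_lt p pP).
rewrite ler_pM2l ?divr_gt0//; last exact: lt_trans xy.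
by apply: (pressure_chord_nd p pP) => //; exact: ltW.
Qed.

(** The Lax inequality on the side of [u]: in the radicand the chord slope is at least
    [derive1 p u.1] and the factor [x / u.1] is at least 1. *)
Lemma shock_speed_lt (x : R) : u.1 < x -> shock_speed x <= lambda1 p u.
Proof.
move=> ux; have ux0 := lt_trans u1_gt0 ux.
rewrite /shock_speed /lambda1 lerD2l lerN2 /sound ler_wsqrtr//.
have /andP[h _] := pressure_slope p pP _ _ u1_gt0 ux.
rewrite -ler_pdivlMr ?subr_gt0// in h.
apply: (le_trans h); rewrite ler_peMl//.
  by rewrite divr_ge0// subr_ge0 ltW// (pressure_lt p pP).
by rewrite ler_pdivlMr// mul1r ltW.
Qed.

(* Rankine-Hugoniot: the second relation holds with the same speed. *)
Lemma flowP_shock (x : R) : u.1 < x ->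
  flowP p (x, L1 p x u) = flowP p u + shock_speed x * (L1 p x u - u.2).
Proof.
move=> ux; have ux0 := lt_trans u1_gt0 ux.
rewrite (L1E _ (ltW ux)) /flowP/=.
set s := shock_speed x.
(* This is the definition of [s], squared. Solved for [p x] in [pE], it eliminates both the root and
   the pressure, so that a rational identity remains. *)
have sE : (u.2 / u.1 - s) ^+ 2 = x / u.1 * ((p x - p u.1) / (x - u.1)).
  rewrite /s /shock_speed opprB addrC subrK sqr_sqrtr// mulr_ge0//.
    by rewrite divr_ge0// ltW.
  by rewrite divr_ge0 ?subr_ge0// ltW// (pressure_lt p pP).
have pE : p x = p u.1 + (u.2 / u.1 - s) ^+ 2 * u.1 / x * (x - u.1).
  by rewrite sE; field; rewrite !gt_eqF// subr_gt0.
by rewrite pE; field; rewrite !gt_eqF.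
Qed.

Definition vel (x : R) := L1 p x u / x.

Lemma vel_rar (d x : R) : 0 < d -> d <= x -> x <= u.1 ->
  vel x = rar_speed d x + sound p x.
Proof.
move=> d0 dx xu; rewrite /vel (L1_rar d)// /rar_curve /rar_speed mulrAC divff.
  by rewrite mul1r subrK.
by rewrite gt_eqF//; exact: lt_le_trans dx.
Qed.

Lemma lambda1_rar (d x : R) : 0 < d -> d <= x -> x <= u.1 ->
  lambda1 p (x, L1 p x u) = rar_speed d x.
Proof.
by move=> d0 dx xu; rewrite /lambda1/= -/(vel x) (vel_rar d)// addrK.
Qed.

(** In terms of the specific volumes the radicand is a product of two increasing factors, so that
    the velocity is seen to decrease. *)
Lemma vel_shock (x : R) : u.1 <= x ->
  vel x = u.2 / u.1 - Num.sqrt ((u.1^-1 - x^-1) * (p x - p u.1)).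
Proof.
move=> ux; have x0 := lt_le_trans u1_gt0 ux.
rewrite /vel L1_shock// /shock_curve mulrBl; congr (_ - _).
  by field; rewrite !gt_eqF.
rewrite -[X in _ * X]ger0_norm ?invr_ge0 ?(ltW x0)// -sqrtr_sqr -sqrtrM.
  by congr Num.sqrt; field; rewrite !gt_eqF.
rewrite mulr_ge0 ?subr_ge0//.
  by rewrite mulr_ge0 ?subr_ge0// divr_ge0 ?ltW.
move: ux; rewrite le_eqVlt => /predU1P[<-//|ux].
by rewrite ltW// (pressure_lt p pP).
Qed.

Lemma vel_decr (x y : R) : 0 < x -> x < y -> vel y < vel x.
Proof.
move=> x0 xy.
have left a b : 0 < a -> a < b -> b <= u.1 -> vel b < vel a.
  (* The base point [a / 2] lies strictly to the left of [a], so the integral is differentiable on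
     all of [[a, b]]. *)
  move=> a0 ab bu; have d0 : 0 < a / 2 by rewrite divr_gt0.
  have da : a / 2 < a by rewrite ltr_pdivrMr// ltr_pMr// ltr1n.
  rewrite (vel_rar (a / 2) a)//; last 2 first.
  - exact: ltW.
  - exact: ltW (lt_le_trans ab bu).
  rewrite (vel_rar (a / 2) b)//; last exact: ltW (lt_trans da ab).
  by have := kappa_int_lt _ _ _ d0 da ab; rewrite /rar_speed; lra.
have right a b : u.1 <= a -> a < b -> vel b < vel a.
  move=> ua ab; have ub := le_lt_trans ua ab.
  have a0 := lt_le_trans u1_gt0 ua; have b0 := lt_trans a0 ab.
  rewrite !vel_shock ?(ltW ub)// ltrD2l ltrN2 ltr_sqrt; last first.
    rewrite mulr_gt0 ?subr_gt0 ?(pressure_lt p pP)//.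
    by rewrite ltf_pV2.
  have pb : 0 < p b - p u.1 by rewrite subr_gt0 (pressure_lt p pP).
  apply: (@le_lt_trans _ _ ((u.1^-1 - a^-1) * (p b - p u.1))).
    rewrite ler_wpM2l//; first by rewrite subr_ge0 lef_pV2.
    by rewrite lerD2r ltW// (pressure_lt p pP).
  by rewrite ltr_pM2r// ltrD2l ltrN2 ltf_pV2.
have [yu|uy] := leP y u.1; first exact: left.
have [ux|xu] := leP u.1 x; first exact: right.
by apply: lt_trans (right _ _ (lexx _) uy) _; exact: left.
Qed.

(** The velocity and minus the sound speed vary in the same direction. For [lambda2] they do not,
    which is why its sign needs [unique_levels]. *)
Lemma lambda1_L1_decr (x y : R) : 0 < x -> x < y ->
  lambda1 p (y, L1 p y u) < lambda1 p (x, L1 p x u).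
Proof.
move=> x0 xy; rewrite /lambda1/= -/(vel x) -/(vel y).
have := vel_decr _ _ x0 xy; have := sound_nd p pP _ _ x0 (ltW xy); lra.
Qed.

Lemma L1_continuous (x : R) : 0 < x -> {for x, continuous (fun r => L1 p r u)}.
Proof.
move=> x0; pose d := Num.min x u.1 / 2.
have m0 : 0 < Num.min x u.1 by rewrite lt_min x0.
have d0 : 0 < d by rewrite divr_gt0.
have dm : d < Num.min x u.1 by rewrite ltr_pdivrMr// ltr_pMr// ltr1n.
move: (dm); rewrite lt_min => /andP[dx du].
(* The two branches are glued without a case distinction: the branch that is not active stays at its
   common value [u.2], which is subtracted. *)
pose F r := rar_curve d (Num.min r u.1) + shock_curve (Num.max r u.1) - u.2.
have LF r : d <= r -> L1 p r u = F r.
  move=> dr; have [ru|ur] := leP r u.1.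
    rewrite /F min_l// max_r// -(L1_shock u.1)// L1_self addrK.
    exact: L1_rar.
  rewrite /F min_r ?(ltW ur)// max_l ?(ltW ur)// (L1_shock _ (ltW ur)).
  by rewrite -(L1_rar d)// ?(ltW du)// L1_self addrAC subrr add0r.
have cid (y : R) : {for y, continuous (fun r : R => r)} by exact: cvg_id.
have cc (k y : R) : {for y, continuous (fun=> k)} by exact: cvg_cst.
have cF : {for x, continuous F}.
  apply: cvgB; last exact: cvg_cst.
  apply: cvgD.
    apply: (@continuous_comp _ _ _ (fun r => Num.min r u.1) (rar_curve d)).
      by apply: continuous_min; [exact: cid|exact: cc].
    by apply: derivable1_continuous; have [] := rar_curve_is_derive d _ d0 dm.
  apply: (@continuous_comp _ _ _ (fun r => Num.max r u.1) shock_curve).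
    by apply: continuous_max; [exact: cid|exact: cc].
  have y0 : 0 < Num.max x u.1 by rewrite lt_max x0.
  move: (Num.max x u.1) y0 => y y0.
  have cxu : {for y, continuous (fun r : R => r / u.1)}.
    exact: (cvgM (cid y) (cc _ y)).
  rewrite /shock_curve /prop_for /continuous_at; apply: cvgB.
    exact: (cvgM cxu (cc u.2 y)).
  apply: (@continuous_comp _ _ _
    (fun r : R => r / u.1 * (r - u.1) * (p r - p u.1)) Num.sqrt);
    last exact: sqrt_continuous.
  apply: cvgM; last exact: (cvgB (pressure_continuous p pP y y0) (cc _ y)).
  exact: (cvgM cxu (cvgB (cid y) (cc _ y))).
have FL : \forall r \near x, F r = L1 p r u.
  by near=> r; rewrite -LF//; apply/ltW; near: r; exact: near_gt.
rewrite /prop_for /continuous_at (LF _ (ltW dx)).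
by apply: cvg_trans cF; exact: near_eq_cvg.
Unshelve. all: by end_near. Qed.

End lax_curve.

(** * Variation of the flow and of the momentum flux along the subsonic 1-Lax curve *)

Section lax_curve_subsonic.
Context {R : realType} (p : R -> R).
Hypothesis pP : pressure p.
Variable u : R * R.
Hypothesis u1_gt0 : 0 < u.1.

Let Q (x : R) := L1 p x u.
Let P (x : R) := flowP p (x, L1 p x u).
Let lam (x : R) := lambda1 p (x, L1 p x u).

Lemma vel_continuous (x : R) : 0 < x -> {for x, continuous (vel p u)}.
Proof.
move=> x0; have cQ := L1_continuous p pP u u1_gt0 x x0.
have cid : {for x, continuous (fun r : R => r)} by exact: cvg_id.
apply: (cvgM cQ); apply: cvgV => //; first by rewrite gt_eqF.
Qed.

Lemma flowP_L1_continuous (x : R) : 0 < x -> {for x, continuous P}.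
Proof.
move=> x0; have cQ := L1_continuous p pP u u1_gt0 x x0.
have cid : {for x, continuous (fun r : R => r)} by exact: cvg_id.
apply: cvgD; last exact: pressure_continuous.
apply: cvgM; first exact: (cvgM cQ cQ).
by apply: cvgV => //; rewrite gt_eqF.
Qed.

Lemma lambda1_L1_continuous (x : R) : 0 < x -> {for x, continuous lam}.
Proof.
by move=> x0; apply: cvgB; [exact: vel_continuous|exact: sound_continuous].
Qed.

Section rarefaction.
Variables (x y : R).
Hypothesis x_gt0 : 0 < x.
Hypothesis xy : x < y.
Hypothesis yu : y <= u.1.

Let d := x / 2.
Let d0 : 0 < d. Proof. by rewrite divr_gt0. Qed.
Let dx : d < x. Proof. by rewrite ltr_pdivrMr// ltr_pMr// ltr1n. Qed.

Let rarE z : x <= z -> z <= y -> Q z = rar_curve p u d z.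
Proof.
move=> xz zy; apply: L1_rar => //; last exact: le_trans yu.
by apply: le_trans xz; exact: ltW.
Qed.

Let lamE z : x <= z -> z <= y -> lam z = rar_speed p u d z.
Proof.
move=> xz zy; apply: lambda1_rar => //; last exact: le_trans yu.
by apply: le_trans xz; exact: ltW.
Qed.

Lemma L1_rar_MVT : exists2 c, x < c < y & Q y - Q x = lam c * (y - x).
Proof.
have [|c /andP[xc cy] cE] :=
    @MVT_closed R (rar_curve p u d) (rar_speed p u d) x y xy _.
  move=> z /andP[xz _]; apply: rar_curve_is_derive => //.
  exact: lt_le_trans xz.
exists c; first by rewrite xc.
by rewrite !rarE ?lexx// ?(ltW xy)// lamE ?(ltW xc) ?(ltW cy).
Qed.

(** Along a rarefaction Q' = [lam] and P' = [lam] squared. Subtracting [A] times Q leaves the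
    derivative [lam * (lam - A)], whose sign is known as soon as [A] is an extreme value of a
    nonpositive [lam]. *)
Lemma flowP_rar_MVT (A : R) : exists2 c, x < c < y &
  (P y - A * Q y) - (P x - A * Q x) = lam c * (lam c - A) * (y - x).
Proof.
pose F z := rar_curve p u d z ^+ 2 / z + p z - A * rar_curve p u d z.
have [|c /andP[xc cy] cE] := @MVT_closed R F
    (fun z => rar_speed p u d z * (rar_speed p u d z - A)) x y xy _.
  move=> z /andP[xz _]; have z0 := lt_le_trans x_gt0 xz.
  have dr := rar_curve_is_derive p pP u d z d0 (lt_le_trans dx xz).
  have dp := pressure_is_derive p pP z z0.
  have di : is_derive z (1 : R) (fun z : R => z^-1) (- z ^- 2 *: 1).
    by apply: is_deriveV; rewrite gt_eqF.
  have d1 := @is_deriveM R R (rar_curve p u d) (rar_curve p u d) z 1 _ _ dr dr.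
  have d2 := @is_deriveM R R _ _ z 1 _ _ d1 di.
  have d3 := @is_deriveD R R R _ _ z 1 _ _ d2 dp.
  have d4 := @is_deriveZ R R R _ A z 1 _ dr.
  have d5 := @is_deriveB R R R _ _ z 1 _ _ d3 d4.
  apply: is_derive_eq d5 _.
  (* Writing the flow as density times velocity, and the velocity as speed plus sound speed, makes
     the derivative a polynomial in these two speeds. *)
  have rE : rar_curve p u d z = z * (rar_speed p u d z + sound p z).
    by rewrite /rar_curve /rar_speed subrK.
  rewrite -(sound_sqr p pP z z0) /GRing.scale/= [(_ * _) z]/GRing.mul/= rE.
  field.
  by rewrite gt_eqF.
exists c; first by rewrite xc.
rewrite lamE ?(ltW xc) ?(ltW cy)// -cE /F /P /flowP/= -/(Q x) -/(Q y).
by rewrite !rarE ?lexx// ltW.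
Qed.

End rarefaction.

Lemma lambda1_decr_le (x y : R) : 0 < x -> x <= y -> lam y <= lam x.
Proof.
move=> x0; rewrite le_eqVlt => /predU1P[->//|xy].
by rewrite ltW// lambda1_L1_decr.
Qed.

(** [flowP_rar_MVT] is used with [A] equal to [lam x] and to [lam y]. The bounds say that the
    increments of P and Q are related by a speed between the two characteristic ones; they serve
    both the strict growth of P and the weak form of a rarefaction. *)
Lemma flowP_rar_bounds (x y : R) : 0 < x -> x <= y -> y <= u.1 -> lam x <= 0 ->
  lam x * (Q y - Q x) <= P y - P x <= lam y * (Q y - Q x).
Proof.
move=> x0; rewrite le_eqVlt => /predU1P[->|xy yu lx].
  by rewrite !subrr !mulr0 lexx.
have bnd c : x < c -> c < y -> lam y <= lam c <= lam x /\ lam c <= 0.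
  move=> xc cy; have h := lambda1_decr_le x c x0 (ltW xc).
  rewrite h (le_trans h lx) (lambda1_decr_le c y (lt_trans x0 xc) (ltW cy)).
  by [].
apply/andP; split.
  have [c /andP[xc cy] cE] := flowP_rar_MVT _ _ x0 xy yu (lam x).
  have [/andP[_ h1] h2] := bnd c xc cy.
  suff : 0 <= lam c * (lam c - lam x) * (y - x) by lra.
  by rewrite mulr_ge0 ?subr_ge0 ?(ltW xy)// mulr_le0// subr_le0.
have [c /andP[xc cy] cE] := flowP_rar_MVT _ _ x0 xy yu (lam y).
have [/andP[h1 _] h2] := bnd c xc cy.
suff : 0 <= - (lam c * (lam c - lam y) * (y - x)) by lra.
rewrite -mulNr mulr_ge0 ?subr_ge0 ?(ltW xy)//.
by rewrite -mulNr mulr_ge0 ?subr_ge0// oppr_ge0.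
Qed.

Hypothesis lam_u : lambda1 p u < 0.

Lemma shock_speed_lt0 (x : R) : u.1 < x -> shock_speed p u x < 0.
Proof. by move=> ux; apply: le_lt_trans lam_u; exact: shock_speed_lt. Qed.

(** With s the shock speed, Q = [u.2] + s (x - [u.1]) and P = P(u) + s^2 (x - [u.1]). As s is
    negative and decreasing, s^2 increases. *)
Let shock_mono (x y : R) : u.1 <= x -> x < y -> Q y < Q x /\ P x < P y.
Proof.
move=> ux xy; have uy := le_lt_trans ux xy.
have sy := shock_speed_lt0 _ uy.
have PE z : u.1 < z -> P z = flowP p u + shock_speed p u z ^+ 2 * (z - u.1).
  move=> uz; rewrite /P flowP_shock// L1E ?(ltW uz)//.
  by ring.
move: ux; rewrite le_eqVlt => /predU1P[ux|ux].
  rewrite (PE _ uy) /Q (L1E p pP u u1_gt0 y (ltW uy)) /P -ux L1_self//.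
  have -> : (u.1, u.2) = u by case: (u).
  have d0 : 0 < y - u.1 by rewrite subr_gt0.
  by split; [rewrite gtrDl nmulr_rlt0|rewrite ltrDl mulr_gt0// expr2 nmulr_rgt0].
have sx := shock_speed_lt0 _ ux.
have ss := shock_speed_decr p pP u u1_gt0 _ _ ux xy.
rewrite (PE _ ux) (PE _ uy) /Q !L1E ?(ltW ux) ?(ltW uy)// !ltrD2l.
move: (shock_speed p u x) (shock_speed p u y) ss sx sy => a b ab a0 b0.
split; first by nra.
have : a ^+ 2 < b ^+ 2 by nra.
move: (a ^+ 2) (b ^+ 2) (sqr_ge0 a) => a2 b2 a20 ab2.
by nra.
Qed.

Let rar_mono (x y : R) : 0 < x -> lam x <= 0 -> x < y -> y <= u.1 ->
  Q y < Q x /\ P x < P y.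
Proof.
move=> x0 lx xy yu.
have Qlt a b : x <= a -> a < b -> b <= u.1 -> Q b < Q a.
  move=> xa ab bu; have a0 := lt_le_trans x0 xa.
  have [c /andP[ac cb] cE] := L1_rar_MVT a b a0 ab bu.
  rewrite -subr_lt0 cE nmulr_rlt0 ?subr_gt0//.
  by apply: lt_le_trans lx; apply: lambda1_L1_decr => //; exact: le_lt_trans ac.
split; first exact: Qlt.
(* At a sonic [x] the lower bound on the increment of P degenerates to 0. Beyond the midpoint [lam]
   is strictly negative, and the second half gives the strict inequality. *)
pose z := (x + y) / 2.
have xz : x < z by rewrite /z; lra.
have zy : z < y by rewrite /z; lra.
have z0 := lt_trans x0 xz.
have lz : lam z < 0 by apply: lt_le_trans lx; exact: lambda1_L1_decr.
have /andP[h1 _] := flowP_rar_bounds x z x0 (ltW xz) (le_trans (ltW zy) yu) lx.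
have /andP[h2 _] := flowP_rar_bounds z y z0 (ltW zy) yu (ltW lz).
have q1 := Qlt x z (lexx _) xz (le_trans (ltW zy) yu).
have q2 := Qlt z y (ltW xz) zy yu.
have : 0 < lam z * (Q y - Q z) by rewrite nmulr_rgt0// subr_lt0.
have : 0 <= lam x * (Q z - Q x) by rewrite mulr_le0// subr_le0 ltW.
lra.
Qed.

Lemma L1_flowP_mono (x y : R) : 0 < x -> lam x <= 0 -> x < y ->
  Q y < Q x /\ P x < P y.
Proof.
move=> x0 lx xy; have [yu|uy] := leP y u.1; first exact: rar_mono.
have [ux|xu] := leP u.1 x; first exact: shock_mono.
have [h1 h2] := rar_mono _ _ x0 lx xu (lexx _).
have [h3 h4] := shock_mono _ _ (lexx _) uy.
by split; [exact: lt_trans h1|exact: lt_trans h4].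
Qed.

End lax_curve_subsonic.

(** * Sonic densities *)

Section sonic.
Context {R : realType} (p : R -> R).
Hypothesis pP : pressure p.
Hypothesis p_sonic : sonic_densities_determined p.

(** Galilean invariance: the initial momentum only adds the constant velocity [q / r] along the
    curve. All states of density [r] can thus be treated through the one with zero momentum. *)
Lemma L1_shift (r q x : R) : 0 < r -> L1 p x (r, q) = x * (q / r) + L1 p x (r, 0).
Proof.
move=> r0; rewrite /L1/= !mulr0 !sub0r.
by case: ifPn => _; rewrite mulrAC mulrA.
Qed.

Section fixed_density.
Variable r : R.
Hypothesis r_gt0 : 0 < r.

Let s (x : R) := vel p (r, 0) x.
Let H (x : R) := s x + sound p x.
Let k (x : R) := s x - sound p x.

Let velE (q x : R) : 0 < x -> vel p (r, q) x = q / r + s x.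
Proof.
by move=> x0; rewrite /s /vel L1_shift// mulrDl mulrAC divff ?mul1r// gt_eqF.
Qed.

Let c := sound p r.
Let c0 : 0 < c. Proof. exact: sound_gt0. Qed.

(** The state of density [r] and velocity [- y] is subsonic exactly for these [y], and on its curve
    [lambda2] vanishes where [H] takes the level [y]. So the hypothesis on sonic densities becomes a
    statement on levels. *)
Let state (y : R) : - c < y < c -> A0 p (r, - (y * r)).
Proof.
move=> /andP[y1 y2]; split => //; rewrite /lambda1 /lambda2/= mulNr mulfK ?gt_eqF//.
by rewrite -/c; apply/andP; split; lra.
Qed.

Let lambda2E (y x : R) : 0 < x -> lambda2 p (x, L1 p x (r, - (y * r))) = H x - y.
Proof.
move=> x0; rewrite /lambda2/= -/(vel p _ x) velE// mulNr mulfK ?gt_eqF//.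
by rewrite /H; ring.
Qed.

Let lambda1E (y x : R) : 0 < x -> lambda1 p (x, L1 p x (r, - (y * r))) = k x - y.
Proof.
move=> x0; rewrite /lambda1/= -/(vel p _ x) velE// mulNr mulfK ?gt_eqF//.
by rewrite /k; ring.
Qed.

Lemma check_levels_unique (y : R) : - c < y < c ->
  exists! x, 0 < x /\ H x = y.
Proof.
move=> /state /p_sonic[[x [[x0 lx] xu]] _ _ _]; exists x; split.
  by split=> //; move: lx; rewrite lambda2E// => /eqP; rewrite subr_eq0 => /eqP.
by move=> z [z0 Hz]; apply: xu; split=> //; rewrite lambda2E// Hz subrr.
Qed.

Lemma hat_levels_exist (y : R) : - c < y < c -> exists x, 0 < x /\ k x = y.
Proof.
move=> /state /p_sonic[_ [x [[x0 lx] _]] _ _]; exists x.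
by split=> //; move: lx; rewrite lambda1E// => /eqP; rewrite subr_eq0 => /eqP.
Qed.

Let H_cont (x : R) : 0 < x -> {for x, continuous H}.
Proof.
by move=> x0; apply: cvgD; [exact: vel_continuous|exact: sound_continuous].
Qed.

Let k_decr (x y : R) : 0 < x -> x < y -> k y < k x.
Proof.
move=> x0 xy; have := vel_decr p pP (r, 0) r_gt0 _ _ x0 xy.
have := sound_nd p pP _ _ x0 (ltW xy); rewrite /k /s; lra.
Qed.

Let kH (x : R) : 0 < x -> k x < H x.
Proof. by move=> /(sound_gt0 p pP); rewrite /k /H; lra. Qed.

Let sr : s r = 0.
Proof. by rewrite /s /vel [X in X / _](L1_self p (r, 0))//= mul0r. Qed.

Let Hr : H r = c. Proof. by rewrite /H sr add0r. Qed.
Let kr : k r = - c. Proof. by rewrite /k sr sub0r. Qed.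

(** This replaces the monotonicity that [lambda2] may lack: its sign changes only once along the
    curve, and it does so beyond the density [r] of the given state. *)
Lemma lambda2_check (q b x : R) : A0 p (r, q) -> 0 < b -> 0 < x ->
  lambda2 p (b, L1 p b (r, q)) = 0 ->
  r < b /\ (0 <= lambda2 p (x, L1 p x (r, q))) = (x <= b).
Proof.
move=> [_]; rewrite /lambda1 /lambda2/= => /andP[q1 q2] b0 x0.
rewrite -/(vel p _ b) -/(vel p _ x) !velE// => lb.
have yc : - c < - (q / r) < c by apply/andP; split; rewrite /c; lra.
have Hb : H b = - (q / r) by rewrite /H; lra.
split; first exact: (@unique_levels_root R H k r c H_cont k_decr kH Hr kr
    check_levels_unique hat_levels_exist _ b yc b0 Hb).
have -> : q / r + s x + sound p x = H x - H b by rewrite Hb /H; lra.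
rewrite subr_ge0; have [xb|bx|->] := ltgtP x b; last by rewrite lexx.
- rewrite ltW// Hb; exact: (@unique_levels_before R H k r c r_gt0 H_cont k_decr kH Hr kr
  check_levels_unique hat_levels_exist _ b yc b0 Hb).
- apply/negbTE; rewrite -ltNge Hb; exact: (@unique_levels_after R H k r c r_gt0 H_cont
    k_decr kH Hr kr check_levels_unique hat_levels_exist _ b x yc b0 Hb).
Qed.

End fixed_density.

Section subsonic.
Variable u : R * R.
Hypothesis uA0 : A0 p u.

Let u1_gt0 : 0 < u.1. Proof. by case: uA0. Qed.

Lemma phi_check_lP : 0 < phi_check_l p u /\
  lambda2 p (phi_check_l p u, L1 p (phi_check_l p u) u) = 0.
Proof. by have [[x [xP _]] _ _ _] := p_sonic _ uA0; exact: (getI xP). Qed.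

Lemma phi_hat_lP : 0 < phi_hat_l p u /\
  lambda1 p (phi_hat_l p u, L1 p (phi_hat_l p u) u) = 0.
Proof. by have [_ [x [xP _]] _ _] := p_sonic _ uA0; exact: (getI xP). Qed.

Lemma lambda1_hat (x : R) : 0 < x ->
  (lambda1 p (x, L1 p x u) <= 0) = (phi_hat_l p u <= x).
Proof.
have [a0 la] := phi_hat_lP => x0; rewrite -[X in _ <= X]la.
have [ax|xa|->] := ltgtP (phi_hat_l p u) x; last by rewrite lexx.
- by rewrite ltW// lambda1_L1_decr.
- by apply/negbTE; rewrite -ltNge lambda1_L1_decr.
Qed.

Lemma phi_hat_l_lt : phi_hat_l p u < u.1.
Proof.
have [a0 la] := phi_hat_lP; rewrite ltNge; apply/negP => ua.
have := lambda1_decr_le p pP u u1_gt0 _ _ u1_gt0 ua.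
rewrite la L1_self// leNgt; have -> : (u.1, u.2) = u by case: (u).
by have [_ /andP[->]] := uA0.
Qed.

Lemma phi_check_l_gt : u.1 < phi_check_l p u.
Proof.
have [b0 lb] := phi_check_lP; case: u uA0 u1_gt0 b0 lb => r q rqA0 r0 b0 lb.
by have [] := lambda2_check r r0 q _ r rqA0 b0 r0 lb.
Qed.

(** The lower end comes from the monotonicity of [lambda1], the upper end from the sign of [lambda2]
    in [lambda2_check]. From here on, subsonic means an interval of densities. *)
Lemma A0cl_L1 (x : R) :
  A0cl p (x, L1 p x u) <-> phi_hat_l p u <= x <= phi_check_l p u.
Proof.
have [a0 la] := phi_hat_lP; have [b0 lb] := phi_check_lP.
have E y : 0 < y -> (0 <= lambda2 p (y, L1 p y u)) = (y <= phi_check_l p u).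
  move=> y0; case: u uA0 u1_gt0 b0 lb => r q rqA0 r0 b0 lb.
  by have [] := lambda2_check r r0 q _ y rqA0 b0 y0 lb.
split => [[/= x0 /andP[h1 h2]]|/andP[ax xb]].
  by rewrite -lambda1_hat// h1 -E.
have x0 := lt_le_trans a0 ax.
by split => //=; rewrite lambda1_hat// ax E.
Qed.

(** At the sonic end the velocity equals the sound speed. Together with the opposite sign at the
    other end this puts zero flow strictly inside the range of flows. *)
Lemma L1_hat_gt0 : 0 < L1 p (phi_hat_l p u) u.
Proof.
have [a0 /eqP] := phi_hat_lP; rewrite /lambda1/= subr_eq0 => /eqP h.
have i0 : 0 < (phi_hat_l p u)^-1 by rewrite invr_gt0.
by rewrite -(pmulr_lgt0 _ i0) h sound_gt0.
Qed.

Lemma L1_check_lt0 : L1 p (phi_check_l p u) u < 0.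
Proof.
have [a0 /eqP] := phi_check_lP; rewrite /lambda2/= addr_eq0 => /eqP h.
have i0 : 0 < (phi_check_l p u)^-1 by rewrite invr_gt0.
by rewrite -(pmulr_llt0 _ i0) h oppr_lt0 sound_gt0.
Qed.

End subsonic.
End sonic.

(** * Scaling and integrals over segments *)

Section scaling.
Context {R : realType}.
Local Notation mu := (@lebesgue_measure R).
Variable t : R.
Hypothesis t0 : 0 < t.

Let k : {nonneg R} := NngNum (ltW t0).

Lemma lebesgue_measure_scale (A : set (measurableTypeR R)) : measurable A ->
  pushforward (mscale k mu) ( *%R t : _ -> measurableTypeR R) A = mu A.
Proof.
move=> mA; apply/esym/lebesgue_measure_unique => //=.

move=> _ [[a b]] _ <-; rewrite /pushforward/= /mscale/=.
have -> : ( *%R t @^-1` `]a, b]) = `](a / t), (b / t)]%classic.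
  apply/seteqP; split => x/=; rewrite !in_itv/= ltr_pdivrMr// ler_pdivlMr//.
    by rewrite !(mulrC x).
  by rewrite !(mulrC x).
rewrite !lebesgue_measure_itv/= !lte_fin ltr_pM2r ?invr_gt0//.
case: ifPn => _; last by rewrite mule0.
by rewrite -!EFinB -EFinM; congr _%:E; field; rewrite gt_eqF.
Qed.

Lemma ge0_integral_scale (f : R -> \bar R) : measurable_fun setT f ->
    (forall x, 0 <= f x)%E ->
  (\int[mu]_x f x = \int[mu]_x (t%:E * f (t * x)%R))%E.
Proof.
move=> mf f0.
have ms := @mulrl_measurable R setT t.
transitivity (\int[pushforward (mscale k mu) ( *%R t : _ -> measurableTypeR R)]_x f x)%E.
  by apply: eq_measure_integral => //= A mA _; rewrite lebesgue_measure_scale.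
rewrite ge0_integral_pushforward//= preimage_setT.
have mft : measurable_fun setT (f \o *%R t) by exact: measurableT_comp.
by rewrite ge0_integral_mscale//= ge0_integralZl// lee_fin ltW.
Qed.

Lemma integral_scale (f : R -> \bar R) : measurable_fun setT f ->
  (\int[mu]_x f x = \int[mu]_x (t%:E * f (t * x)%R))%E.
Proof.
move=> mf; rewrite [LHS]integralE [RHS]integralE.
rewrite ge0_funeposM ?ge0_funenegM ?(ltW t0)//.
rewrite ge0_integral_scale//; last exact: measurable_funepos.
rewrite [X in (_ - X)%E = _]ge0_integral_scale//; last first.
  exact: measurable_funeneg.
congr (_ - _)%E; apply: eq_integral => x _; congr (_ * _)%E.
  exact: (esym (congr1 (@^~ x) (funepos_comp f ( *%R t)))).
exact: (esym (congr1 (@^~ x) (funeneg_comp f ( *%R t)))).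
Qed.

End scaling.

(** Bisection: each halving divides the length by 2, while the increments of [V] over the two halves
    only add up. So the bound on [E] is halved at every step. *)
Lemma additive_interval_eq0 {R : realType} (E : R -> R -> R) (V : R -> R)
    (a b : R) : a <= b ->
    (forall x y z, a <= x -> x <= y -> y <= z -> z <= b ->
      E x z = E x y + E y z) ->
    (forall x y, a <= x -> x <= y -> y <= b ->
      `|E x y| <= (y - x) * (V y - V x)) ->
  E a b = 0.
Proof.
move=> ab ED EV.
have EVn n : forall x y, a <= x -> x <= y -> y <= b ->
    `|E x y| <= (y - x) * (V y - V x) / 2 ^+ n.
  elim: n => [x y ax xy yb|n IH x y ax xy yb]; first by rewrite divr1 EV.
  pose m := (x + y) / 2.
  have xm : x <= m by rewrite /m; lra.
  have my : m <= y by rewrite /m; lra.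
  rewrite (ED x m y)// (le_trans (ler_normD _ _))//.
  rewrite (le_trans (lerD (IH _ _ ax xm _) (IH _ _ _ my yb)))//.
  - exact: le_trans yb.
  - exact: le_trans xm.
  - have p2 : (2 : R) ^+ n != 0 by rewrite expf_neq0.
    rewrite exprS le_eqVlt; apply/orP; left; apply/eqP; rewrite /m; field.
    by rewrite p2.
apply/eqP; rewrite -normr_le0 leNgt; apply/negP => E0.
pose C := (b - a) * (V b - V a).
have C0 : 0 <= C by apply: le_trans (EV _ _ (lexx _) ab (lexx _)).
(* An integer n above the quotient of [C] by the absolute value of [E a b]; since n is at most 2^n,
   n bisections contradict it. *)
have := archi_boundP (divr_ge0 C0 (ltW E0)).
set n := Num.bound _; rewrite ltNge => /negP; apply.
rewrite ler_pdivlMr//.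
have := EVn n _ _ (lexx _) ab (lexx _); rewrite -/C ler_pdivlMr ?exprn_gt0//.
apply: le_trans; rewrite mulrC ler_wpM2l//.
by rewrite -natrX ler_nat ltnW// ltn_expl.
Qed.

Section Rintegral_segment.
Context {R : realType}.
Local Notation mu := (@lebesgue_measure R).
Implicit Types f g : R -> R.

Lemma integrable_segmentS f (a b x y : R) : a <= x -> y <= b ->
  mu.-integrable `[a, b] (EFin \o f) -> mu.-integrable `[x, y] (EFin \o f).
Proof.
move=> ax yb; apply: integrableS => //.
by apply: subset_itv; rewrite bnd_simp.
Qed.

Lemma Rintegral_split f (x y z : R) : x <= y -> y <= z ->
    mu.-integrable `[x, z] (EFin \o f) ->
  (\int[mu]_(s in `[x, z]) f s =
   \int[mu]_(s in `[x, y]) f s + \int[mu]_(s in `[y, z]) f s)%R.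
Proof.
move=> xy yz fi; have := @Rintegral_itvB R f (BLeft x) (BRight z) y fi.
rewrite !bnd_simp => /(_ xy yz) E.
rewrite -(@Rintegral_itv_obnd_cbnd _ y); last first.
  by apply: integrableS fi => //; apply: subset_itvr; rewrite bnd_simp.
by rewrite -E addrC subrK.
Qed.

Lemma continuous_segment_integrable f (a b : R) :
  (forall x, a <= x <= b -> {for x, continuous f}) ->
  mu.-integrable `[a, b] (EFin \o f).
Proof.
move=> cf; apply: continuous_compact_integrable; first exact: segment_compact.
exact: continuous_within_itvcc.
Qed.

Lemma Rintegral_segment_le f (x y B : R) : x <= y ->
    mu.-integrable `[x, y] (EFin \o f) ->
    (forall s, x <= s <= y -> `|f s| <= B) ->
  `|\int[mu]_(s in `[x, y]) f s|%R <= B * (y - x).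
Proof.
move=> xy fi fB; apply: le_trans (le_normr_Rintegral _ fi) _ => //.
apply: (@le_trans _ _ (\int[mu]_(s in `[x, y]) B)%R).
  apply: le_Rintegral => //.
  - by have /integrable_norm := fi.
  - by apply: continuous_segment_integrable => z _; exact: cvg_cst.
rewrite Rintegral_cst//= lebesgue_measure_itv/= lte_fin.
move: xy; rewrite le_eqVlt => /predU1P[->|->//]; rewrite ltxx/= subrr !mulr0.
by [].
Qed.

Lemma bounded_segment_integrable f (a b B : R) :
  measurable_fun `[a, b] f -> (forall x, a <= x <= b -> `|f x| <= B) ->
  mu.-integrable `[a, b] (EFin \o f).
Proof.
move=> mf fB; apply: measurable_bounded_integrable => //.
  by rewrite /= lebesgue_measure_itv/=; case: ifPn => _; rewrite ?ltry.
exists B; split; first exact: num_real.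
move=> M BM x /=; rewrite in_itv/= => /fB/le_trans; apply; exact: ltW.
Qed.

Lemma Rintegral_derive (F f : R -> R) (a b : R) : a <= b ->
    (forall x, a <= x <= b -> is_derive x (1 : R) F (f x)) ->
    (forall x, a <= x <= b -> {for x, continuous f}) ->
  (\int[mu]_(x in `[a, b]) f x)%R = F b - F a.
Proof.
rewrite le_eqVlt => /predU1P[->|ab] dF cf.
  by rewrite set_itv1 Rintegral_set1 subrr.
rewrite /Rintegral (@continuous_FTC2 R f F)//.
- exact: continuous_within_itvcc.
- have cF x : a <= x <= b -> {for x, continuous F}.
    by move=> /dF[dFx _]; exact: derivable1_continuous.
  split.
  + move=> x; rewrite ?inE/= ?in_itv/= => /andP[ax xb].
    by have [|] := dF x; rewrite ?(ltW ax) ?(ltW xb).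
  + by apply: cvg_at_right_filter; apply: cF; rewrite lexx ltW.
  + by apply: cvg_at_left_filter; apply: cF; rewrite lexx ltW.
- move=> x; rewrite ?inE/= ?in_itv/= => /andP[ax xb].
  by have [|_ E] := dF x; rewrite ?(ltW ax) ?(ltW xb)// derive1E.
Qed.

End Rintegral_segment.

(** * Weak form of self-similar solutions *)

Definition monotone_fun {R : realType} (f : R -> R) :=
  nondecreasing_fun f \/ nonincreasing_fun f.

(* The increments of the flux [G] and of the state [W] of a centered wave are
   related by intermediate speeds: the shock speed for a shock, a mean value of
   the characteristic speed for a rarefaction. *)
Definition speed_bounded {R : realType} (W G : R -> R) :=
  forall x y, `|G y - G x - y * (W y - W x)| <= `|y - x| * `|W y - W x|.

Lemma monotone_measurable {R : realType} (D : set R) (f : R -> R) :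
  measurable D -> monotone_fun f -> measurable_fun D f.
Proof.
by move=> mD [|]; [exact: nondecreasing_measurable|exact: nonincreasing_measurable].
Qed.

Lemma monotone_dist {R : realType} (f : R -> R) : monotone_fun f ->
  exists V, forall x y, x <= y -> `|f y - f x| = V y - V x.
Proof.
move=> [fnd|fni].
  by exists f => x y xy; rewrite ger0_norm// subr_ge0 fnd.
exists (fun x => - f x) => x y xy.
by rewrite ler0_norm ?subr_le0 ?fni// opprB opprK addrC.
Qed.

Section weak_ode.
Context {R : realType}.
Local Notation mu := (@lebesgue_measure R).
Variables (W G : R -> R) (M : R).
Hypothesis Wmono : monotone_fun W.
Hypothesis WM : forall x, `|W x| <= M.
Hypothesis WG : speed_bounded W G.

Let M0 : 0 <= M. Proof. exact: le_trans (WM 0). Qed.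
Let K (x : R) := G x - x * W x.

Lemma speed_bounded_increment (x y : R) :
  `|K y - K x + W x * (y - x)| <= `|y - x| * `|W y - W x|.
Proof.
have := WG x y.
suff -> : K y - K x + W x * (y - x) = G y - G x - y * (W y - W x) by [].
by rewrite /K; ring.
Qed.

Let WW (x y : R) : `|W y - W x| <= 2 * M.
Proof.
rewrite (le_trans (ler_normB _ _))//.
have := WM x; have := WM y; lra.
Qed.

(** The constant is [2 * M], a bound for the variation of [W], plus [M] for the term
    [W x * (y - x)]. Thus [K] is continuous even where [W] and [G] jump. *)
Lemma potential_lipschitz (x y : R) : `|K y - K x| <= 3 * M * `|y - x|.
Proof.
have h := speed_bounded_increment x y.
rewrite -[X in `|X|](addrK (W x * (y - x))) (le_trans (ler_normB _ _))//.
rewrite normrM.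
have h1 : `|y - x| * `|W y - W x| <= `|y - x| * (2 * M) by rewrite ler_wpM2l.
have h2 : `|W x| * `|y - x| <= M * `|y - x| by rewrite ler_wpM2r.
lra.
Qed.

Lemma potential_continuous (x : R) : {for x, continuous K}.
Proof.
have M1 : 0 < 3 * M + 1 by have := M0; lra.
apply/cvgrPdist_le => e e0; near=> y.
rewrite distrC (le_trans (potential_lipschitz _ _))//.
have : `|y - x| <= e / (3 * M + 1).
  rewrite distrC; near: y.
  apply: (@cvgr_dist_le _ _ _ (nbhs x) _ id x); first exact: cvg_id.
  exact: divr_gt0.
rewrite ler_pdivlMr// => h; apply: le_trans h.
rewrite mulrC ler_wpM2l//; lra.
Unshelve. all: by end_near. Qed.

Lemma potential_measurable : measurable_fun setT K.
Proof. by apply: continuous_measurable_fun => x; exact: potential_continuous. Qed.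

Section test.
Variables (eta deta : R -> R) (a b N : R).
Hypothesis ab : a <= b.
Hypothesis deta_is : forall x, is_derive x (1 : R) eta (deta x).
Hypothesis deta_cont : continuous deta.
Hypothesis etaN : forall x, a <= x <= b -> `|eta x| <= N.
Hypothesis detaN : forall x, a <= x <= b -> `|deta x| <= N.

Let N0 : 0 <= N. Proof. by apply: le_trans (etaN a _) => //; rewrite lexx. Qed.

Let eta_cont (x : R) : {for x, continuous eta}.
Proof. by apply: derivable1_continuous; have [] := deta_is x. Qed.

Let f (x : R) := K x * deta x - W x * eta x.

Let intf1 : mu.-integrable `[a, b] (EFin \o (fun x => K x * deta x)).
Proof.
apply: continuous_segment_integrable => x _; apply: cvgM.
  exact: potential_continuous.
exact: deta_cont.
Qed.

Let intf2 : mu.-integrable `[a, b] (EFin \o (fun x => W x * eta x)).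
Proof.
apply: (@bounded_segment_integrable _ _ _ _ (M * N)) => [|x xab].
  apply: measurable_funM; first exact: monotone_measurable.
  by apply: measurable_funTS; exact: continuous_measurable_fun.
by rewrite normrM ler_pM// etaN.
Qed.

Lemma weak_ode_integrable : mu.-integrable `[a, b] (EFin \o f).
Proof. exact: (integrableB _ intf1 intf2). Qed.

Let intf := weak_ode_integrable.

(** The defect of the identity of [weak_ode] on [[x, y]]. It is additive in the interval, so only a
    bound of second order on short intervals is required. *)
Let E (x y : R) :=
  (\int[mu]_(s in `[x, y]) f s)%R - (K y * eta y - K x * eta x).

(** The integrand recentered at [K x] and [W x * eta y]: each of its terms is small on a short
    interval, and the subtracted constants integrate exactly. *)
Let g (x y s : R) := (K s - K x) * deta s - (W s * eta s - W x * eta y).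

Let E_eq (x y : R) : a <= x -> x <= y -> y <= b ->
  E x y = (\int[mu]_(s in `[x, y]) g x y s)%R -
          (K y - K x + W x * (y - x)) * eta y.
Proof.
move=> ax xy yb.
have intd : mu.-integrable `[x, y] (EFin \o (fun s => K x * deta s)).
  apply: continuous_segment_integrable => s _.
  by apply: cvgM; [exact: cvg_cst|exact: deta_cont].
have intc : mu.-integrable `[x, y] (EFin \o (fun=> W x * eta y)).
  by apply: continuous_segment_integrable => s _; exact: cvg_cst.
have -> : (\int[mu]_(s in `[x, y]) g x y s)%R =
    (\int[mu]_(s in `[x, y]) ((f s - K x * deta s) + W x * eta y))%R.
  by apply: eq_Rintegral => s _; rewrite /g /f; ring.
have intfx := integrable_segmentS _ _ _ _ _ ax yb intf.
rewrite RintegralD//; last exact: (integrableB _ intfx intd).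
rewrite RintegralB// RintegralZl//; last first.
  by apply: continuous_segment_integrable => s _; exact: deta_cont.
rewrite (@Rintegral_derive _ eta)//; last by move=> s _; exact: deta_cont.
rewrite Rintegral_cst//= lebesgue_measure_itv/= lte_fin.
have -> : fine (if (x < y)%R then y%:E - x%:E else 0)%E = y - x.
  by move: xy; rewrite le_eqVlt => /predU1P[->|->//]; rewrite ltxx subrr.
by rewrite /E; ring.
Qed.

Lemma weak_ode :
  (\int[mu]_(s in `[a, b]) f s)%R = K b * eta b - K a * eta a.
Proof.
have [V VE] := monotone_dist _ Wmono.
apply/eqP; rewrite -subr_eq0; apply/eqP.
(* In [4 * M * N], 3 comes from the Lipschitz bound on [K] and 1 from that on [eta]. In [2 * N], one
   [N] comes from the variation of [W] in the integrand [g], the other from the increment of [K]. *)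
apply: (@additive_interval_eq0 _ E
  (fun x => 4 * M * N * x + 2 * N * V x) a b ab) => [x y z ax xy yz zb|x y ax xy yb].
  rewrite /E (@Rintegral_split _ _ _ y)//; first by ring.
  exact: (integrable_segmentS _ _ _ _ _ ax zb intf).
have yab : a <= y <= b by rewrite yb (le_trans ax xy).
have VW s : x <= s -> s <= y -> `|W s - W x| <= V y - V x.
  move=> xs sy; rewrite VE//.
  have : 0 <= V y - V s by rewrite -VE.
  lra.
have Vxy : 0 <= V y - V x by rewrite -VE.
rewrite E_eq// (le_trans (ler_normB _ _))//.
have gB s : x <= s <= y ->
    `|g x y s| <= 4 * M * N * (y - x) + N * (V y - V x).
  move=> /andP[xs sy].
  have sab : a <= s <= b by rewrite (le_trans ax xs) (le_trans sy yb).
  have sx : `|s - x| <= y - x by rewrite ger0_norm ?subr_ge0// lerD2r.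
  have h1 : `|(K s - K x) * deta s| <= 3 * M * (y - x) * N.
    rewrite normrM ler_pM ?detaN//.
    by rewrite (le_trans (potential_lipschitz _ _))// ler_wpM2l ?mulr_ge0.
  have h2 : `|(W s - W x) * eta s| <= (V y - V x) * N.
    by rewrite normrM ler_pM ?etaN ?VW.
  have h3 : `|W x * (eta s - eta y)| <= M * (N * (y - x)).
    rewrite normrM ler_pM// distrC -(@Rintegral_derive _ eta deta s y)//; last first.
      by move=> z _; exact: deta_cont.
    rewrite (le_trans (@Rintegral_segment_le _ _ _ _ N sy _ _))//.
    - by apply: continuous_segment_integrable => z _; exact: deta_cont.
    - move=> z /andP[sz zy]; apply: detaN.
      by case/andP: sab => as_ _; rewrite (le_trans as_ sz) (le_trans zy yb).
    - by rewrite ler_wpM2l// lerD2l lerN2.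
  have -> : g x y s =
      (K s - K x) * deta s - ((W s - W x) * eta s + W x * (eta s - eta y)).
    by rewrite /g; ring.
  rewrite (le_trans (ler_normB _ _))//.
  have := ler_normD ((W s - W x) * eta s) (W x * (eta s - eta y)).
  lra.
have intg : mu.-integrable `[x, y] (EFin \o g x y).
  have sub : `[x, y] `<=` `[a, b] by apply: subset_itv; rewrite bnd_simp.
  have i1 := integrable_segmentS _ _ _ _ _ ax yb intf.
  have i2 : mu.-integrable `[x, y] (EFin \o (fun s => K x * deta s - W x * eta y)).
    apply: continuous_segment_integrable => s _; apply: cvgB; last exact: cvg_cst.
    by apply: cvgM; [exact: cvg_cst|exact: deta_cont].
  apply: eq_integrable (integrableB _ i1 i2) => // s _ /=.
  by rewrite -EFinB; congr _%:E; rewrite /g /f; ring.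
have h1 := Rintegral_segment_le _ _ _ _ xy intg gB.
have h2 : `|(K y - K x + W x * (y - x)) * eta y| <= (y - x) * (V y - V x) * N.
  rewrite normrM ler_pM ?etaN// (le_trans (speed_bounded_increment _ _))//.
  by rewrite ger0_norm ?subr_ge0// ler_wpM2l ?subr_ge0// VW.
lra.
Qed.

End test.
End weak_ode.

(** * Test functions: derivatives along lines, support and bounds *)

Section test_functions.
Context {R : realType}.
Variable phi : R * R -> R.
Hypothesis phi_test : test_function phi.

Let supp := closure [set z | phi z != 0].

Let cphi : continuous phi.
Proof. by move=> z; apply: differentiable_continuous; have [] := phi_test. Qed.

Let cdt : continuous (d_t phi). Proof. by have [_ []] := phi_test. Qed.
Let cdx : continuous (d_x phi). Proof. by have [_ []] := phi_test. Qed.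

Lemma derive_test (v z : R * R) :
  'D_v phi z = v.1 * d_t phi z + v.2 * d_x phi z.
Proof.
have [/(_ z) dz _ _ _] := phi_test.
rewrite /d_t /d_x !deriveE//.
have {1}-> : v = v.1 *: (1 : R, 0 : R) + v.2 *: (0 : R, 1 : R).
  case: v => v1 v2; congr (_, _);
  by rewrite /= /GRing.scale/= !(mulr1, mulr0) ?addr0 ?add0r.
by rewrite linearD !linearZ.
Qed.

Lemma is_derive_line (z v : R * R) (s : R) :
  is_derive s (1 : R) (fun r : R => phi (z + r *: v))
    (v.1 * d_t phi (z + s *: v) + v.2 * d_x phi (z + s *: v)).
Proof.
have [/(_ (z + s *: v)) dz _ _ _] := phi_test.
have E : (fun h : R => h^-1 *: (phi (z + (h *: (1 : R) + s) *: v) - phi (z + s *: v)))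
       = (fun h : R => h^-1 *: (phi (h *: v + (z + s *: v)) - phi (z + s *: v))).
  apply/funext => h; congr (_ *: (phi _ - _)).
  by rewrite scalerDl -[h *: 1]/(h * 1) mulr1 addrCA.
apply: DeriveDef; last by rewrite -derive_test /derive; congr (lim _); rewrite -E.
have := @diff_derivable _ _ _ phi (z + s *: v) v dz; rewrite /derivable -E; exact.
Qed.

Let outside (z : R * R) : ~ supp z ->
  [/\ phi z = 0, d_t phi z = 0 & d_x phi z = 0].
Proof.
move=> nz; have near0 : \forall y \near z, phi y = (cst 0) y.
  have : nbhs z (~` supp).
    by apply: open_nbhs_nbhs; split=> //; apply: closed_openC; exact: closed_closure.
  apply: filterS => y ny; apply/eqP/negPn/negP => h; apply: ny.
  exact: subset_closure.
split; first exact: (nbhs_singleton near0).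
- by rewrite /d_t (near_eq_derive _ near0)// derive_cst.
- by rewrite /d_x (near_eq_derive _ near0)// derive_cst.
Qed.

(** The support avoids the junction. Hence the two sides decouple, boundary terms at [x = 0] vanish,
    and the values of the waves at speed 0 do not matter. *)
Lemma test_axis (t : R) :
  [/\ phi (t, 0) = 0, d_t phi (t, 0) = 0 & d_x phi (t, 0) = 0].
Proof.
by apply: outside => h; have [_ _ _ /(_ _ h)/= [_]] := phi_test; rewrite eqxx.
Qed.

Lemma test_bounds : exists e T : R, [/\ 0 < e, e < T & forall z,
  ~ (e <= z.1 <= T /\ `|z.2| <= T) ->
  [/\ phi z = 0, d_t phi z = 0 & d_x phi z = 0]].
Proof.
have [_ _ csupp pos] := phi_test.
have c1 : compact (fst @` supp).
  by apply: continuous_compact csupp; apply: continuous_subspaceT => z; exact: cvg_fst.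
have c2 : compact (snd @` supp).
  by apply: continuous_compact csupp; apply: continuous_subspaceT => z; exact: cvg_snd.
have [T1 [_ T1P]] := compact_bounded c1.
have [T2 [_ T2P]] := compact_bounded c2.
have [e e0 eP] : exists2 e : R, 0 < e & forall z, supp z -> e <= z.1.
  have : nbhs (0 : R) (~` (fst @` supp)).
    apply: open_nbhs_nbhs; split.
      by apply: closed_openC; exact: compact_closed (@Rhausdorff R) c1.
    by move=> [z /pos/= [z0 _] z1]; rewrite z1 ltxx in z0.
  move=> /nbhs_ballP[e /= e0 eP]; exists e => // z sz.
  rewrite leNgt; apply/negP => ze.
  have [z0 _] := pos z sz.
  apply: (eP z.1); last by exists z.
  by rewrite /ball/= sub0r normrN gtr0_norm.
(* [compact_bounded] provides a bound for every number strictly above [T1], respectively [T2], hence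
   the added 1; it also ensures [e < T]. *)
exists e, (Num.max e (Num.max T1 T2) + 1); split => //.
  by rewrite (@le_lt_trans _ _ (Num.max e (Num.max T1 T2))) ?le_max ?lexx// ltrDl.
move=> z nz; apply: outside => sz; apply: nz.
have lt1 : T1 < Num.max e (Num.max T1 T2) + 1.
  by rewrite (@le_lt_trans _ _ (Num.max e (Num.max T1 T2))) ?le_max ?lexx ?orbT// ltrDl.
have lt2 : T2 < Num.max e (Num.max T1 T2) + 1.
  by rewrite (@le_lt_trans _ _ (Num.max e (Num.max T1 T2))) ?le_max ?lexx ?orbT// ltrDl.
split; last by apply: (T2P _ lt2); exists z.
rewrite eP//= (le_trans (ler_norm _))//.
by apply: (T1P _ lt1); exists z.
Qed.

Lemma test_bounded : exists N : R, forall z,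
  [/\ `|phi z| <= N, `|d_t phi z| <= N & `|d_x phi z| <= N].
Proof.
have [_ _ csupp _] := phi_test.
have bnd (f : R * R -> R) : continuous f -> exists N : R, forall z, supp z -> `|f z| <= N.
  move=> cf; have c : compact (f @` supp).
    by apply: continuous_compact csupp; exact: continuous_subspaceT.
  have [N [_ NP]] := compact_bounded c.
  by exists (N + 1) => z sz; apply: (NP (N + 1)); [rewrite ltrDl|exists z].
have [N1 h1] := bnd _ cphi; have [N2 h2] := bnd _ cdt; have [N3 h3] := bnd _ cdx.
pose N := Num.max 0 (Num.max N1 (Num.max N2 N3)).
have N0 : 0 <= N by rewrite le_max lexx.
have n1 : N1 <= N by rewrite le_max; apply/orP; right; rewrite le_max lexx.
have n23 : Num.max N2 N3 <= N.
  by rewrite le_max; apply/orP; right; rewrite le_max lexx orbT.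
have n2 : N2 <= N by apply: le_trans n23; rewrite le_max lexx.
have n3 : N3 <= N by apply: le_trans n23; rewrite le_max lexx orbT.
exists N => z; have [sz|nz] := pselect (supp z).
  split; [exact: le_trans (h1 z sz) n1|exact: le_trans (h2 z sz) n2|].
  exact: le_trans (h3 z sz) n3.
by have [-> -> ->] := outside _ nz; rewrite normr0.
Qed.

End test_functions.

Definition sides {R : realType} {T : Type} (f g : R -> T) (x : R) : T :=
  if x < 0 then f x else g x.

Lemma sides_measurable {R : realType} (f g : R -> R) :
  measurable_fun setT f -> measurable_fun setT g -> measurable_fun setT (sides f g).
Proof.
move=> mf mg; apply: measurable_fun_ifT => //.
by apply: measurable_fun_ltr => //; exact: measurable_cst.
Qed.

(* The space integral in the weak formulation is the time derivative of
   [J t = \int W xi * (t * phi (t, t * xi)) dxi], which vanishes for [t] small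
   and for [t] large. *)
Section selfsimilar.
Context {R : realType}.
Local Notation mu := (@lebesgue_measure R).
Variables (Wm Gm Wp Gp : R -> R) (M : R).
Hypothesis Wm_mono : monotone_fun Wm.
Hypothesis Wp_mono : monotone_fun Wp.
Hypothesis WmM : forall x, `|Wm x| <= M.
Hypothesis WpM : forall x, `|Wp x| <= M.
Hypothesis WGm : speed_bounded Wm Gm.
Hypothesis WGp : speed_bounded Wp Gp.

Let W := sides Wm Wp.
Let G := sides Gm Gp.

Let WM x : `|W x| <= M. Proof. by rewrite /W /sides; case: ifP. Qed.
Let M0 : 0 <= M. Proof. exact: le_trans (WM 0). Qed.

(** The flux is the Lipschitz potential [g x - x * w x] plus [x * w x] with [w] monotone; nothing is
    assumed directly on [g]. *)
Let flux_measurable (w g : R -> R) : monotone_fun w -> (forall x, `|w x| <= M) ->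
  speed_bounded w g -> measurable_fun setT g.
Proof.
move=> wm wM wg; have -> : g = (fun x => (g x - x * w x) + x * w x).
  by apply/funext => x; rewrite subrK.
apply: measurable_funD; first exact: (potential_measurable w g M).
by apply: measurable_funM; [|exact: monotone_measurable].
Qed.

Let mW : measurable_fun setT W.
Proof. by apply: sides_measurable; exact: monotone_measurable. Qed.

Let mG : measurable_fun setT G.
Proof.
by apply: sides_measurable; [exact: (flux_measurable Wm)|exact: (flux_measurable Wp)].
Qed.

Let flux_bound (w g : R -> R) (B x : R) : (forall x, `|w x| <= M) ->
  speed_bounded w g -> `|x| <= B -> `|g x| <= `|g 0| + 4 * M * B.
Proof.
move=> wM wg xB; have h := potential_lipschitz w g M wM wg 0 x.
rewrite subr0 mul0r subr0 in h.
have -> : g x = (g x - x * w x - g 0) + x * w x + g 0 by ring.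
have h1 : `|x * w x| <= B * M by rewrite normrM ler_pM.
have h2 : 3 * M * `|x| <= 3 * M * B by rewrite ler_wpM2l// mulr_ge0.
rewrite (le_trans (ler_normD _ _))//.
have := ler_normD (g x - x * w x - g 0) (x * w x); lra.
Qed.

Let GB (B x : R) : `|x| <= B -> `|G x| <= `|Gm 0| + `|Gp 0| + 4 * M * B.
Proof.
move=> xB; rewrite /G /sides; case: ifP => _.
  have := flux_bound _ _ _ _ WmM WGm xB; have := normr_ge0 (Gp 0); lra.
have := flux_bound _ _ _ _ WpM WGp xB; have := normr_ge0 (Gm 0); lra.
Qed.

Variable phi : R * R -> R.
Hypothesis phi_test : test_function phi.

Let cphi : continuous phi.
Proof. by move=> z; apply: differentiable_continuous; have [] := phi_test. Qed.
Let cdt : continuous (d_t phi). Proof. by have [_ []] := phi_test. Qed.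
Let cdx : continuous (d_x phi). Proof. by have [_ []] := phi_test. Qed.

Variables e T N : R.
Hypothesis e_gt0 : 0 < e.
Hypothesis eT : e < T.
Hypothesis phi_out : forall z, ~ (e <= z.1 <= T /\ `|z.2| <= T) ->
  [/\ phi z = 0, d_t phi z = 0 & d_x phi z = 0].
Hypothesis phiN : forall z,
  [/\ `|phi z| <= N, `|d_t phi z| <= N & `|d_x phi z| <= N].

Let N0 : 0 <= N. Proof. by have [+ _ _] := phiN 0; exact: le_trans. Qed.
Let T0 : 0 < T. Proof. exact: lt_trans eT. Qed.
(** A window of speeds valid at all times: for [t >= e] and a speed of size at least [B], the point
    [t * x] is at distance at least [T + 1] from 0, outside the support; for [t < e] the test
    function vanishes anyway. *)
Let B := (T + 1) / e.
Let B0 : 0 < B. Proof. by rewrite divr_gt0// addr_gt0. Qed.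

Let outB (t x : R) : 0 < t -> B <= `|x| ->
  [/\ phi (t, t * x) = 0, d_t phi (t, t * x) = 0 & d_x phi (t, t * x) = 0].
Proof.
move=> t0 Bx; apply: phi_out => /= -[/andP[et _]].
rewrite normrM gtr0_norm// leNgt => /negP; apply.
apply: (@lt_le_trans _ _ (e * B)); first by rewrite mulrC divfK ?gt_eqF// ltrDl.
by rewrite ler_pM// ltW.
Qed.

(** The derivative in [t] of [t * phi (t, t * x)] at fixed speed [x]. *)
Let m (t x : R) :=
  phi (t, t * x) + t * (d_t phi (t, t * x) + x * d_x phi (t, t * x)).

Let pairE (t x : R) : (t, t * x) = 0 + t *: (1 : R, x) :> R * R.
Proof. by rewrite add0r; congr (_, _); rewrite /= /GRing.scale/= ?mulr1. Qed.

Let is_derive_t (t x : R) :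
  is_derive t (1 : R) (fun s : R => s * phi (s, s * x)) (m t x).
Proof.
have d1 : is_derive t (1 : R) (fun s : R => phi (s, s * x))
    (d_t phi (t, t * x) + x * d_x phi (t, t * x)).
  have := is_derive_line phi phi_test 0 (1, x) t.
  rewrite mul1r -pairE; congr (is_derive _ _ _ _).
  by apply/funext => s; rewrite -pairE.
have d2 := @is_deriveM _ _ id (fun s : R => phi (s, s * x)) t 1 _ _ (is_derive_id _ _) d1.
apply: is_derive_eq d2 _.
by rewrite /m /GRing.scale/= mulr1 addrC.
Qed.

Let mulr_cont (x : R) : continuous (fun t : R => t * x).
Proof.
have cid : continuous (fun t : R => t) by move=> t; exact: cvg_id.
by move=> t; exact: (cvgM (cid t) (cvg_cst x)).
Qed.

Let mull_cont (x : R) : continuous (fun t : R => x * t).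
Proof. by under eq_fun do rewrite mulrC; exact: mulr_cont. Qed.

Let ray_cont (x : R) : continuous (fun t : R => (t, t * x)).
Proof.
by move=> t; exact: (cvg_pair (@cvg_id _ (nbhs t)) (mulr_cont x t)).
Qed.

Let line_cont (t : R) : continuous (fun x : R => (t, t * x)).
Proof.
by move=> x; exact: (cvg_pair (cvg_cst t) (mull_cont t x)).
Qed.

Let comp_cont (f : R * R -> R) (g : R -> R * R) :
  continuous f -> continuous g -> continuous (fun x => f (g x)).
Proof. by move=> cf cg x; apply: continuous_comp; [exact: cg|exact: cf]. Qed.

Let m_cont_t (x : R) : continuous (m^~ x).
Proof.
move=> t; apply: cvgD; first exact: (comp_cont _ _ cphi (ray_cont x)).
apply: cvgM; first exact: cvg_id.
apply: cvgD; first exact: (comp_cont _ _ cdt (ray_cont x)).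
by apply: cvgM; [exact: cvg_cst|exact: (comp_cont _ _ cdx (ray_cont x))].
Qed.

Let line_measurable (f : R * R -> R) (t : R) : continuous f ->
  measurable_fun setT (fun x => f (t, t * x)).
Proof.
by move=> cf; apply: continuous_measurable_fun; exact: (comp_cont _ _ cf (line_cont t)).
Qed.

Let m_measurable (t : R) : measurable_fun setT (m t).
Proof.
apply: measurable_funD; first exact: line_measurable.
apply: measurable_funM => //; apply: measurable_funD; first exact: line_measurable.
by apply: measurable_funM => //; exact: line_measurable.
Qed.

Let Cm := N + (T + 2) * (N + B * N).
Let m_bound (t x : R) : 0 < t -> t < T + 2 -> `|x| <= B -> `|m t x| <= Cm.
Proof.
move=> t0 tT xB; have [h1 h2 h3] := phiN (t, t * x).
rewrite (le_trans (ler_normD _ _))// lerD// normrM (gtr0_norm t0).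
rewrite ler_pM ?(ltW t0) ?(ltW tT)// (le_trans (ler_normD _ _))// lerD//.
by rewrite normrM ler_pM.
Qed.

Let F (t x : R) := W x * (t * phi (t, t * x)).

Let F_is_derive (t x : R) : is_derive t (1 : R) (F^~ x) (W x * m t x).
Proof. exact: (is_deriveZ (W x) (is_derive_t t x)). Qed.

Let dFE (t x : R) : partial1of2 F t x = W x * m t x.
Proof. by rewrite partial1of2E; have [_] := F_is_derive t x. Qed.

(** An open interval of times around the segment from [e / 2] to [T + 1], so that derivatives and
    continuity are available up to the ends of that segment. *)
Let I : set R := `]0, T + 2[.

Let IE (t : R) : I t -> 0 < t < T + 2. Proof. by rewrite /I/= in_itv. Qed.

Let inB (x : R) : `[- B, B]%classic x -> `|x| <= B.
Proof. by rewrite /= in_itv/= ler_norml. Qed.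

Let intF (t : R) : I t -> mu.-integrable `[- B, B] (EFin \o F t).
Proof.
move=> /IE/andP[t0 tT].
apply: (@bounded_segment_integrable _ _ _ _ (M * ((T + 2) * N))) => [|x _].
  apply: measurable_funTS; apply: measurable_funM => //.
  by apply: measurable_funM; [exact: measurable_cst|exact: line_measurable].
rewrite normrM ler_pM// normrM (gtr0_norm t0) ler_pM ?(ltW t0) ?(ltW tT)//.
by have [] := phiN (t, t * x).
Qed.

Let intm (t : R) : I t -> mu.-integrable `[- B, B] (EFin \o (fun x => W x * m t x)).
Proof.
move=> /IE/andP[t0 tT].
apply: (@bounded_segment_integrable _ _ _ _ (M * Cm)) => [|x xB].
  by apply: measurable_funTS; apply: measurable_funM.
by rewrite normrM ler_pM// m_bound// ler_norml.
Qed.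

Let C0 : 0 <= M * Cm.
Proof.
apply: mulr_ge0 => //; rewrite /Cm addr_ge0 ?mulr_ge0 ?addr_ge0 ?(ltW T0)//.
by rewrite mulr_ge0// ltW.
Qed.

Let intC : mu.-integrable `[- B, B] (EFin \o cst (M * Cm)).
Proof. by apply: continuous_segment_integrable => x _; exact: cvg_cst. Qed.

Let J (t : R) := (\int[mu]_(x in `[- B, B]) F t x)%R.
Let dJ (t : R) := (\int[mu]_(x in `[- B, B]) (W x * m t x))%R.

Let WmC (t x : R) : I t -> `[- B, B]%classic x -> `|W x * m t x| <= M * Cm.
Proof. by move=> /IE/andP[t0 tT] /inB xB; rewrite normrM ler_pM// m_bound. Qed.

Let J_is_derive (t : R) : I t -> is_derive t (1 : R) J (dJ t).
Proof.
move=> It.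
have derF x y : I x -> `[- B, B]%classic y -> derivable (F^~ y) x 1.
  by move=> _ _; have [] := F_is_derive x y.
have G_ub x y : I x -> `[- B, B]%classic y ->
    `|partial1of2 F x y| <= cst (M * Cm) y.
  by rewrite dFE; exact: WmC.
have mB : measurable (`[- B, B]%classic : set (measurableTypeR R)).
  exact: measurable_itv.
apply: DeriveDef.
  exact: (derivable_under_integral mB It intF derF (fun=> C0) intC G_ub).
rewrite -derive1E.
rewrite (differentiation_under_integral mB It intF derF (fun=> C0) intC G_ub).
by apply: eq_Rintegral => x _; exact: dFE.
Qed.

Let dJ_cont (t : R) : I t -> {for t, continuous dJ}.
Proof.
move=> It; have mB : measurable (`[- B, B]%classic : set (measurableTypeR R)).
  exact: measurable_itv.
have cf : {ae mu, forall y, `[- B, B]%classic y ->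
    {in I, continuous (fun t => W y * m t y)}}.
  apply/aeW => y _ s _; apply: cvgM; first exact: cvg_cst.
  exact: m_cont_t.
have ub x : I x -> {ae mu, forall y, `[- B, B]%classic y ->
    `|W y * m x y| <= cst (M * Cm) y}.
  by move=> Ix; apply/aeW => y; exact: WmC.
have := @continuity_under_integral R _ _ mu (fun t x => W x * m t x) _ mB 0 (T + 2)
  intm cf _ intC ub.
by apply; rewrite inE.
Qed.

(** After the substitution of [t * x] for [x], the integrand differs from [W x * m t x] by
    [(G x - x * W x) * eta' - W x * eta], where [eta x = phi (t, t * x)]. This difference integrates
    to zero by [weak_ode]. *)
Let slice_integral (t : R) : I t ->
  (\int[mu]_x (W (x / t) * d_t phi (t, x) + G (x / t) * d_x phi (t, x))%:E =
   (dJ t)%:E)%E.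
Proof.
move=> It; have /andP[t0 tT] := IE _ It.
pose h x := W (x / t) * d_t phi (t, x) + G (x / t) * d_x phi (t, x).
pose k x := W x * (t * d_t phi (t, t * x)) + G x * (t * d_x phi (t, t * x)).
have hk x : t * h (t * x) = k x.
  have tx : t * x / t = x by field; rewrite gt_eqF.
  by rewrite /h /k tx; ring.
have mk : measurable_fun setT k.
  apply: measurable_funD; apply: measurable_funM => //;
  by apply: measurable_funM; [exact: measurable_cst|exact: line_measurable].
have mh : measurable_fun setT h.
  have -> : h = (fun x => t^-1 * k (x / t)).
    apply/funext => x; rewrite -hk mulKf ?gt_eqF//.
    by congr h; field; rewrite gt_eqF.
  apply: measurable_funM; first exact: measurable_cst.
  apply: measurableT_comp => //.
  by apply: measurable_funM; [|exact: measurable_cst].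
rewrite (integral_scale t t0) -/h; last exact/measurable_EFinP.
under eq_integral do rewrite -EFinM hk.
have kout x : ~ (`|x| <= B) -> k x = 0.
  move=> /negP; rewrite -ltNge => /ltW /(outB _ _ t0)[_ h1 h2].
  by rewrite /k h1 h2 !mulr0 addr0.
have -> : (\int[mu]_x (k x)%:E = \int[mu]_(x in `[(- B)%R, B]) (k x)%:E)%E.
  rewrite [RHS]integral_mkcond; apply: eq_integral => x _.
  rewrite patchE; case: ifPn => // /negP xB; rewrite kout// => xB'.
  by apply: xB; rewrite inE/= in_itv/= -ler_norml.
have eta_is x : is_derive x (1 : R) (fun y : R => phi (t, t * y))
    (t * d_x phi (t, t * x)).
  have lineE y : (t, t * y) = (t, 0) + y *: (0 : R, t) :> R * R.
    by congr (_, _); rewrite /= /GRing.scale/= ?mulr0 ?addr0 ?add0r// mulrC.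
  have := is_derive_line phi phi_test (t, 0) (0, t) x.
  rewrite -lineE/= mul0r add0r; congr (is_derive _ _ _ _).
  by apply/funext => y; rewrite -lineE.
have deta_cont : continuous (fun x => t * d_x phi (t, t * x)).
  move=> x; apply: cvgM; first exact: cvg_cst.
  exact: (comp_cont _ _ cdx (line_cont t)).
have etaN x : `|phi (t, t * x)| <= N + t * N.
  by have [h1 _ _] := phiN (t, t * x); rewrite (le_trans h1)// lerDl mulr_ge0// ltW.
have detaN x : `|t * d_x phi (t, t * x)| <= N + t * N.
  have [_ _ h1] := phiN (t, t * x).
  rewrite normrM (gtr0_norm t0) (@le_trans _ _ (t * N))// ?lerDr//.
  by rewrite ler_wpM2l// ltW.
pose f x := k x - W x * m t x.
have ode (w g : R -> R) (a b : R) : monotone_fun w -> (forall x, `|w x| <= M) ->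
    speed_bounded w g -> a <= b -> phi (t, t * a) = 0 -> phi (t, t * b) = 0 ->
    (forall x, a <= x <= b -> x != 0 -> W x = w x /\ G x = g x) ->
    (\int[mu]_(x in `[a, b]) f x)%R = 0.
  move=> wm wM wg ab ea eb Ww.
  have := weak_ode w g M wm wM wg (fun y => phi (t, t * y)) _ a b (N + t * N)
    ab eta_is deta_cont (fun x _ => etaN x) (fun x _ => detaN x).
  rewrite ea eb !mulr0 subrr => E; rewrite -[RHS]E; apply: eq_Rintegral => x.
  rewrite inE/= in_itv/= => xab; rewrite /f /k /m.
  have [->|x0] := eqVneq x 0.
    have [h1 h2 h3] := test_axis phi phi_test t.
    by rewrite mulr0 h1 h2 h3 !(mulr0, mul0r, addr0).
  by have [-> ->] := Ww x xab x0; ring.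
have nB0 : - B <= 0 by rewrite oppr_le0 ltW.
have eB : phi (t, t * B) = 0 by have [] := outB t B t0 (ler_norm B).
have eNB : phi (t, t * - B) = 0.
  by have [] := outB t (- B) t0; rewrite // normrN ler_norm.
have e0 : phi (t, t * 0) = 0 by rewrite mulr0; have [] := test_axis phi phi_test t.
have intk : mu.-integrable `[- B, B] (EFin \o k).
  pose CG := `|Gm 0| + `|Gp 0| + 4 * M * B.
  apply: (@bounded_segment_integrable _ _ _ _ (M * (t * N) + CG * (t * N))) => [|x].
    exact: measurable_funTS.
  rewrite -ler_norml => xB; have [_ h1 h2] := phiN (t, t * x).
  rewrite (le_trans (ler_normD _ _))// lerD// normrM ler_pM// ?GB//.
    by rewrite normrM (gtr0_norm t0) ler_wpM2l// ltW.
  by rewrite normrM (gtr0_norm t0) ler_wpM2l// ltW.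
have intf : mu.-integrable `[- B, B] (EFin \o f).
  exact: (integrableB _ intk (intm _ It)).
have f0 : (\int[mu]_(x in `[- B, B]) f x)%R = 0.
  (* Each side uses its own wave. The boundary terms vanish at [- B] and [B] because these lie
     outside the support, and at 0 because the support avoids the junction. *)
  rewrite (@Rintegral_split _ _ _ 0)// ?(ltW B0)//.
  rewrite (ode Wm Gm)// ?(ode Wp Gp)// ?addr0 ?(ltW B0)//.
  - by move=> x /andP[x0 _] _; rewrite /W /G /sides ltNge x0.
  - by move=> x /andP[_ x0] xn0; rewrite /W /G /sides lt_neqAle xn0 x0.
rewrite -(fineK (integrable_fin_num _ intk))//; congr _%:E.
transitivity (\int[mu]_(x in `[- B, B]) (f x + W x * m t x))%R.
  by apply: eq_Rintegral => x _; rewrite /f subrK.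
by rewrite RintegralD ?f0 ?add0r//; exact: intm.
Qed.

Let slice_out (t : R) : ~ (e / 2 <= t <= T + 1) -> forall x,
  d_t phi (t, x) = 0 /\ d_x phi (t, x) = 0.
Proof.
move=> nt x; have [] // := phi_out (t, x).
move=> /= [/andP[et tT] _]; apply: nt; apply/andP; split.
  by apply: le_trans et; rewrite ler_pdivrMr// ler_peMr ?ler1n// ltW.
by apply: le_trans tT _; rewrite lerDl.
Qed.

Let J_out (t : R) : t < e \/ T < t -> J t = 0.
Proof.
move=> ht; rewrite /J (@eq_Rintegral _ _ _ _ _ (fun=> 0)) ?Rintegral_cst ?mul0r//.
move=> x _; rewrite /F; have [] := phi_out (t, t * x).
  by move=> /= [/andP[et tT] _]; case: ht; rewrite ltNge ?et ?tT.
by move=> -> _ _; rewrite !mulr0.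
Qed.

Lemma weak_selfsimilar_aux (U V : R -> R -> R) :
    (forall t x, 0 < t -> x != 0 -> U t x = W (x / t) /\ V t x = G (x / t)) ->
  (\int[mu]_(t in `[0%R, +oo[) \int[mu]_x
     (U t x * d_t phi (t, x) + V t x * d_x phi (t, x))%:E = 0)%E.
Proof.
move=> UV.
pose H t := (\int[mu]_x
     (U t x * d_t phi (t, x) + V t x * d_x phi (t, x))%:E)%E.
have e2 : 0 < e / 2 by rewrite divr_gt0.
have e2e : e / 2 < e by rewrite ltr_pdivrMr// ltr_pMr// ltr1n.
have eT1 : e / 2 < T + 1 by rewrite (lt_trans (lt_trans e2e eT))// ltrDl.
have inI t : e / 2 <= t <= T + 1 -> I t.
  move=> /andP[et tT]; rewrite /I/= in_itv/= (lt_le_trans e2 et)/=.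
  by rewrite (le_lt_trans tT)// ltrD2l ltr1n.
have HE t : e / 2 <= t <= T + 1 -> H t = (dJ t)%:E.
  move=> et; have It := inI _ et; have /andP[t0 _] := IE _ It.
  rewrite -slice_integral//; apply: eq_integral => x _; congr _%:E.
  have [->|x0] := eqVneq x 0; last by have [-> ->] := UV _ _ t0 x0.
  by have [_ -> ->] := test_axis phi phi_test t; rewrite !mulr0.
have H0 t : ~ (e / 2 <= t <= T + 1) -> H t = 0%E.
  move=> nt; rewrite /H integral0_eq// => x _.
  by have [-> ->] := slice_out _ nt x; rewrite !mulr0 addr0.
(* The segment is slightly larger than [[e, T]], so that [J] vanishes at both of its ends and the
   integral of [dJ] is 0. *)
transitivity (\int[mu]_(t in `[(e / 2)%R, (T + 1)%R]) (dJ t)%:E)%E.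
  rewrite integral_mkcond [RHS]integral_mkcond; apply: eq_integral => t _.
  rewrite !patchE -/(H t); have [et|/negP net] := boolP (e / 2 <= t <= T + 1).
    rewrite (mem_set (A := `[e / 2, T + 1]%classic)) ?/= ?in_itv//= HE//.
    rewrite mem_set//= in_itv/= andbT; case/andP: et => et _.
    by rewrite (le_trans _ et)// ltW.
  rewrite H0// (memNset (A := `[e / 2, T + 1]%classic)) ?/= ?in_itv//=.
  by case: ifP.
rewrite (@continuous_FTC2 _ dJ J)//.
- rewrite J_out; last by right; rewrite ltrDl.
  by rewrite J_out ?subee//; left.
- by apply: continuous_within_itvcc => t et; apply: dJ_cont; exact: inI.
- have cJ t : e / 2 <= t <= T + 1 -> {for t, continuous J}.
    move=> /inI It; apply: derivable1_continuous.
    by have [] := J_is_derive _ It.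
  split.
  + move=> t; rewrite ?inE/= ?in_itv/= => /andP[et tT].
    by have [|] := J_is_derive t _; first by apply: inI; rewrite !ltW.
  + by apply: cvg_at_right_filter; apply: cJ; rewrite lexx ltW.
  + by apply: cvg_at_left_filter; apply: cJ; rewrite lexx ltW.
- move=> t; rewrite ?inE/= ?in_itv/= => /andP[et tT].
  have It : I t by apply: inI; rewrite !ltW.
  by have [_ E] := J_is_derive _ It; rewrite derive1E.
Qed.

End selfsimilar.

Lemma weak_selfsimilar {R : realType} (Wm Gm Wp Gp : R -> R) (M : R)
    (phi : R * R -> R) (U V : R -> R -> R) :
    monotone_fun Wm -> monotone_fun Wp ->
    (forall x, `|Wm x| <= M) -> (forall x, `|Wp x| <= M) ->
    speed_bounded Wm Gm -> speed_bounded Wp Gp ->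
    test_function phi ->
    (forall t x, 0 < t -> x != 0 ->
      U t x = sides Wm Wp (x / t) /\ V t x = sides Gm Gp (x / t)) ->
  (\int[@lebesgue_measure R]_(t in `[0%R, +oo[) \int[@lebesgue_measure R]_x
     (U t x * d_t phi (t, x) + V t x * d_x phi (t, x))%:E = 0)%E.
Proof.
move=> ? ? ? ? ? ? phi_test UV.
have [e [T [e0 eT out]]] := test_bounds phi phi_test.
have [N phiN] := test_bounded phi phi_test.
exact: (@weak_selfsimilar_aux R Wm Gm Wp Gp M _ _ _ _ _ _ phi phi_test e T N).
Qed.

(** * Continuity in time and bounded variation *)

Section C0_L1loc_criterion.
Context {R : realType}.
Local Notation mu := (@lebesgue_measure R).
Variables (f : R -> R -> R) (M : R).
Hypothesis mf : forall t, 0 <= t -> measurable_fun setT (f t).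
Hypothesis fM : forall t x, 0 <= t -> `|f t x| <= M.
Hypothesis cf : forall t : R, 0 <= t -> {ae mu, forall x,
  f s x @[s --> within [set s : R | 0 <= s] (nbhs t)] --> f t x}.

Let compact_integrable (g : R -> R) (K : set R) (C : R) : compact K ->
  measurable_fun K g -> (forall x, `|g x| <= C) -> mu.-integrable K (EFin \o g).
Proof.
move=> cK mg gC; apply: measurable_bounded_integrable => //.
- exact: compact_measurable.
- exact: compact_finite_measure.
- exists C; split; first exact: num_real.
  by move=> D CD x _ /=; rewrite (le_trans (gC x))// ltW.
Qed.

(** Dominated convergence on the compact set, with the constant [M] as dominating function. *)
Lemma C0_L1loc_bounded : C0_L1loc f.
Proof.
split=> [t t0|t K t0 cK].
  split; [exact: mf|exact: openT|move=> K _ cK].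
  have : mu.-integrable K (EFin \o f t).
    apply: (compact_integrable _ _ M) => //; last by move=> x; exact: fM.
    exact: measurable_funTS (mf _ t0).
  by move=> /integrableP[].
have mK : measurable K := compact_measurable cK.
have mft s : 0 <= s -> measurable_fun K (f s) by move=> /mf; exact: measurable_funTS.
(* Replacing [s] by its positive part extends the function to all real times, so that continuity at
   [t] can be tested on sequences. *)
pose G s := (\int[mu]_(x in K) `|f (Num.max s 0) x - f t x|%:E)%E.
have max0 s : 0 <= Num.max s 0 :> R by rewrite le_max lexx orbT.
have d2M s x : 0 <= s -> `|f s x - f t x| <= 2 * M.
  move=> s0; rewrite (le_trans (ler_normB _ _))//.
  have := fM s x s0; have := fM t x t0; lra.
have Gfin s : G s \is a fin_num.
  apply: integrable_fin_num => //.
  apply: (compact_integrable (fun x => `|f (Num.max s 0) x - f t x|) _ (2 * M)) => //.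
    by apply: measurableT_comp => //; apply: measurable_funB; exact: mft.
  by move=> x; rewrite normr_id d2M.
have Gt : fine (G t) = 0.
  rewrite /G; under eq_integral do rewrite max_l// subrr normr0.
  by rewrite integral0.
have cG : (fun s => fine (G s)) @ t --> fine (G t).
  apply/(@cvg_nbhsP _ R^o) => s_ s_t; rewrite Gt.
  have s_D x : f s x @[s --> within [set s : R | 0 <= s] (nbhs t)] --> f t x ->
      f (Num.max (s_ n) 0) x @[n --> \oo] --> f t x.
    have cm : {for t, continuous (fun s : R => Num.max s 0)}.
      apply: continuous_max; first by exact: cvg_id.
      by exact: cvg_cst.
    have cmax : Num.max (s_ n) 0 @[n --> \oo] --> Num.max t 0.
      exact: (cvg_comp _ _ s_t cm).
    rewrite max_l// in cmax.
    have cD : Num.max (s_ n) 0 @[n --> \oo] -->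
        within [set s : R | 0 <= s] (nbhs t).
      move=> P; rewrite /within/= => /cmax.
      apply: (@filterS _ \oo _
        (fun n => 0 <= Num.max (s_ n) 0 -> P (Num.max (s_ n) 0))) => n.
      by move=> h; exact: (h (max0 _)).
    by move=> cx; exact: (cvg_comp _ (f^~ x) cD cx).
  have fae : {ae mu, forall x, K x ->
      (fun n => (f (Num.max (s_ n) 0) x)%:E) @ \oo --> (f t x)%:E}.
    have := cf t t0; apply: filterS; first exact: (ae_filter_ringOfSetsType mu).
    move=> x cx _; apply: cvg_EFin; first exact: nearW.
    exact: s_D.
  have intM : mu.-integrable K (cst M%:E).
    apply: (compact_integrable (cst M) K `|M| cK).
      exact: measurable_cst.
    by [].
  have fdom : {ae mu, forall x n, K x ->
      (`|(f (Num.max (s_ n) 0) x)%:E| <= cst M%:E x)%E}.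
    by apply/aeW => x n _; rewrite /= lee_fin fM.
  have mfs n : measurable_fun K (fun x => (f (Num.max (s_ n) 0) x)%:E).
    by apply/measurable_EFinP; exact: mft.
  have mft' : measurable_fun K (fun x => (f t x)%:E).
    by apply/measurable_EFinP; exact: mft.
  have [_ + _] := @dominated_convergence _ _ _ mu K mK _ _ _ mfs mft' fae intM fdom.
  move=> h; apply: fine_cvg; apply: cvg_trans h; apply: near_eq_cvg.
  by apply: nearW => n; apply: eq_integral => x _; rewrite -EFinB.
have : (fine (G s))%:E @[s --> within [set s : R | 0 <= s] (nbhs t)] --> 0%E.
  apply: cvg_EFin; first exact: nearW.
  by rewrite Gt in cG; apply: cvg_trans cG; apply: cvg_app; exact: cvg_within.
apply: cvg_trans; apply: near_eq_cvg; rewrite near_withinE; apply: nearW => s s0.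
by rewrite fineK// /G max_l.
Qed.

End C0_L1loc_criterion.

Lemma total_variation_monotone {R : realType} (f : R -> R) (a b M : R) :
  monotone_fun f -> (forall x, `|f x| <= M) -> a <= b ->
  (total_variation a b f <= (2 * M)%:E)%E.
Proof.
move=> fm fM ab.
have fab : `|f b - f a| <= 2 * M.
  rewrite (le_trans (ler_normB _ _))//; have := fM a; have := fM b; lra.
case: fm => [fnd|fni].
  rewrite nondecreasing_total_variation//; last by move=> x y _ _; exact: fnd.
  by rewrite lee_fin (le_trans (ler_norm _)).
rewrite -total_variationN nondecreasing_total_variation//; last first.
  by move=> x y _ _ xy; rewrite lerN2; exact: fni.
by rewrite lee_fin /= opprK addrC (le_trans _ fab)// distrC ler_norm.
Qed.

(** A sum of three bounded monotone functions: [f] continued by a constant [c] to the right, [g] by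
    a constant [d] to the left, and a step that cancels [c] and [d]. The constants are [M] or [- M],
    the sign chosen so that the continuation stays monotone. *)
Lemma BV_class_sides {R : realType} (f g : R -> R) (M : R) :
  monotone_fun f -> monotone_fun g ->
  (forall x, `|f x| <= M) -> (forall x, `|g x| <= M) -> BV_class (sides f g).
Proof.
move=> fm gm fM gM; have M0 : 0 <= M := le_trans (normr_ge0 _) (fM 0).
have lM (h : R -> R) x : (forall x, `|h x| <= M) -> - M <= h x <= M.
  by move=> hM; rewrite -ler_norml.
have [c [cM hm]] : exists c : R, `|c| <= M /\ monotone_fun (sides f (fun=> c)).
  case: fm => [fnd|fni].
    exists M; rewrite ger0_norm//; split=> //; left => x y xy; rewrite /sides.
    case: ifP => x0; case: ifP => y0 //; first exact: fnd.
      by have /andP[] := lM f x fM.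
    by move: x0; rewrite (le_lt_trans xy y0).
  exists (- M); rewrite normrN ger0_norm//; split=> //; right => x y xy; rewrite /sides.
  case: ifP => y0; case: ifP => x0 //; first exact: fni.
    by move: x0; rewrite (le_lt_trans xy y0).
  by have /andP[] := lM f x fM.
have [d [dM km]] : exists d : R, `|d| <= M /\ monotone_fun (sides (fun=> d) g).
  case: gm => [gnd|gni].
    exists (- M); rewrite normrN ger0_norm//; split=> //; left => x y xy; rewrite /sides.
    case: ifP => x0; case: ifP => y0 //; last exact: gnd.
      by have /andP[] := lM g y gM.
    by move: x0; rewrite (le_lt_trans xy y0).
  exists M; rewrite ger0_norm//; split=> //; right => x y xy; rewrite /sides.
  case: ifP => y0; case: ifP => x0 //; last exact: gni.
    by move: x0; rewrite (le_lt_trans xy y0).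
  by have /andP[] := lM g y gM.
have sm : monotone_fun (sides (fun=> - d) (fun=> - c)).
  have [dc|cd] := leP (- d) (- c); [left|right] => x y xy; rewrite /sides;
    case: ifP => y0; case: ifP => x0 //; try (by move: x0; rewrite (le_lt_trans xy y0));
    try (by move: y0; rewrite (le_lt_trans xy x0)); exact: ltW.
exists (sides f g); first exact/aeW.
exists (2 * M + (2 * M + 2 * M)) => a b ab.
have -> : sides f g =
    (sides f (fun=> c) \+ (sides (fun=> d) g \+ sides (fun=> - d) (fun=> - c))).
  by apply/funext => x; rewrite /sides/=; case: ifP => _; ring.
rewrite (le_trans (total_variation_le _ _ ab))// EFinD leeD//.
  apply: total_variation_monotone => // x.
  by rewrite /sides; case: ifP.
rewrite (le_trans (total_variation_le _ _ ab))// EFinD leeD//.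
  apply: total_variation_monotone => // x.
  by rewrite /sides; case: ifP.
apply: total_variation_monotone => // x.
by rewrite /sides; case: ifP => _; rewrite normrN.
Qed.

(** * Centered waves of the first family *)

Lemma intermediate_speed_bounded {R : realType} (W G : R -> R) :
  (forall x y, x <= y -> exists2 s, x <= s <= y & G y - G x = s * (W y - W x)) ->
  speed_bounded W G.
Proof.
move=> WG x y; have [xy|yx] := leP x y.
  have [s /andP[xs sy] ->] := WG x y xy.
  rewrite -mulrBl normrM ler_wpM2r//.
  by rewrite (ger0_norm (_ : 0 <= y - x)) ?subr_ge0// ler0_norm ?subr_le0//; lra.
have [s /andP[ys sx] E] := WG y x (ltW yx).
have -> : G y - G x - y * (W y - W x) = (s - y) * (W y - W x).
  by rewrite -(opprB (G x)) E; ring.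
rewrite normrM ler_wpM2r// ger0_norm ?subr_ge0// ler0_norm ?subr_le0; lra.
Qed.

Section clamp.
Context {R : realType} (lo hi : R).
Hypothesis lohi : lo <= hi.

Definition clamp (x : R) := Num.max lo (Num.min x hi).

Lemma clamp_bounds (x : R) : lo <= clamp x <= hi.
Proof. by rewrite /clamp le_max lexx ge_max lohi ge_min lexx orbT. Qed.

Lemma clamp_left (x : R) : x <= lo -> clamp x = lo.
Proof. by move=> xlo; rewrite /clamp max_l// ge_min xlo. Qed.

Lemma clamp_right (x : R) : hi <= x -> clamp x = hi.
Proof. by move=> xhi; rewrite /clamp min_r// max_r. Qed.

Lemma clamp_id (x : R) : lo <= x <= hi -> clamp x = x.
Proof. by move=> /andP[lox xhi]; rewrite /clamp min_l// max_r. Qed.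

Lemma clamp_le (x y : R) : x <= y -> clamp x <= clamp y.
Proof.
move=> xy; rewrite /clamp !maxEle !minEle.
by case: (leP x hi) => xhi; case: (leP y hi) => yhi; case: (leP lo x) => lox;
  case: (leP lo y) => loy; case: (leP lo hi) => lh; lra.
Qed.

(** A clamped value below another one can only have been raised, and the larger one only lowered.
    For a rarefaction this places the characteristic speeds of two distinct states between the
    speeds at which they are taken. *)
Lemma clamp_lt (x y : R) : clamp x < clamp y -> x <= clamp x /\ clamp y <= y.
Proof.
rewrite /clamp !maxEle !minEle.
by case: (leP x hi) => xhi; case: (leP y hi) => yhi; case: (leP lo x) => lox;
  case: (leP lo y) => loy; case: (leP lo hi) => lh h; split; lra.
Qed.

Lemma clamp_lipschitz (x y : R) : `|clamp x - clamp y| <= `|x - y|.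
Proof.
wlog xy : x y / x <= y.
  by move=> H; have [/H//|/ltW/H] := leP x y; rewrite distrC (distrC y).
rewrite distrC (distrC x) !ger0_norm ?subr_ge0 ?clamp_le//.
have := clamp_le _ _ xy; rewrite le_eqVlt => /predU1P[->|/clamp_lt[]].
  by rewrite subrr subr_ge0.
by move=> h1 h2; rewrite lerB.
Qed.

End clamp.

Section wave1.
Context {R : realType} (p : R -> R).
Hypothesis pP : pressure p.
Hypothesis p_sonic : sonic_densities_determined p.
Variable u : R * R.
Hypothesis uA0 : A0 p u.

Let u1_gt0 : 0 < u.1. Proof. by case: uA0. Qed.
Let lam_u : lambda1 p u < 0. Proof. by case: uA0 => _ /andP[]. Qed.

Let Q (x : R) := L1 p x u.
Let P (x : R) := flowP p (x, L1 p x u).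
Let lam (x : R) := lambda1 p (x, L1 p x u).
Let a := phi_hat_l p u.
Let b := phi_check_l p u.

Let a0 : 0 < a. Proof. by have [] := phi_hat_lP p p_sonic u uA0. Qed.

Let Qu : Q u.1 = u.2. Proof. exact: L1_self. Qed.
Let uE : (u.1, Q u.1) = u. Proof. by rewrite Qu; case: (u). Qed.

Lemma L1_decr (x y : R) : a <= x -> x < y -> Q y < Q x.
Proof.
move=> ax xy; have x0 := lt_le_trans a0 ax.
have lx : lam x <= 0 by rewrite /lam lambda1_hat.
by have [] := L1_flowP_mono p pP u u1_gt0 lam_u x y x0 lx xy.
Qed.

Lemma flowP_incr (x y : R) : a <= x -> x < y -> P x < P y.
Proof.
move=> ax xy; have x0 := lt_le_trans a0 ax.
have lx : lam x <= 0 by rewrite /lam lambda1_hat.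
by have [] := L1_flowP_mono p pP u u1_gt0 lam_u x y x0 lx xy.
Qed.

(* The properties of a centered wave of the first family, defined for all speeds,
   that make it a subsonic self-similar weak solution on [x < 0] with trace [um]
   at [x = 0]. *)
Definition wave_profile (um : R * R) (w : R -> R * R) : Prop :=
  [/\ lax_wave1 p u um w,
      forall xi, a <= (w xi).1 <= b /\ (w xi).2 = Q (w xi).1,
      monotone_fun (fun xi => (w xi).1) /\ monotone_fun (fun xi => (w xi).2),
      speed_bounded (fun xi => (w xi).1) (fun xi => (w xi).2) /\
      speed_bounded (fun xi => (w xi).2) (fun xi => flowP p (w xi)) &
      [/\ exists2 s, s < 0 & forall xi, xi != s -> {for xi, continuous w},
          w 0 = um & exists B, forall xi, xi <= - B -> w xi = u]].

Section shock.
Variable r : R.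
Hypothesis ur : u.1 < r.
Hypothesis rb : r <= b.

Let s := shock_speed p u r.
Let s0 : s < 0. Proof. exact: shock_speed_lt0. Qed.
Let um := (r, Q r).
Let w (xi : R) := if xi < s then u else um.

Let dq : Q r - u.2 = s * (r - u.1).
Proof. by rewrite /Q L1E ?(ltW ur)// addrAC subrr add0r. Qed.

(** Between two speeds that enclose the shock, [s] itself is the intermediate speed; otherwise
    nothing jumps. The two uses are the two Rankine-Hugoniot relations. *)
Let speed (f g : R * R -> R) : g um - g u = s * (f um - f u) ->
  speed_bounded (f \o w) (g \o w).
Proof.
move=> fg; apply: intermediate_speed_bounded => x y xy; rewrite /= /w.
case: ifPn => ys; case: ifPn => xs.
- by exists x; rewrite ?lexx ?xy// !subrr mulr0.
- by move: xs; rewrite (le_lt_trans xy ys).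
- by exists s; rewrite // (ltW xs) leNgt.
- by exists x; rewrite ?lexx ?xy// !subrr mulr0.
Qed.

Let mono (f : R * R -> R) : monotone_fun (f \o w).
Proof.
have [h|h] := leP (f u) (f um); [left|right] => x y xy; rewrite /= /w.
  case: ifPn => xs; case: ifPn => ys //.
  by move: xs; rewrite (le_lt_trans xy ys).
case: ifPn => ys; case: ifPn => xs //; last exact: ltW.
by move: xs; rewrite (le_lt_trans xy ys).
Qed.

Lemma shock_profile : exists w, wave_profile um w.
Proof.
have b0 : a <= u.1 <= b.
  by rewrite ltW ?phi_hat_l_lt//= ltW ?phi_check_l_gt.
exists w; split.
- split => //=; first exact: lt_trans ur.
  rewrite leNgt ur /= /shock_wave /= => xi.
  have -> : (Q r - u.2) / (r - u.1) = s.
    by rewrite dq mulfK// subr_eq0 gt_eqF.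
  by split => h; rewrite /w ?h// ltNge ltW.
- move=> xi; rewrite /w; case: ifP => _ /=; first by rewrite Qu.
  by split=> //; rewrite rb andbT (le_trans _ (ltW ur))//; case/andP: b0.
- by split; exact: mono.
- split; first exact: (speed fst snd).
  apply: (speed snd (flowP p)); rewrite /um /Q flowP_shock//.
  by rewrite addrAC subrr add0r.
- split.
  + exists s => // xi; rewrite neq_lt => /orP[xs|sx].
      apply: (@near_cst_continuous _ _ u); near=> z; rewrite /w ifT//.
      by near: z; exact: near_lt.
    apply: (@near_cst_continuous _ _ um); near=> z; rewrite /w ifF//.
    by apply/negbTE; rewrite -leNgt ltW//; near: z; exact: near_gt.
  + by rewrite /w ltNge (ltW s0).
  + by exists (1 - s) => xi xis; rewrite /w ifT//; lra.
Unshelve. all: by end_near. Qed.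

End shock.

Section rarefaction.
Variable r : R.
Hypothesis ar : a <= r.
Hypothesis ru : r <= u.1.

Let r0 : 0 < r. Proof. exact: lt_le_trans ar. Qed.

Let lam_strict (x y : R) : 0 < x -> x < y -> lam y < lam x.
Proof. exact: lambda1_L1_decr. Qed.

Let lo := lambda1 p u.
Let hi := lam r.

Let loE : lam u.1 = lo. Proof. by rewrite /lam -/(Q _) uE. Qed.

Let lohi : lo <= hi.
Proof. by rewrite -loE; exact: lambda1_decr_le. Qed.

Let hi0 : hi <= 0. Proof. by rewrite /hi /lam lambda1_hat. Qed.

(** The fan is obtained by solving for the density at which [lam] equals the given speed. Clamping
    the speed to the range of the fan covers the constant states on both sides as well. *)
Let inverse (xi : R) : exists x, r <= x <= u.1 /\ lam x = clamp lo hi xi.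
Proof.
have /andP[c1 c2] := clamp_bounds lo hi lohi xi.
have [||x + xE] := @IVT R lam r u.1 (clamp lo hi xi) ru.
- apply: continuous_within_itvcc => x /andP[rx _].
  by apply: lambda1_L1_continuous => //; exact: lt_le_trans rx.
- by rewrite loE -/hi (min_idPr lohi) (max_idPl lohi) c1.
- by rewrite in_itv/=; exists x.
Qed.

Let dens (xi : R) : R := projT1 (cid (inverse xi)).

Let dens_bounds (xi : R) : r <= dens xi <= u.1.
Proof. by rewrite /dens; case: cid => x []. Qed.

Let lam_dens (xi : R) : lam (dens xi) = clamp lo hi xi.
Proof. by rewrite /dens; case: cid => x []. Qed.

Let dens_gt0 (xi : R) : 0 < dens xi.
Proof. by have /andP[+ _] := dens_bounds xi; exact: lt_le_trans. Qed.

Let dens_uniq (xi x : R) : 0 < x -> lam x = clamp lo hi xi -> dens xi = x.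
Proof.
move=> x0; rewrite -lam_dens => e.
have [h|h|//] := ltgtP (dens xi) x.
  by have := lam_strict _ _ (dens_gt0 xi) h; rewrite e ltxx.
by have := lam_strict _ _ x0 h; rewrite e ltxx.
Qed.

Let dens_ni (x y : R) : x <= y -> dens y <= dens x.
Proof.
move=> xy; rewrite leNgt; apply/negP => /(lam_strict _ _ (dens_gt0 x)).
by rewrite !lam_dens ltNge clamp_le.
Qed.

Let dens_lam (x y : R) : dens y < dens x ->
  x <= lam (dens x) /\ lam (dens y) <= y.
Proof.
move=> /(lam_strict _ _ (dens_gt0 y)); rewrite !lam_dens.
exact: clamp_lt.
Qed.

(** The velocity part of [lam] has slope - c / rho, of size at least [sound p r / u.1] on the fan,
    and minus the sound speed only adds to the decrease. A speed that falls at a uniform rate has a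
    Lipschitz inverse, whence the continuity of [dens]. *)
Let lam_lip (x y : R) : r <= x -> x <= y -> y <= u.1 ->
  sound p r / u.1 * (y - x) <= lam x - lam y.
Proof.
move=> rx; rewrite le_eqVlt => /predU1P[->|xy yu]; first by rewrite !subrr mulr0.
have x0 := lt_le_trans r0 rx; have d0 : 0 < x / 2 by rewrite divr_gt0.
have dx : x / 2 < x by rewrite ltr_pdivrMr// ltr_pMr// ltr1n.
have xu := le_trans (ltW xy) yu.
rewrite /lam (lambda1_rar p pP u (x / 2) x)// ?(ltW dx)//.
rewrite (lambda1_rar p pP u (x / 2) y)// ?(ltW (lt_trans dx xy))//.
have [|c /andP[xc cy] cE] := @MVT_closed R
    (fun y => oint (fun r => sound p r / r) (x / 2) y)
    (fun r => sound p r / r) x y xy _.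
  move=> z /andP[xz _]; apply: (kappa_int_is_derive p pP) => //.
  exact: lt_le_trans xz.
have c0 := lt_trans x0 xc.
have h1 : sound p r / u.1 * (y - x) <= sound p c / c * (y - x).
  rewrite ler_wpM2r ?subr_ge0 ?(ltW xy)// ler_pM ?invr_ge0 ?(ltW u1_gt0)//.
  - by rewrite ltW// sound_gt0.
  - by apply: sound_nd => //; exact: le_trans rx (ltW xc).
  - by rewrite lef_pV2// ltW// (lt_le_trans cy).
have := sound_nd p pP _ _ x0 (ltW xy).
rewrite /rar_speed; lra.
Qed.

Let k := sound p r / u.1.
Let k0 : 0 < k. Proof. by rewrite divr_gt0// sound_gt0. Qed.

Let dens_lip (x y : R) : `|dens x - dens y| <= `|x - y| / k.
Proof.
wlog xy : x y / x <= y.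
  by move=> H; have [/H//|/ltW/H] := leP x y; rewrite distrC (distrC y).
rewrite ler_pdivlMr// ger0_norm ?subr_ge0 ?dens_ni// mulrC.
have /andP[rx _] := dens_bounds y; have /andP[_ yu] := dens_bounds x.
apply: le_trans (lam_lip _ _ rx (dens_ni _ _ xy) yu) _.
rewrite !lam_dens (le_trans (ler_norm _))// (distrC x).
exact: clamp_lipschitz.
Qed.

Let dens_cont : continuous dens.
Proof.
move=> x; apply/cvgrPdist_le => e e0; near=> y.
apply: le_trans (dens_lip _ _) _; rewrite ler_pdivrMr//; near: y.
apply: (@cvgr_dist_le _ _ _ (nbhs x) _ id x); first exact: cvg_id.
exact: mulr_gt0.
Unshelve. all: by end_near. Qed.

Let w (xi : R) := (dens xi, Q (dens xi)).

Let w_cont : continuous w.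
Proof.
move=> x; have cQ : {for x, continuous (Q \o dens)}.
  apply: continuous_comp; first exact: dens_cont.
  by apply: L1_continuous => //; exact: dens_gt0.
exact: (cvg_pair (dens_cont x) cQ).
Qed.

Let w_left (xi : R) : xi <= lo -> w xi = u.
Proof.
move=> h; rewrite /w (dens_uniq xi u.1) ?uE// loE.
by rewrite clamp_left.
Qed.

Let w_right (xi : R) : hi <= xi -> w xi = (r, Q r).
Proof. by move=> h; rewrite /w (dens_uniq xi r)// clamp_right. Qed.

Lemma rarefaction_profile : exists w, wave_profile (r, Q r) w.
Proof.
have ad xi : a <= dens xi by rewrite (le_trans ar)//; case/andP: (dens_bounds xi).
have dQ x y : a <= x -> x <= y -> Q y <= Q x.
  by move=> ax; rewrite le_eqVlt => /predU1P[->//|/(L1_decr _ _ ax)/ltW].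
exists w; split.
- split => //=; rewrite ru => xi; split => /=.
  + exact: w_left.
  + exact: w_right.
  + move=> /andP[l h]; split => //.
      rewrite /w/= minC (min_idPl ru) maxC (max_idPr ru).
      exact: dens_bounds.
    by rewrite [LHS]lam_dens clamp_id// !ltW.
- move=> xi; split=> //=; rewrite ad/=.
  apply: le_trans (ltW (phi_check_l_gt p pP p_sonic u uA0)).
  by case/andP: (dens_bounds xi).
- split; first by right.
  by left => x y xy /=; apply: dQ; [exact: ad|exact: dens_ni].
- split; apply: intermediate_speed_bounded => x y xy /=.
    have := dens_ni _ _ xy; rewrite le_eqVlt => /predU1P[->|yx].
      by exists x; rewrite ?lexx// !subrr mulr0.
    have [l1 l2] := dens_lam _ _ yx.
    have /andP[_ xu] := dens_bounds x.
    have [c /andP[c1 c2] E] := L1_rar_MVT p pP u _ _ (dens_gt0 y) yx xu.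
    exists (lam c); last by rewrite -[LHS]opprB E -mulrN opprB.
    have := lam_strict _ _ (dens_gt0 y) c1.
    have := lam_strict _ _ (lt_trans (dens_gt0 y) c1) c2.
    move=> h1 h2; apply/andP; split; first exact: le_trans l1 (ltW h1).
    exact: le_trans (ltW h2) l2.
  rewrite -[flowP p (w x)]/(P (dens x)) -[flowP p (w y)]/(P (dens y)).
  have := dens_ni _ _ xy; rewrite le_eqVlt => /predU1P[->|yx].
    by exists x; rewrite ?lexx// !subrr mulr0.
  have [l1 l2] := dens_lam _ _ yx.
  have /andP[_ xu] := dens_bounds x.
  have ly : lam (dens y) <= 0 by rewrite /lam lambda1_hat.
  have /andP[h1 h2] := flowP_rar_bounds p pP u u1_gt0 _ _ (dens_gt0 y) (ltW yx) xu ly.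
  have q0 : 0 < Q (dens y) - Q (dens x) by rewrite subr_gt0 L1_decr.
  (* For the flow the intermediate speed is the quotient of the increments itself;
     [flowP_rar_bounds] places it between the two characteristic speeds. *)
  exists ((P (dens y) - P (dens x)) / (Q (dens y) - Q (dens x))); last first.
    by rewrite divfK// gt_eqF.
  rewrite ler_pdivlMr// ler_pdivrMr//; apply/andP; split.
    by apply: (@le_trans _ _ (lam (dens x) * (Q (dens y) - Q (dens x)))); [
      rewrite ler_pM2r|rewrite /lam /Q /P; lra].
  by apply: (@le_trans _ _ (lam (dens y) * (Q (dens y) - Q (dens x)))); [
    rewrite /lam /Q /P; lra|rewrite ler_pM2r].
- split.
  (* A rarefaction is continuous at all speeds; any negative number can stand for the exceptional
     one. *)
  + by exists (-1); [rewrite ltrN10|move=> xi _; exact: w_cont].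
  + exact: w_right.
  + by exists (- lo) => xi; rewrite opprK; exact: w_left.
Qed.

End rarefaction.

Lemma wave_profile_exists (r : R) : a <= r <= b -> exists w, wave_profile (r, Q r) w.
Proof.
move=> /andP[ar rb]; have [ru|ur] := leP r u.1; first exact: rarefaction_profile.
exact: shock_profile.
Qed.

(** Inside a fan the strict monotonicity of [lambda1] determines the density from the speed. For a
    shock, only the value at the shock speed itself is left open. *)
Lemma lax_wave1_unique (um : R * R) (w1 w2 : R -> R * R) :
  lax_wave1 p u um w1 -> lax_wave1 p u um w2 ->
  exists s, forall xi, xi != s -> w1 xi = w2 xi.
Proof.
move=> [um0 umE h1] [_ _ h2]; move: h1 h2; case: ifPn => [mu h1 h2|_ h1 h2].
  exists 0 => xi _; have [a1 b1 c1] := h1 xi; have [a2 b2 c2] := h2 xi.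
  have [l|l] := leP xi (lambda1 p u); first by rewrite a1 ?a2.
  have [l'|l'] := leP (lambda1 p um) xi; first by rewrite b1 ?b2.
  move: c1 c2; rewrite l l' => /(_ isT)[/andP[m1 _] q1 e1] /(_ isT)[/andP[m2 _] q2 e2].
  have pos (z : R) : Num.min u.1 um.1 <= z -> 0 < z.
    by apply: lt_le_trans; rewrite lt_min u1_gt0.
  case: (w1 xi) (w2 xi) m1 q1 e1 m2 q2 e2 => [d1 f1] [d2 f2]/= m1 -> e1 m2 -> e2.
  suff -> : d1 = d2 by [].
  have [d12|d21|//] := ltgtP d1 d2.
    by have := lambda1_L1_decr p pP u u1_gt0 _ _ (pos _ m1) d12; rewrite e1 e2 ltxx.
  by have := lambda1_L1_decr p pP u u1_gt0 _ _ (pos _ m2) d21; rewrite e1 e2 ltxx.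
exists ((um.2 - u.2) / (um.1 - u.1)) => xi.
have [a1 b1] := h1 xi; have [a2 b2] := h2 xi.
by rewrite neq_lt => /orP[l|l]; [rewrite a1 ?a2|rewrite b1 ?b2].
Qed.

End wave1.

Lemma ae_neq {R : realType} (c : R) : {ae @lebesgue_measure R, forall x, x != c}.
Proof.
exists [set c]; split => //; first exact: lebesgue_measure_set1.
by move=> x /= /negP; rewrite negbK => /eqP.
Qed.

Lemma ae_filter {R : realType} : Filter (almost_everywhere (@lebesgue_measure R)).
Proof. exact: (ae_filter_ringOfSetsType (@lebesgue_measure R)). Qed.

(** * The weak solution glued from two centered waves *)

Section selfsimilar_solution.
Context {R : realType} (p : R -> R).
Local Notation mu := (@lebesgue_measure R).
Variables (ul ur um up : R * R) (wl wp : R -> R * R) (M sl sp B : R).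

Definition selfsimilar (t x : R) : R * R :=
  if 0 < t then sides wl wp (x / t) else riemann_datum ul ur x.

Hypothesis wl_bound : forall xi, `|(wl xi).1| <= M /\ `|(wl xi).2| <= M.
Hypothesis wp_bound : forall xi, `|(wp xi).1| <= M /\ `|(wp xi).2| <= M.
Hypothesis wl_mono : monotone_fun (fun xi => (wl xi).1) /\
  monotone_fun (fun xi => (wl xi).2).
Hypothesis wp_mono : monotone_fun (fun xi => (wp xi).1) /\
  monotone_fun (fun xi => (wp xi).2).
Hypothesis wl_speed : speed_bounded (fun xi => (wl xi).1) (fun xi => (wl xi).2) /\
  speed_bounded (fun xi => (wl xi).2) (fun xi => flowP p (wl xi)).
Hypothesis wp_speed : speed_bounded (fun xi => (wp xi).1) (fun xi => (wp xi).2) /\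
  speed_bounded (fun xi => (wp xi).2) (fun xi => flowP p (wp xi)).
Hypothesis sl0 : sl < 0.
Hypothesis sp0 : 0 < sp.
Hypothesis wl_cont : forall xi, xi != sl -> {for xi, continuous wl}.
Hypothesis wp_cont : forall xi, xi != sp -> {for xi, continuous wp}.
Hypothesis wl0 : wl 0 = um.
Hypothesis wp0 : wp 0 = up.
Hypothesis wl_far : forall xi, xi <= - B -> wl xi = ul.
Hypothesis wp_far : forall xi, B <= xi -> wp xi = ur.
Hypothesis wl_gt0 : forall xi, 0 < (wl xi).1.
Hypothesis wp_gt0 : forall xi, 0 < (wp xi).1.

Let B1 := Num.max B 1.
Let B1_gt0 : 0 < B1. Proof. by rewrite lt_max ltr01 orbT. Qed.
Let BB1 : B <= B1. Proof. by rewrite le_max lexx. Qed.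

Let ulE : ul = wl (- B1). Proof. by rewrite wl_far// lerN2. Qed.
Let urE : ur = wp B1. Proof. by rewrite wp_far. Qed.

Lemma selfsimilar_left (t x : R) : 0 < t -> x < 0 -> selfsimilar t x = wl (x / t).
Proof.
by move=> t0 x0; rewrite /selfsimilar t0 /sides pmulr_llt0 ?invr_gt0// x0.
Qed.

Lemma selfsimilar_right (t x : R) : 0 < t -> 0 < x -> selfsimilar t x = wp (x / t).
Proof.
move=> t0 x0; rewrite /selfsimilar t0 /sides pmulr_llt0 ?invr_gt0//.
by rewrite ltNge (ltW x0).
Qed.

(* At time 0 the datum is the same function as the waves frozen far away. *)
Let freeze (t x : R) : R := if 0 < t then x / t else if x < 0 then - B1 else B1.

Let selfsimilarE (t x : R) :
  selfsimilar t x = if x < 0 then wl (freeze t x) else wp (freeze t x).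
Proof.
rewrite /selfsimilar /freeze; case: ifPn => t0.
  by rewrite /sides pmulr_llt0 ?invr_gt0.
by rewrite /riemann_datum; case: ifP => x0; rewrite ?ulE ?urE.
Qed.

Section component.
Variable f : R * R -> R.
Hypothesis cf : continuous f.
Hypothesis fl_mono : monotone_fun (f \o wl).
Hypothesis fp_mono : monotone_fun (f \o wp).
Hypothesis fl_bound : forall xi, `|f (wl xi)| <= M.
Hypothesis fp_bound : forall xi, `|f (wp xi)| <= M.

Let slice (t : R) : exists g h, [/\ monotone_fun g, monotone_fun h,
  forall x, `|g x| <= M /\ `|h x| <= M &
  (fun x => f (selfsimilar t x)) = sides g h].
Proof.
have [t0|t0] := ltP 0 t.
  have resc g : monotone_fun g -> monotone_fun (fun x => g (x / t)).
    by move=> [gm|gm]; [left|right] => x y xy; apply: gm;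
      rewrite ler_pM2r ?invr_gt0.
  exists (fun x => f (wl (x / t))), (fun x => f (wp (x / t))); split.
  - exact: (resc (f \o wl)).
  - exact: (resc (f \o wp)).
  - by [].
  - apply/funext => x; rewrite /selfsimilar t0 /sides pmulr_llt0 ?invr_gt0//.
    by case: ifP.
exists (fun=> f ul), (fun=> f ur); split.
- by left.
- by left.
- by move=> x; rewrite ulE urE.
- apply/funext => x; rewrite /selfsimilar ltNge t0 /riemann_datum /sides.
  by case: ifP.
Qed.

Lemma selfsimilar_BV (t : R) : BV_class (fun x => f (selfsimilar t x)).
Proof.
have [g [h [gm hm gh ->]]] := slice t.
by apply: (BV_class_sides g h M) => // x; have [] := gh x.
Qed.

(** The excluded points are the junction and the two possible shock positions, a null set. At time
    0, for fixed [x] and small later times, the speed [x / s] is so large that the wave already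
    equals the datum. *)
Let time_cont (t x : R) : 0 <= t -> x != 0 -> x != sl * t -> x != sp * t ->
  selfsimilar s x @[s --> within [set s : R | 0 <= s] (nbhs t)] --> selfsimilar t x.
Proof.
rewrite le_eqVlt => /predU1P[<-{t}|t0] x0 xl xp.
  have xB : 0 < `|x| / B1 by rewrite divr_gt0// normr_gt0.
  apply: cvg_near_cst; rewrite near_withinE; near=> s => /= s0.
  rewrite /selfsimilar ltxx; case: ifPn => // s1.
  have h : B1 <= `|x| / s.
    rewrite ler_pdivlMr// mulrC -ler_pdivlMr//; apply: ltW.
    by near: s; exact: near_lt.
  rewrite /sides /riemann_datum pmulr_llt0 ?invr_gt0//.
  case: ifPn h => [xn|xn] h.
    apply: wl_far; rewrite ltr0_norm// mulNr in h.
    by rewrite lerNr; apply: le_trans h.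
  rewrite ger0_norm in h; last by rewrite leNgt.
  by apply: wp_far; exact: le_trans h.
suff h : selfsimilar s x @[s --> t] --> selfsimilar t x.
  by apply: cvg_trans h; apply: cvg_app; exact: cvg_within.
have ct : {for t, continuous (fun s : R => x / s)}.
  have ci : {for t, continuous (fun s : R => s)} by exact: cvg_id.
  exact: (cvgM (cvg_cst x) (cvgV (lt0r_neq0 t0) ci)).
have [xn|xp'|xE] := ltgtP x 0; last by rewrite xE eqxx in x0.
- have cw : {for t, continuous (fun s : R => wl (x / s))}.
    apply: (continuous_comp ct); apply: wl_cont.
    by apply: contra_neq xl => <-; rewrite divfK// gt_eqF.
  rewrite (selfsimilar_left _ _ t0 xn).
  apply: cvg_trans cw; apply: near_eq_cvg; near=> s.
  by rewrite selfsimilar_left//; near: s; exact: near_gt.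
- have cw : {for t, continuous (fun s : R => wp (x / s))}.
    apply: (continuous_comp ct); apply: wp_cont.
    by apply: contra_neq xp => <-; rewrite divfK// gt_eqF.
  rewrite (selfsimilar_right _ _ t0 xp').
  apply: cvg_trans cw; apply: near_eq_cvg; near=> s.
  by rewrite selfsimilar_right//; near: s; exact: near_gt.
Unshelve. all: by end_near. Qed.

Lemma selfsimilar_C0 : C0_L1loc (fun t x => f (selfsimilar t x)).
Proof.
apply: (C0_L1loc_bounded _ M) => [t t0|t x t0|t t0].
- have [g [h [gm hm gh ->]]] := slice t.
  by apply: sides_measurable; exact: monotone_measurable.
- by rewrite selfsimilarE; case: ifP.
- apply: (@filterS3 _ _ ae_filter _ _ _ _ _
    (ae_neq 0) (ae_neq (sl * t)) (ae_neq (sp * t))) => x x0 xl xp.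
  apply: (cvg_comp (selfsimilar^~ x) f (time_cont _ _ t0 x0 xl xp)).
  exact: cf.
Qed.

End component.

Lemma selfsimilar_left_trace (t : R) : 0 < t -> left_trace (selfsimilar t) um.
Proof.
move=> t0; exists (selfsimilar t); first exact/aeW.
have cm : {for 0, continuous (fun x : R => x / t)}.
  have ci : {for 0, continuous (fun s : R => s)} by exact: cvg_id.
  exact: (cvgM ci (cvg_cst t^-1)).
have cw : {for 0, continuous (fun x : R => wl (x / t))}.
  by apply: (continuous_comp cm); apply: wl_cont; rewrite mul0r gt_eqF.
have : wl (x / t) @[x --> 0^'-] --> um.
  by rewrite -wl0 -[in X in _ --> X](mul0r t^-1); exact: cvg_at_left_filter cw.
apply: cvg_trans; apply: near_eq_cvg; near=> x.
by rewrite selfsimilar_left//; near: x; exact: nbhs_left_lt.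
Unshelve. all: by end_near. Qed.

Lemma selfsimilar_right_trace (t : R) : 0 < t -> right_trace (selfsimilar t) up.
Proof.
move=> t0; exists (selfsimilar t); first exact/aeW.
have cm : {for 0, continuous (fun x : R => x / t)}.
  have ci : {for 0, continuous (fun s : R => s)} by exact: cvg_id.
  exact: (cvgM ci (cvg_cst t^-1)).
have cw : {for 0, continuous (fun x : R => wp (x / t))}.
  by apply: (continuous_comp cm); apply: wp_cont; rewrite mul0r lt_eqF.
have : wp (x / t) @[x --> 0^'+] --> up.
  by rewrite -wp0 -[in X in _ --> X](mul0r t^-1); exact: cvg_at_right_filter cw.
apply: cvg_trans; apply: near_eq_cvg; near=> x.
by rewrite selfsimilar_right//; near: x; exact: nbhs_right_gt.
Unshelve. all: by end_near. Qed.

Lemma selfsimilar_weak_solution (Phi : R -> R * R -> R -> R * R -> R * R)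
    (al ar : R) : Phi al um ar up = 0 ->
  weak_Phi_solution p Phi al ar ul ur selfsimilar.
Proof.
move=> PhiE.
have cfst : continuous (@fst R R) by move=> z; exact: cvg_fst.
have csnd : continuous (@snd R R) by move=> z; exact: cvg_snd.
have [l1 l2] := wl_mono; have [r1 r2] := wp_mono.
have bl1 xi : `|(wl xi).1| <= M by have [] := wl_bound xi.
have bl2 xi : `|(wl xi).2| <= M by have [] := wl_bound xi.
have br1 xi : `|(wp xi).1| <= M by have [] := wp_bound xi.
have br2 xi : `|(wp xi).2| <= M by have [] := wp_bound xi.
have [sl1 sl2] := wl_speed; have [sp1 sp2] := wp_speed.
have stE t x : 0 < t -> selfsimilar t x = sides wl wp (x / t).
  by move=> t0; rewrite /selfsimilar t0.
split.
- split.
  + exact: (selfsimilar_C0 fst cfst).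
  + exact: (selfsimilar_C0 snd csnd).
  + by move=> t _; apply/aeW => x; rewrite selfsimilarE; case: ifP.
  + apply/aeW => t _; split.
      exact: (selfsimilar_BV fst).
    exact: (selfsimilar_BV snd).
- move=> phi phi_test; split.
    apply: (weak_selfsimilar _ _ _ _ M phi _ _ l1 r1 bl1 br1 sl1 sp1 phi_test).
    by move=> t x t0 _; rewrite !stE// /sides; case: ifP.
  apply: (weak_selfsimilar _ _ _ _ M phi _ (fun t x => flowP p (selfsimilar t x))
    l2 r2 bl2 br2 sl2 sp2 phi_test).
  by move=> t x t0 _; rewrite !stE// /sides; case: ifP.
- by apply/aeW => x; rewrite /selfsimilar ltxx.
- apply: (@filterS _ _ ae_filter _ _ _ (ae_neq (0 : R))) => t tn0 t0.
  have {tn0}t0 : 0 < t by rewrite lt_neqAle eq_sym tn0.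
  exists um, up; split=> //; first exact: selfsimilar_left_trace.
  exact: selfsimilar_right_trace.
Qed.

End selfsimilar_solution.

(** * The junction problem *)

Lemma continuous_within_comp {R : realType} (f g : R -> R) (A B : set R) :
  {within A, continuous f} -> {within B, continuous g} ->
  (forall x, A x -> B (f x)) -> {within A, continuous (g \o f)}.
Proof.
move=> /subspace_continuousP cf /subspace_continuousP cg AB.
apply/subspace_continuousP => x Ax.
have fB : f y @[y --> within A (nbhs x)] --> within B (nbhs (f x)).
  move=> P BP.
  have h : \forall z \near x, A z -> B (f z) -> P (f z) by exact: (cf x Ax _ BP).
  rewrite /fmap/= /within/=.
  apply: (@filterS _ (nbhs x) _ (fun z => A z -> B (f z) -> P (f z))) => // z hz Az.
  exact: (hz Az (AB z Az)).
exact: (cvg_comp f g fB (cg _ (AB _ Ax))).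
Qed.

(** The infimum that defines l' is attained, either at the left end or where [f] meets the level.
    The positive sign of [f] there is what later places l' to the left of l''. *)
Lemma first_below {R : realType} (f : R -> R) (a b y : R) : a <= b ->
    (forall x, a <= x <= b -> {for x, continuous f}) ->
    (forall x z, a <= x -> x < z -> z <= b -> f z < f x) ->
    0 < f a -> f b < 0 -> 0 < y ->
  exists c, [/\ a <= c <= b, 0 < f c, f c <= y &
    forall x, a <= x <= b -> f x <= y -> c <= x].
Proof.
move=> ab cf fd fa fb y0; have [fay|yfa] := leP (f a) y.
  by exists a; split; rewrite ?lexx// => x /andP[].
have [|c /andP[ac cb] fc] := @IVT_decr R f a b y ab cf.
  by rewrite yfa (lt_trans fb).
exists c; split; rewrite ?fc ?(ltW ac) ?(ltW cb)// => x /andP[ax xb] fxy.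
by rewrite leNgt; apply/negP => xc; have := fd _ _ ax xc (ltW cb); rewrite fc ltNge fxy.
Qed.

Lemma last_above {R : realType} (f : R -> R) (a b y : R) : a <= b ->
    (forall x, a <= x <= b -> {for x, continuous f}) ->
    (forall x z, a <= x -> x < z -> z <= b -> f z < f x) ->
    0 < f a -> f b < 0 -> y < 0 ->
  exists c, [/\ a <= c <= b, f c < 0, y <= f c &
    forall x, a <= x <= b -> y <= f x -> x <= c].
Proof.
move=> ab cf fd fa fb y0; have [fay|yfa] := leP y (f b).
  by exists b; split; rewrite ?lexx ?ab// => x /andP[].
have [|c /andP[ac cb] fc] := @IVT_decr R f a b y ab cf.
  by rewrite yfa (lt_trans y0).
exists c; split; rewrite ?fc ?(ltW ac) ?(ltW cb)// => x /andP[ax xb] fxy.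
by rewrite leNgt; apply/negP => xc; have := fd _ _ (ltW ac) xc xb; rewrite fc ltNge fxy.
Qed.

Section junction.
Context {R : realType} (al ar a b a' b' : R) (Q PL N PR g : R -> R).
Hypothesis al_gt0 : 0 < al.
Hypothesis ar_gt0 : 0 < ar.
Hypothesis ab : a <= b.
Hypothesis ab' : a' <= b'.
Hypothesis Q_cont : forall x, a <= x <= b -> {for x, continuous Q}.
Hypothesis PL_cont : forall x, a <= x <= b -> {for x, continuous PL}.
Hypothesis N_cont : forall x, a' <= x <= b' -> {for x, continuous N}.
Hypothesis PR_cont : forall x, a' <= x <= b' -> {for x, continuous PR}.
Hypothesis Q_decr : forall x y, a <= x -> x < y -> y <= b -> Q y < Q x.
Hypothesis PL_incr : forall x y, a <= x -> x < y -> y <= b -> PL x < PL y.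
Hypothesis N_incr : forall x y, a' <= x -> x < y -> y <= b' -> N x < N y.
Hypothesis PR_incr : forall x y, a' <= x -> x < y -> y <= b' -> PR x < PR y.
Hypothesis Qa : 0 < Q a.
Hypothesis Qb : Q b < 0.
Hypothesis Na' : N a' < 0.
Hypothesis Nb' : 0 < N b'.
Hypothesis gN : forall x, a' <= x <= b' -> g (N x) = x.

Definition junction_states (x y : R) := [/\ a <= x <= b, a' <= y <= b',
  al * Q x = ar * N y & al * PL x = ar * PR y].

Let Q_le (x y : R) : a <= x -> x <= y -> y <= b -> Q y <= Q x.
Proof. by move=> ax; rewrite le_eqVlt => /predU1P[->//|xy yb]; rewrite ltW// Q_decr. Qed.

Let PL_le (x y : R) : a <= x -> x <= y -> y <= b -> PL x <= PL y.
Proof. by move=> ax; rewrite le_eqVlt => /predU1P[->//|xy yb]; rewrite ltW// PL_incr. Qed.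

Let PR_le (x y : R) : a' <= x -> x <= y -> y <= b' -> PR x <= PR y.
Proof. by move=> ax; rewrite le_eqVlt => /predU1P[->//|xy yb]; rewrite ltW// PR_incr. Qed.

Let N_le (x y : R) : a' <= x -> x <= y -> y <= b' -> N x <= N y.
Proof. by move=> ax; rewrite le_eqVlt => /predU1P[->//|xy yb]; rewrite ltW// N_incr. Qed.

(** A larger left density lowers the flow and raises P. On the right both increase with the density,
    so no pair of right densities can match the two changes. *)
Lemma junction_unique (x y x' y' : R) :
  junction_states x y -> junction_states x' y' -> x = x' /\ y = y'.
Proof.
have aux u v u' v' : junction_states u v -> junction_states u' v' -> ~ u < u'.
  move=> [/andP[au ub] /andP[av vb] q1 p1] [/andP[au' ub'] /andP[av' vb'] q2 p2] uu'.
  have qlt : ar * N v' < ar * N v by rewrite -q1 -q2 ltr_pM2l// Q_decr.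
  rewrite ltr_pM2l// in qlt.
  have plt : ar * PR v < ar * PR v' by rewrite -p1 -p2 ltr_pM2l// PL_incr.
  rewrite ltr_pM2l// in plt.
  have [vv'|v'v] := leP v v'; first by move: qlt; rewrite ltNge N_le.
  by move: plt; rewrite ltNge PR_le// ltW.
move=> j1 j2; have xx' : x = x'.
  by have [/(aux _ _ _ _ j1 j2)|/(aux _ _ _ _ j2 j1)|] := ltgtP x x'.
split=> //; case: j1 j2 => [_ /andP[ay yb] q1 _] [_ /andP[ay' yb'] q2 _].
have : ar * N y = ar * N y' by rewrite -q1 -q2 xx'.
move=> /(mulfI (lt0r_neq0 ar_gt0)) NN.
have [h|h|//] := ltgtP y y'.
  by have := N_incr _ _ ay h yb'; rewrite NN ltxx.
by have := N_incr _ _ ay' h yb; rewrite NN ltxx.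
Qed.

Let k := al / ar.
Let k0 : 0 < k. Proof. exact: divr_gt0. Qed.

Let kE (x y : R) : (al * x <= ar * y) = (k * x <= y).
Proof. by rewrite /k mulrAC ler_pdivrMr// (mulrC y). Qed.

Let kE' (x y : R) : (ar * y <= al * x) = (y <= k * x).
Proof. by rewrite /k mulrAC ler_pdivlMr// (mulrC y). Qed.

Let NV (y : R) : N a' <= y <= N b' -> a' <= g y <= b' /\ N (g y) = y.
Proof.
move=> /andP[y1 y2].
suff [x xab <-] : exists2 x, a' <= x <= b' & N x = y by rewrite gN.
have [|x + xE] := @IVT R N a' b' y ab' (continuous_within_itvcc _ _ _ N_cont).
  by rewrite ge_min le_max y1 y2 orbT.
by rewrite in_itv/=; exists x.
Qed.

Let gN_incr (y z : R) : N a' <= y -> y <= z -> z <= N b' -> g y <= g z.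
Proof.
move=> ay yz zb.
have [|/andP[h1 h2] h3] := NV y; first by rewrite ay (le_trans yz).
have [|/andP[h1' h2'] h3'] := NV z; first by rewrite zb (le_trans ay).
rewrite leNgt; apply/negP => h; have := N_incr _ _ h1' h h2.
by rewrite h3 h3' ltNge yz.
Qed.

(** An increasing map of one segment onto another is continuous; surjectivity comes from [gN]. *)
Let g_cont : {within `[N a', N b'], continuous g}.
Proof.
have ga : g (N a') = a' by rewrite gN// lexx.
have gb : g (N b') = b' by rewrite gN// lexx andbT.
apply: segment_inc_surj_continuous => [x y|].
  rewrite !in_itv/= => xN yN.
  have [/andP[h1 h2] h3] := NV x xN; have [/andP[h1' h2'] h3'] := NV y yN.
  apply/idP/idP => h; first by rewrite -h3 -h3' N_le.
  by apply: gN_incr => //; [case/andP: xN|case/andP: yN].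
rewrite ga gb => x; rewrite /= in_itv/= => xab; exists (N x); last exact: gN.
by rewrite in_itv/=; case/andP: xab => ax xb; rewrite !N_le.
Qed.

Let lset := [set x | a <= x <= b /\ al * Q x <= ar * N b'].
Let rset := [set x | a <= x <= b /\ al * Q x >= ar * N a'].

Let inf_min (A : set R) (c : R) : A c -> lbound A c -> inf A = c.
Proof.
move=> Ac cA; apply/eqP; rewrite eq_le lb_le_inf//; last by exists c.
by rewrite andbT; apply: ge_inf => //; exists c.
Qed.

Let sup_max (A : set R) (c : R) : A c -> ubound A c -> sup A = c.
Proof.
move=> Ac cA; apply/eqP; rewrite eq_le ge_sup//; last by exists c.
by rewrite /=; apply: ub_le_sup => //; exists c.
Qed.

Let y0' : 0 < ar * N b' / al. Proof. by rewrite divr_gt0// mulr_gt0. Qed.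
Let y0'' : ar * N a' / al < 0.
Proof. by rewrite pmulr_llt0 ?invr_gt0// pmulr_rlt0. Qed.

Let lsetP : [/\ a <= inf lset <= b, N a' <= k * Q (inf lset) <= N b',
  0 < Q (inf lset) & forall x, lset x -> inf lset <= x].
Proof.
have [c [cab c0 cy cmin]] := first_below Q a b _ ab Q_cont Q_decr Qa Qb y0'.
have lc : lset c by split=> //; rewrite mulrC -ler_pdivlMr.
have cl : lbound lset c.
  by move=> x [xab xN]; apply: cmin => //; rewrite ler_pdivlMr// mulrC.
rewrite (inf_min _ _ lc cl); split=> //.
rewrite -kE; case: lc => _ ->; rewrite andbT.
by apply/ltW; apply: lt_trans Na' _; exact: mulr_gt0.
Qed.

Let rsetP : [/\ a <= sup rset <= b, N a' <= k * Q (sup rset) <= N b',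
  Q (sup rset) < 0 & forall x, rset x -> x <= sup rset].
Proof.
have [c [cab c0 cy cmin]] := last_above Q a b _ ab Q_cont Q_decr Qa Qb y0''.
have lc : rset c by split=> //; rewrite [leRHS]mulrC -ler_pdivrMr.
have cl : ubound rset c.
  by move=> x [xab xN]; apply: cmin => //; rewrite ler_pdivrMr// [leRHS]mulrC.
rewrite (sup_max _ _ lc cl); split=> //.
rewrite -kE'; case: lc => _ -> /=.
by apply/ltW; apply: lt_trans Nb'; rewrite pmulr_rlt0.
Qed.

(** The right state in the criterion has the prescribed flow as its second component; this
    identifies it as a point of the right curve, at density [g] of that flow. *)
Lemma junction_value_left : N (g (k * Q (inf lset))) = k * Q (inf lset).
Proof. by have [_ h _ _] := lsetP; have [] := NV _ h. Qed.

Lemma junction_value_right : N (g (k * Q (sup rset))) = k * Q (sup rset).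
Proof. by have [_ h _ _] := rsetP; have [] := NV _ h. Qed.

Lemma junction_iff : (exists x y, junction_states x y) <->
  (al * PL (inf lset) <= ar * PR (g (k * Q (inf lset))) /\
   al * PL (sup rset) >= ar * PR (g (k * Q (sup rset)))).
Proof.
have [/andP[al' lb'] lN l0 lmin] := lsetP.
have [/andP[ar' rb'] rN r0 rmax] := rsetP.
have [/andP[gl1 gl2] gl3] := NV _ lN; have [/andP[gr1 gr2] gr3] := NV _ rN.
split.
  move=> [x [y [xab /andP[ay yb] qE pE]]].
  have lx : inf lset <= x by apply: lmin; split=> //; rewrite qE ler_pM2l// N_le.
  have xr : x <= sup rset by apply: rmax; split=> //; rewrite qE ler_pM2l// N_le.
  case/andP: xab => ax xb.
  have NyE : N y = k * Q x by rewrite /k mulrAC qE mulrAC divff ?mul1r// gt_eqF.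
  have gy : y = g (k * Q x) by rewrite -NyE gN// ay.
  have Nyb : N a' <= N y <= N b' by rewrite !N_le.
  split.
    apply: (@le_trans _ _ (al * PL x)); first by rewrite ler_pM2l// PL_le.
    rewrite pE ler_pM2l// PR_le// gy gN_incr//.
    - by rewrite -NyE; case/andP: Nyb.
    - by rewrite ler_pM2l// Q_le.
    - by case/andP: lN.
  apply: (@le_trans _ _ (al * PL x)); last by rewrite ler_pM2l// PL_le.
  rewrite pE ler_pM2l// PR_le// [leRHS]gy gN_incr//.
  - by case/andP: rN.
  - by rewrite ler_pM2l// Q_le.
  - by rewrite -NyE; case/andP: Nyb.
move=> [Fl Fr].
(* The flow is positive at the first point and negative at the second, and it decreases. *)
have lr : inf lset <= sup rset.
  rewrite leNgt; apply/negP => h; have := Q_decr _ _ ar' h lb'.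
  by rewrite ltNge (ltW (lt_trans r0 l0)).
have sub x : inf lset <= x <= sup rset -> a <= x <= b.
  by move=> /andP[lx xr]; rewrite (le_trans al' lx) (le_trans xr rb').
have kQN x : inf lset <= x <= sup rset -> N a' <= k * Q x <= N b'.
  move=> xlr; have /andP[ax xb] := sub _ xlr; case/andP: xlr => lx xr.
  case/andP: lN => _ lN; case/andP: rN => rN _.
  apply/andP; split; [apply: le_trans rN _|apply: le_trans lN];
  by rewrite ler_pM2l// Q_le.
(* The jump of P through the junction once the flows are matched; a zero between l' and l'' yields
   the junction states. *)
pose F x := al * PL x - ar * PR (g (k * Q x)).
have cF : {within `[inf lset, sup rset], continuous F}.
  have c1 : {within `[inf lset, sup rset], continuous (fun x => al * PL x)}.
    apply: continuous_within_itvcc => x /sub xab.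
    by apply: cvgM; [exact: cvg_cst|exact: PL_cont].
  have c2 : {within `[inf lset, sup rset], continuous (fun x => k * Q x)}.
    apply: continuous_within_itvcc => x /sub xab.
    by apply: cvgM; [exact: cvg_cst|exact: Q_cont].
  have c3 : {within `[inf lset, sup rset], continuous (g \o (fun x => k * Q x))}.
    apply: (continuous_within_comp _ _ _ _ c2 g_cont) => x.
    by rewrite /= !in_itv/=; exact: kQN.
  have c4 : {within `[a', b'], continuous (fun x => ar * PR x)}.
    apply: continuous_within_itvcc => x xab.
    by apply: cvgM; [exact: cvg_cst|exact: PR_cont].
  have c5 := continuous_within_comp _ _ _ _ c3 c4.
  have {}c5 : {within `[inf lset, sup rset],
      continuous ((fun x => ar * PR x) \o (g \o (fun x => k * Q x)))}.
    by apply: c5 => x; rewrite /= !in_itv/= => /kQN/NV[].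
  by move=> x; apply: cvgB; [exact: c1|exact: c5].
have Fl0 : F (inf lset) <= 0 by rewrite subr_le0.
have Fr0 : 0 <= F (sup rset) by rewrite subr_ge0.
have [|x + Fx] := @IVT R F (inf lset) (sup rset) 0 lr cF.
  by rewrite ge_min le_max Fl0 Fr0 orbT.
rewrite in_itv/= => xlr; have [h1 h2] := NV _ (kQN _ xlr).
exists x, (g (k * Q x)); split; rewrite ?sub//.
  by rewrite h2 /k mulrAC mulrCA divff ?mulr1// gt_eqF.
by move/eqP: Fx; rewrite subr_eq0 => /eqP.
Qed.

End junction.

(** * Reflection, traces and solutions *)

(* Space reflection: exchanges the two families, and turns the reversed 2-Lax
   curve into the forward 1-Lax curve. *)
Definition reflect_state {R : realType} (z : R * R) : R * R := (z.1, - z.2).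

Section reflection.
Context {R : realType} (p : R -> R).
Implicit Types (z u : R * R).

Lemma reflect_stateK z : reflect_state (reflect_state z) = z.
Proof. by case: z => r q; rewrite /reflect_state/= opprK. Qed.

Lemma L2mE x u : L2m p x u = - L1 p x (reflect_state u).
Proof.
rewrite /L2m /L1 /reflect_state/=.
by case: ifP => _; rewrite mulrN opprB addrC opprK.
Qed.

Lemma lambda1_reflect z : lambda1 p (reflect_state z) = - lambda2 p z.
Proof. by rewrite /lambda1 /lambda2 /= mulNr opprD. Qed.

Lemma lambda2_reflect z : lambda2 p (reflect_state z) = - lambda1 p z.
Proof. by rewrite /lambda1 /lambda2 /= mulNr opprB addrC. Qed.

Lemma flowP_reflect z : flowP p (reflect_state z) = flowP p z.
Proof. by rewrite /flowP /= sqrrN. Qed.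

Lemma A0_reflect z : A0 p z -> A0 p (reflect_state z).
Proof.
move=> [z0 /andP[h1 h2]]; split=> //.
by rewrite lambda1_reflect lambda2_reflect oppr_lt0 oppr_gt0 h1 h2.
Qed.

Lemma A0cl_reflect z : A0cl p (reflect_state z) <-> A0cl p z.
Proof.
by split=> -[z0 h]; split=> //; move: h;
  rewrite lambda1_reflect lambda2_reflect oppr_le0 oppr_ge0 andbC.
Qed.

(** Reflection exchanges the equations [lambda2 = 0] and [lambda1 = 0], so the two sets agree and
    [get] selects the same element. Therefore check and hat trade places on the right, where check
    is the lower end. *)
Lemma phi_check_rE u : phi_check_r p u = phi_hat_l p (reflect_state u).
Proof.
congr get; apply/seteqP.
split=> x [x0 h]; split=> //; move: h;
  rewrite L2mE -[(x, - _)]/(reflect_state (x, _)) lambda2_reflect.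
  by move=> /eqP; rewrite oppr_eq0 => /eqP.
by move=> ->; rewrite oppr0.
Qed.

Lemma phi_hat_rE u : phi_hat_r p u = phi_check_l p (reflect_state u).
Proof.
congr get; apply/seteqP.
split=> x [x0 h]; split=> //; move: h;
  rewrite L2mE -[(x, - _)]/(reflect_state (x, _)) lambda1_reflect.
  by move=> /eqP; rewrite oppr_eq0 => /eqP.
by move=> ->; rewrite oppr0.
Qed.

Lemma A0_A0cl z : A0 p z -> A0cl p z.
Proof. by move=> [z0 /andP[h1 h2]]; split=> //; rewrite !ltW. Qed.

Lemma lax_wave2_reflect um ur (w : R -> R * R) :
  lax_wave1 p (reflect_state ur) (reflect_state um) w ->
  lax_wave2 p um ur (fun xi => reflect_state (w (- xi))).
Proof.
move=> [m0 mE h]; split=> //.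
  by rewrite L2mE -mE /= opprK.
move: h; case: ifPn => /= _ h.
  move=> xi; have := h (- xi).
  rewrite !lambda1_reflect !lerN2 !ltrN2 => -[h1 h2 h3]; split.
  - by move=> /h2 ->; rewrite reflect_stateK.
  - by move=> /h1 ->; rewrite reflect_stateK.
  - rewrite andbC => /h3[d1 d2 d3]; split.
    + by rewrite minC maxC.
    + by rewrite L2mE /= d2.
    + by rewrite lambda2_reflect d3 opprK.
rewrite /shock_wave /= in h *.
have -> : (ur.2 - um.2) / (ur.1 - um.1) =
    - ((- um.2 - - ur.2) / (um.1 - ur.1)).
  by rewrite -mulrN -invrN opprB; congr (_ / _); ring.
move=> xi; have [h1 h2] := h (- xi); split=> l.
  by rewrite h2 ?reflect_stateK// ltrNr.
by rewrite h1 ?reflect_stateK// ltrNl.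
Qed.

Lemma lax_wave1_reflect um ur (w : R -> R * R) :
  lax_wave2 p um ur w ->
  lax_wave1 p (reflect_state ur) (reflect_state um)
    (fun xi => reflect_state (w (- xi))).
Proof.
move=> [m0 mE h]; split=> //; first by rewrite /= mE L2mE opprK.
move: h; case: ifPn => /= _ h.
  move=> xi; have := h (- xi).
  rewrite !lambda1_reflect !(lerNl xi) !(lerNr xi) => -[h1 h2 h3]; split.
  - by move=> l; rewrite h2// lerNr.
  - by move=> l; rewrite h1// lerNl.
  - rewrite ltrNl (ltrNr xi) andbC => /h3[d1 d2 d3]; split.
    + by rewrite minC maxC.
    + by rewrite /= d2 L2mE opprK.
    + by rewrite d3 opprK.
rewrite /shock_wave /= in h *.
have -> : (- um.2 - - ur.2) / (um.1 - ur.1) =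
    - ((ur.2 - um.2) / (ur.1 - um.1)).
  by rewrite -mulrN -invrN opprB; congr (_ / _); ring.
move=> xi; have [h1 h2] := h (- xi); split=> l.
  by rewrite h2// ltrNr.
by rewrite h1// ltrNl.
Qed.

End reflection.

(** * One-sided limits of classes up to null sets *)

Section traces.
Context {R : realType}.
Local Notation mu := (@lebesgue_measure R).

Lemma ae_meets_interval (P : R -> Prop) (a b : R) :
  {ae mu, forall x, P x} -> a < b -> exists x, a < x < b /\ P x.
Proof.
move=> [A [mA muA PA]] ab; apply: contrapT => nP.
have sub : `]a, b[%classic `<=` A.
  move=> x; rewrite /= in_itv/= => xab; apply: PA => /= Px; apply: nP.
  by exists x.
have : (mu `]a, b[ <= mu A)%E by apply: le_measure; rewrite ?inE.
rewrite muA lebesgue_measure_itv/= lte_fin ab -EFinB lee_fin subr_le0 leNgt ab.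
by [].
Qed.

(** Every member of the filter meets every set of full measure. This makes limits along [F]
    insensitive to changes on null sets. *)
Definition meets_ae (F : set_system R) :=
  forall P Q : R -> Prop, {ae mu, forall x, P x} -> (\forall x \near F, Q x) ->
  exists x, P x /\ Q x.

Lemma meets_ae_left : meets_ae (0 : R)^'-.
Proof.
move=> P Q Pae; rewrite near_withinE => /nbhs_ballP[e /= e0 eQ].
have [|x [/andP[ex x0] Px]] := ae_meets_interval P (- e) 0 Pae.
  by rewrite oppr_lt0.
exists x; split=> //; apply: eQ => //.
by rewrite /ball/= sub0r normrN ltr0_norm// ltrNl.
Qed.

Lemma meets_ae_right : meets_ae (0 : R)^'+.
Proof.
move=> P Q Pae; rewrite near_withinE => /nbhs_ballP[e /= e0 eQ].
have [x [/andP[x0 xe] Px]] := ae_meets_interval P 0 e Pae e0.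
exists x; split=> //; apply: eQ => //.
by rewrite /ball/= sub0r normrN gtr0_norm.
Qed.

Definition trace_along (F : set_system R) (f : R -> R * R) (l : R * R) :=
  exists2 g : R -> R * R, {ae mu, forall x, f x = g x} & g @ F --> l.

Lemma trace_unique (F : set_system R) (FF : Filter F) (f : R -> R * R)
    (l l' : R * R) : meets_ae F ->
  trace_along F f l -> trace_along F f l' -> l = l'.
Proof.
move=> mF [g fg gl] [g' fg' gl']; apply/eqP; rewrite -subr_eq0.
apply/negPn/negP => ll'.
have h : \forall x \near F, g x - g' x != 0.
  exact: (@cvgr_neq0 _ _ _ _ FF _ _ (cvgB gl gl') ll').
have gg' : {ae mu, forall x, g x = g' x}.
  by apply: (@filterS2 _ _ ae_filter _ _ _ _ fg fg') => x <- <-.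
have [x [e]] := mF _ _ gg' h.
by rewrite /= e subrr eqxx.
Qed.

(** Only non-strict inequalities survive in the limit, so traces of subsonic solutions are
    controlled in [A0cl], not in [A0]. *)
Lemma trace_le0 (F : set_system R) (FF : Filter F) (f : R -> R * R)
    (l : R * R) (h : R * R -> R) : meets_ae F ->
  trace_along F f l -> {for l, continuous h} ->
  {ae mu, forall x, h (f x) <= 0} -> h l <= 0.
Proof.
move=> mF [g fg gl] ch hf; rewrite leNgt; apply/negP => hl.
have hg : {ae mu, forall x, h (g x) <= 0}.
  by apply: (@filterS2 _ _ ae_filter _ _ _ _ fg hf) => x <-.
have cg : (h \o g) @ F --> h l by exact: (cvg_comp g h gl ch).
have [x []] := mF _ _ hg (@cvgr_gt _ _ _ FF (h \o g) _ cg 0 hl).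
by rewrite /= leNgt => /negP.
Qed.

End traces.

Lemma speed_bounded_reflect {R : realType} (W G : R -> R) : speed_bounded W G ->
  speed_bounded (fun x => W (- x)) (fun x => - G (- x)).
Proof.
move=> WG x y; have := WG (- x) (- y).
have -> : - y - - x = - (y - x) by ring.
have -> : G (- y) - G (- x) - - y * (W (- y) - W (- x)) =
  - (- G (- y) - - G (- x) - y * (W (- y) - W (- x))) by ring.
by rewrite !normrN.
Qed.

Lemma speed_bounded_opp {R : realType} (W G : R -> R) :
  speed_bounded W G -> speed_bounded (fun x => - W x) (fun x => - G x).
Proof.
move=> WG x y; have := WG x y.
have -> : - W y - - W x = - (W y - W x) by ring.
have -> : - G y - - G x - y * - (W y - W x) = - (G y - G x - y * (W y - W x)).
  by ring.
by rewrite !normrN.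
Qed.

Lemma monotone_fun_opp {R : realType} (f : R -> R) :
  monotone_fun f -> monotone_fun (fun x => - f x).
Proof. by move=> [h|h]; [right|left] => x y xy; rewrite lerN2 h. Qed.

Lemma monotone_fun_reflect {R : realType} (f : R -> R) :
  monotone_fun f -> monotone_fun (fun x => f (- x)).
Proof. by move=> [h|h]; [right|left] => x y xy; rewrite h// lerN2. Qed.

(** * From solutions to junction states and back *)

Section solutions.
Context {R : realType} (p : R -> R) (al ar : R) (ul ur : R * R).
Hypothesis pP : pressure p.
Hypothesis p_sonic : sonic_densities_determined p.
Hypothesis ul_A0 : A0 p ul.
Hypothesis ur_A0 : A0 p ur.
Local Notation mu := (@lebesgue_measure R).

Lemma lambda_continuous (z : R * R) : 0 < z.1 ->
  {for z, continuous (lambda1 p)} /\ {for z, continuous (lambda2 p)}.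
Proof.
move=> z0.
have c1 : {for z, continuous (@fst R R)} by exact: cvg_fst.
have c2 : {for z, continuous (@snd R R)} by exact: cvg_snd.
have cv : {for z, continuous (fun z : R * R => z.2 / z.1)}.
  exact: (cvgM c2 (cvgV (lt0r_neq0 z0) c1)).
have cs : {for z, continuous (fun z : R * R => sound p z.1)}.
  exact: (continuous_comp c1 (sound_continuous p pP _ z0)).
by split; [exact: (cvgB cv cs)|exact: (cvgD cv cs)].
Qed.

Lemma trace_A0cl (F : set_system R) (FF : Filter F) (f : R -> R * R) (l : R * R) :
  meets_ae F -> trace_along F f l -> 0 < l.1 ->
  {ae mu, forall x, A0cl p (f x)} -> A0cl p l.
Proof.
move=> mF fl l0 fA; have [c1 c2] := lambda_continuous _ l0.
split=> //; apply/andP; split.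
  apply: (trace_le0 _ _ _ _ _ mF fl c1).
  by apply: (@filterS _ _ ae_filter _ _ _ fA) => x [_ /andP[]].
rewrite -oppr_le0; apply: (trace_le0 _ _ _ _ (fun z => - lambda2 p z) mF fl).
  exact: cvgN c2.
by apply: (@filterS _ _ ae_filter _ _ _ fA) => x [_ /andP[_]]; rewrite oppr_le0.
Qed.

Let N (x : R) := L2m p x ur.
Let Q (x : R) := L1 p x ul.

Lemma A0cl_L2m (x : R) : A0cl p (x, N x) <-> phi_check_r p ur <= x <= phi_hat_r p ur.
Proof.
rewrite /N L2mE -[(x, - _)]/(reflect_state (x, _)) A0cl_reflect.
by rewrite A0cl_L1 ?phi_check_rE ?phi_hat_rE//; exact: A0_reflect.
Qed.

Definition L_junction := junction_states al ar (phi_hat_l p ul) (phi_check_l p ul)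
  (phi_check_r p ur) (phi_hat_r p ur) Q (fun x => flowP p (x, Q x))
  N (fun x => flowP p (x, N x)).

Let side_l : [/\ 0 < phi_hat_l p ul, phi_hat_l p ul <= phi_check_l p ul,
  0 < Q (phi_hat_l p ul) & Q (phi_check_l p ul) < 0].
Proof.
have [a0 _] := phi_hat_lP p p_sonic ul ul_A0.
split => //; [|exact: L1_hat_gt0|exact: L1_check_lt0].
by rewrite ltW// (lt_trans (phi_hat_l_lt p pP p_sonic ul ul_A0))// phi_check_l_gt.
Qed.

Let ur'_A0 := A0_reflect p _ ur_A0.

Let side_r : [/\ 0 < phi_check_r p ur, phi_check_r p ur <= phi_hat_r p ur,
  N (phi_check_r p ur) < 0 & 0 < N (phi_hat_r p ur)].
Proof.
rewrite /N !L2mE phi_check_rE phi_hat_rE oppr_lt0 oppr_gt0.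
have [a0 _] := phi_hat_lP p p_sonic _ ur'_A0.
split => //; [|exact: L1_hat_gt0|exact: L1_check_lt0].
by rewrite ltW// (lt_trans (phi_hat_l_lt p pP p_sonic _ ur'_A0))// phi_check_l_gt.
Qed.

Let N_incr (x y : R) : phi_check_r p ur <= x -> x < y -> y <= phi_hat_r p ur ->
  N x < N y.
Proof.
rewrite phi_check_rE => ax xy _.
by rewrite /N !L2mE ltrN2 (L1_decr p pP p_sonic _ ur'_A0).
Qed.

Let flowN (x : R) : flowP p (x, N x) = flowP p (x, L1 p x (reflect_state ur)).
Proof. by rewrite /N L2mE -[(x, - _)]/(reflect_state (x, _)) flowP_reflect. Qed.

Let PR_incr (x y : R) : phi_check_r p ur <= x -> x < y -> y <= phi_hat_r p ur ->
  flowP p (x, N x) < flowP p (y, N y).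
Proof.
by rewrite phi_check_rE => ax xy _; rewrite !flowN (flowP_incr p pP p_sonic _ ur'_A0).
Qed.

Lemma L_junction_unique : 0 < al -> 0 < ar -> forall x y x' y',
  L_junction x y -> L_junction x' y' -> x = x' /\ y = y'.
Proof.
move=> al0 ar0 x y x' y'; apply: junction_unique => //.
- by move=> s t as_ st _; exact: (L1_decr p pP p_sonic ul ul_A0).
- by move=> s t as_ st _; exact: (flowP_incr p pP p_sonic ul ul_A0).
Qed.

(** [pinv] inverts on the left wherever the map is injective, which follows here from strict
    monotonicity on the closed subsonic interval. *)
Lemma g_inv_L2m (x : R) : phi_check_r p ur <= x <= phi_hat_r p ur ->
  g_inv p ur (N x) = x.
Proof.
move=> xab; rewrite /g_inv pinvKV//; last by rewrite inE; apply/A0cl_L2m.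
move=> s t; rewrite !inE => /A0cl_L2m/andP[s1 s2] /A0cl_L2m/andP[t1 t2] st.
have [h|h|//] := ltgtP s t.
  by have := N_incr _ _ s1 h t2; rewrite /N st ltxx.
by have := N_incr _ _ t1 h s2; rewrite /N st ltxx.
Qed.

Lemma L_junction_iff : 0 < al -> 0 < ar ->
  let l' := l_prime p al ar ul ur in
  let l'' := l_second p al ar ul ur in
  let g := g_inv p ur in
  (exists x y, L_junction x y) <->
  (al * flowP p (l', L1 p l' ul) <=
     ar * flowP p (g (al / ar * L1 p l' ul), al / ar * L1 p l' ul) /\
   al * flowP p (l'', L1 p l'' ul) >=
     ar * flowP p (g (al / ar * L1 p l'' ul), al / ar * L1 p l'' ul)).
Proof.
move=> al0 ar0 l' l'' g.
have [a0 ab Qa Qb] := side_l; have [a0' ab' Na Nb] := side_r.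
have u0 : 0 < ul.1 by case: ul_A0.
have u0' : 0 < (reflect_state ur).1 by case: ur_A0.
have cQ x : phi_hat_l p ul <= x <= phi_check_l p ul -> {for x, continuous Q}.
  by move=> /andP[ax _]; apply: L1_continuous => //; exact: lt_le_trans ax.
have cP x : phi_hat_l p ul <= x <= phi_check_l p ul ->
    {for x, continuous (fun x => flowP p (x, Q x))}.
  by move=> /andP[ax _]; apply: flowP_L1_continuous => //; exact: lt_le_trans ax.
have NE : N = (fun x => - L1 p x (reflect_state ur)).
  by apply/funext => x; rewrite /N L2mE.
have cN x : phi_check_r p ur <= x <= phi_hat_r p ur -> {for x, continuous N}.
  move=> /andP[ax _]; rewrite NE; apply: cvgN; apply: L1_continuous => //.
  exact: lt_le_trans ax.
have cR x : phi_check_r p ur <= x <= phi_hat_r p ur ->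
    {for x, continuous (fun x => flowP p (x, N x))}.
  move=> /andP[ax _].
  have -> : (fun x => flowP p (x, N x)) =
      (fun x => flowP p (x, L1 p x (reflect_state ur))).
    by apply/funext => z; exact: flowN.
  by apply: flowP_L1_continuous => //; exact: lt_le_trans ax.
have Qd x y : phi_hat_l p ul <= x -> x < y -> y <= phi_check_l p ul -> Q y < Q x.
  by move=> ax xy _; exact: (L1_decr p pP p_sonic ul ul_A0).
have Pi x y : phi_hat_l p ul <= x -> x < y -> y <= phi_check_l p ul ->
    flowP p (x, Q x) < flowP p (y, Q y).
  by move=> ax xy _; exact: (flowP_incr p pP p_sonic ul ul_A0).
have E1 := junction_value_left al ar _ _ _ _ Q N g al0 ar0 ab ab' cQ cN Qd Qa Qb
  Na Nb g_inv_L2m.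
have E2 := junction_value_right al ar _ _ _ _ Q N g al0 ar0 ab ab' cQ cN Qd Qa Qb
  Na Nb g_inv_L2m.
(* Only the second component of each right state is rewritten; the occurrence inside the argument of
   [g] has to stay. *)
rewrite -{2}E1 -{2}E2.
exact: (junction_iff al ar _ _ _ _ Q _ N _ g al0 ar0 ab ab' cQ cP cN cR Qd Pi
  N_incr PR_incr Qa Qb Na Nb g_inv_L2m).
Qed.

Lemma L_solution_states (v : R -> R -> R * R) :
  L_solution p al ar ul ur v -> subsonic_valued p v ->
  exists x y, [/\ L_junction x y,
    exists2 w, lax_wave1 p ul (x, Q x) w & forall t, 0 < t ->
      {ae mu, forall x, x < 0 -> v t x = w (x / t)} &
    exists2 w, lax_wave2 p (y, N y) ur w & forall t, 0 < t ->
      {ae mu, forall x, 0 < x -> v t x = w (x / t)}].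
Proof.
(* The junction condition holds at almost every time, hence at some time in []0, 1[]. One such time
   is enough, as the traces of the Lax waves are the same at all positive times. *)
move=> [[_ _ _ Phi0] [[um [wl [wlP wlE]]] [up [wr [wrP wrE]]]]] vA.
have [t [/andP[t0 _] /(_ (ltW t0))[um' [up' [tl tr PhiE]]]]] :=
  ae_meets_interval _ _ _ Phi0 (@ltr01 R).
have [_ tl'] := wlE _ t0; have [_ tr'] := wrE _ t0.
have umE : um' = um by exact: (trace_unique _ _ _ _ _ meets_ae_left tl tl').
have upE : up' = up by exact: (trace_unique _ _ _ _ _ meets_ae_right tr tr').
have [um0 umQ _] := wlP; have [up0 upN _] := wrP.
have umA : A0cl p um.
  exact: (trace_A0cl _ _ _ _ meets_ae_left tl' um0 (vA _ (ltW t0))).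
have upA : A0cl p up.
  exact: (trace_A0cl _ _ _ _ meets_ae_right tr' up0 (vA _ (ltW t0))).
have {}umE' : um = (um.1, Q um.1) by rewrite /Q -umQ; case: (um).
have {}upE' : up = (up.1, N up.1) by rewrite /N -upN; case: (up).
exists um.1, up.1; split.
- move: PhiE; rewrite umE upE => -[/eqP e1 /eqP e2].
  rewrite !subr_eq0 in e1 e2.
  split.
  + by apply/(A0cl_L1 p pP p_sonic ul ul_A0); rewrite -umQ -surjective_pairing.
  + by apply: (proj1 (A0cl_L2m _)); rewrite /N -upN -surjective_pairing.
  + by rewrite /Q /N -umQ -upN; apply/eqP.
  + by rewrite -umE' -upE'; apply/eqP.
- by exists wl; rewrite -?umE'// => t' t'0; have [] := wlE _ t'0.
- by exists wr; rewrite -?upE'// => t' t'0; have [] := wrE _ t'0.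
Qed.

Lemma lax_wave2_unique (up : R * R) (w1 w2 : R -> R * R) :
  lax_wave2 p up ur w1 -> lax_wave2 p up ur w2 ->
  exists s, forall xi, xi != s -> w1 xi = w2 xi.
Proof.
move=> /lax_wave1_reflect h1 /lax_wave1_reflect h2.
have [s sE] := lax_wave1_unique p pP _ (A0_reflect _ _ ur_A0) _ _ _ h1 h2.
exists (- s) => xi xis; have := sE (- xi); rewrite opprK.
move=> /(_ _)/(congr1 reflect_state); rewrite !reflect_stateK; apply.
by rewrite eqr_oppLR.
Qed.

(** Equal junction densities give, on each side, Lax waves that agree off one speed. At a fixed
    positive time the solutions then agree off a null set that includes two shock positions and the
    junction. *)
Lemma L_solution_unique (u v : R -> R -> R * R) : 0 < al -> 0 < ar ->
  L_solution p al ar ul ur u -> subsonic_valued p u ->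
  L_solution p al ar ul ur v -> subsonic_valued p v -> same_solution u v.
Proof.
move=> al0 ar0 uL uA vL vA t; rewrite le_eqVlt => /predU1P[<-|t0].
  have [[_ _ u0 _] _] := uL; have [[_ _ v0 _] _] := vL.
  by apply: (@filterS2 _ _ ae_filter _ _ _ _ u0 v0) => x -> ->.
have [x [y [uJ [w1 w1P u1] [w2 w2P u2]]]] := L_solution_states _ uL uA.
have [x' [y' [vJ [w1' w1P' v1] [w2' w2P' v2]]]] := L_solution_states _ vL vA.
have [xx' yy'] := L_junction_unique al0 ar0 _ _ _ _ uJ vJ.
subst x' y'.
have [s1 s1E] := lax_wave1_unique p pP ul ul_A0 _ _ _ w1P w1P'.
have [s2 s2E] := lax_wave2_unique _ _ _ w2P w2P'.
have neq z s : z != s * t -> z / t != s.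
  by apply: contra_neq => <-; rewrite divfK// gt_eqF.
have L : {ae mu, forall z, z < 0 -> u t z = v t z}.
  apply: (@filterS3 _ _ ae_filter _ _ _ _ _ (u1 _ t0) (v1 _ t0) (ae_neq (s1 * t))).
  by move=> z e1 e2 zs z0; rewrite e1// e2// s1E// neq.
have Rr : {ae mu, forall z, 0 < z -> u t z = v t z}.
  apply: (@filterS3 _ _ ae_filter _ _ _ _ _ (u2 _ t0) (v2 _ t0) (ae_neq (s2 * t))).
  by move=> z e1 e2 zs z0; rewrite e1// e2// s2E// neq.
apply: (@filterS3 _ _ ae_filter _ _ _ _ _ L Rr (ae_neq 0)) => z e1 e2.
by rewrite neq_lt => /orP[]; [exact: e1|exact: e2].
Qed.

Lemma wave_profile_bounded (u um : R * R) (w : R -> R * R) : A0 p u ->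
  wave_profile p u um w -> exists M, forall xi, `|(w xi).1| <= M /\ `|(w xi).2| <= M.
Proof.
move=> uA [_ wab _ _ _].
have [a0 _] := phi_hat_lP p p_sonic u uA.
pose C := `|L1 p (phi_hat_l p u) u| + `|L1 p (phi_check_l p u) u|.
exists (phi_check_l p u + C) => xi; have [/andP[aw wb] ->] := wab xi.
have C0 : 0 <= C by rewrite addr_ge0.
have w0 : 0 < (w xi).1 by exact: lt_le_trans aw.
have decr x y : phi_hat_l p u <= x -> x <= y -> L1 p y u <= L1 p x u.
  move=> ax; rewrite le_eqVlt => /predU1P[->//|xy].
  by rewrite ltW// (L1_decr p pP p_sonic u uA).
split; first by rewrite gtr0_norm// (le_trans wb)// lerDl.
have h1 := decr _ _ (lexx _) aw; have h2 := decr _ _ aw wb.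
rewrite ler_norml; apply/andP; split.
  have := ler_norm (- L1 p (phi_check_l p u) u); rewrite normrN.
  have := normr_ge0 (L1 p (phi_hat_l p u) u); rewrite /C in C0 *.
  lra.
have := ler_norm (L1 p (phi_hat_l p u) u).
have := normr_ge0 (L1 p (phi_check_l p u) u); rewrite /C in C0 *.
lra.
Qed.

Lemma L_solution_exists (x y : R) : L_junction x y ->
  exists u, L_solution p al ar ul ur u /\ subsonic_valued p u.
Proof.
move=> [xab yab qE pE].
have ur'A := A0_reflect p _ ur_A0.
have [wl wlP] := wave_profile_exists p pP p_sonic ul ul_A0 x xab.
rewrite phi_check_rE phi_hat_rE in yab.
have [wr wrP] := wave_profile_exists p pP p_sonic _ ur'A y yab.
have [Ml MlP] := wave_profile_bounded _ _ _ ul_A0 wlP.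
have [Mr MrP] := wave_profile_bounded _ _ _ ur'A wrP.
have [l1 l2 [l3 l3'] l4 [[sl sl0 slc] wl0 [Bl BlP]]] := wlP.
have [r1 r2 [r3 r3'] [r4 r4'] [[sr sr0 src] wr0 [Br BrP]]] := wrP.
(* The wave on the right is the mirror image, in space and in momentum, of a wave of the first
   family issued from the reflected datum. *)
pose wp xi := reflect_state (wr (- xi)).
pose up := (y, N y).
have upE : reflect_state (y, L1 p y (reflect_state ur)) = up.
  by rewrite /up /N L2mE.
pose M := Num.max Ml Mr; pose B := Num.max Bl Br.
have [a0 _] := phi_hat_lP p p_sonic ul ul_A0.
have [a0' _] := phi_hat_lP p p_sonic _ ur'A.
pose U := selfsimilar ul ur wl wp.
have wlA xi : A0cl p (wl xi).
  have [h1 h2] := l2 xi; rewrite (surjective_pairing (wl xi)) h2.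
  exact/(A0cl_L1 p pP p_sonic ul ul_A0).
have wpA xi : A0cl p (wp xi).
  apply/A0cl_reflect; have [h1 h2] := r2 (- xi).
  rewrite (surjective_pairing (wr (- xi))) h2.
  exact/(A0cl_L1 p pP p_sonic _ ur'A).
have lM xi : `|(wl xi).1| <= M /\ `|(wl xi).2| <= M.
  by have [h1 h2] := MlP xi; rewrite !le_max h1 h2.
have pM xi : `|(wp xi).1| <= M /\ `|(wp xi).2| <= M.
  by have [h1 h2] := MrP (- xi); rewrite /= normrN !le_max h1 h2 !orbT.
have pmono : monotone_fun (fun xi => (wp xi).1) /\ monotone_fun (fun xi => (wp xi).2).
  split; first exact: (monotone_fun_reflect (fun xi => (wr xi).1)).
  apply: (monotone_fun_opp (fun xi => (wr (- xi)).2)).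
  exact: (monotone_fun_reflect (fun xi => (wr xi).2)).
have pspeed : speed_bounded (fun xi => (wp xi).1) (fun xi => (wp xi).2) /\
    speed_bounded (fun xi => (wp xi).2) (fun xi => flowP p (wp xi)).
  split; first exact: (speed_bounded_reflect _ _ r4).
  have := speed_bounded_opp _ _ (speed_bounded_reflect _ _ r4').
  congr speed_bounded; apply/funext => xi.
  by rewrite opprK flowP_reflect.
have pcont xi : xi != - sr -> {for xi, continuous wp}.
  move=> xis; have cw : {for xi, continuous (fun s : R => wr (- s))}.
    apply: (continuous_comp (@oppr_continuous _ R xi)); apply: src.
    by rewrite eqr_oppLR.
  have cfst (z : R * R) : {for z, continuous (@fst R R)} by exact: cvg_fst.
  have csnd (z : R * R) : {for z, continuous (@snd R R)} by exact: cvg_snd.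
  have c1 : {for xi, continuous (fun s : R => (wr (- s)).1)}.
    exact: (continuous_comp cw (cfst _)).
  have c2 : {for xi, continuous (fun s : R => - (wr (- s)).2)}.
    exact: (cvgN (continuous_comp cw (csnd _))).
  exact: (cvg_pair c1 c2).
have wp0 : wp 0 = up by rewrite /wp oppr0 wr0 upE.
have lfar xi : xi <= - B -> wl xi = ul.
  by move=> h; rewrite BlP// (le_trans h)// lerN2 le_max lexx.
have pfar xi : B <= xi -> wp xi = ur.
  move=> h; rewrite /wp BrP ?reflect_stateK//.
  by rewrite lerN2 (le_trans _ h)// le_max lexx orbT.
have lgt0 xi : 0 < (wl xi).1 by have [] := wlA xi.
have pgt0 xi : 0 < (wp xi).1 by have [] := wpA xi.
have sr0' : 0 < - sr by rewrite oppr_gt0.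
exists U; split; last first.
  move=> t t0; apply/aeW => z; rewrite /U /selfsimilar /sides /riemann_datum.
  case: ifP => _; case: ifP => _; [exact: wlA|exact: wpA|..]; exact: A0_A0cl.
split.
  apply: (selfsimilar_weak_solution p ul ur (x, Q x) up wl wp M sl (- sr) B) => //.
  by rewrite /Phi_L /= qE pE !subrr.
split.
  exists (x, Q x), wl; split=> // t t0; split.
    by apply/aeW => z z0; rewrite /U selfsimilar_left.
  exact: (selfsimilar_left_trace ul ur (x, Q x) wl wp sl).
exists up, wp; split.
  rewrite -upE; apply: lax_wave2_reflect; rewrite reflect_stateK.
  exact: r1.
move=> t t0; split.
  by apply/aeW => z z0; rewrite /U selfsimilar_right.
exact: (selfsimilar_right_trace ul ur up wl wp (- sr)).
Qed.

End solutions.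

Theorem theorem2p4 (R : realType) (p : R -> R) (al ar : R) (ul ur : R * R)
    (p_pressure : pressure p)
    (p_sonic : sonic_densities_determined p)
    (al_gt0 : 0 < al) (ar_gt0 : 0 < ar)
    (ul_subsonic : A0 p ul) (ur_subsonic : A0 p ur) :
  let l' := l_prime p al ar ul ur in
  let l'' := l_second p al ar ul ur in
  let g := g_inv p ur in
  (exists u : R -> R -> R * R,
     [/\ L_solution p al ar ul ur u,
         subsonic_valued p u &
         forall v : R -> R -> R * R,
           L_solution p al ar ul ur v -> subsonic_valued p v ->
           same_solution u v])
  <->
  (al * flowP p (l', L1 p l' ul) <=
     ar * flowP p (g (al / ar * L1 p l' ul), al / ar * L1 p l' ul) /\
   al * flowP p (l'', L1 p l'' ul) >=
     ar * flowP p (g (al / ar * L1 p l'' ul), al / ar * L1 p l'' ul)).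
Proof.
move=> l' l'' g.
rewrite -(L_junction_iff p al ar ul ur p_pressure p_sonic ul_subsonic
  ur_subsonic al_gt0 ar_gt0).
(* Existence of a subsonic solution already produces junction states, and junction states give
   existence together with uniqueness. *)
split=> [[u [uL uA _]]|[x [y J]]].
  have [x [y [J _ _]]] := L_solution_states p al ar ul ur p_pressure p_sonic
    ul_subsonic ur_subsonic u uL uA.
  by exists x, y.
have [u [uL uA]] := L_solution_exists p al ar ul ur p_pressure p_sonic
  ul_subsonic ur_subsonic x y J.
exists u; split=> // v; exact: L_solution_unique.
Qed.
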